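(* Consider the impulsive system $$\dot x=f(x)+\varepsilon g(t,x,\varepsilon)\ \ (t\ne t_k),\qquad x(t_k+)-x(t_k-)=\varepsilon\, l_k(x(t_k-),\varepsilon)\ \ (k\in\mathbb Z),\qquad (S_\varepsilon)$$ with all the standing assumptions and notation of the context (the planar Hamiltonian vector field $f$ with its family of periodic orbits $L_h$, $h\in V$, the impulse data $t_k,l_k$, the period $T$, and $h_0\in V$ with $T(h_0)/T=m/K$, where $m,K\ge 1$ are coprime integers). Let $M$ be the function defined in the context. Then: (1) For small $\varepsilon\neq 0$, a necessary condition for the periodic orbit $L_{h_0}$ to generate a subharmonic solution of order $m$ of $(S_\varepsilon)$ is that there exists $t_0^*\in[0,T]$ such that $$M(t_0^*,h_0)=0 .$$ That is: if for all sufficiently small $\varepsilon\ne0$ the system $(S_\varepsilon)$ has an $mT$-periodic solution $x_\varepsilon$ with $\sup_{t\in\mathbb R}\operatorname{dist}(x_\varepsilon(t),L_{h_0})\to0$ as $\varepsilon\to0$, then such a $t_0^*$ exists. (2) Suppose $t_0^*\in[0,T]$ satisfies $M(t_0^*,h_0)=0$, and suppose further that $$\Omega'(h_0)\neq 0,\qquad \frac{\partial M}{\partial \bar t_0}(t_0^*,h_0)\neq 0 .$$ Then there is $\varepsilon_0>0$ such that for every $\varepsilon$ with $0<|\varepsilon|<\varepsilon_0$ the system $(S_\varepsilon)$ has a subharmonic (if $m>1$) or harmonic (if $m=1$) solution $x_\varepsilon(t)$ of order $m$, with the property $$\lim_{\varepsilon\to0}x_\varepsilon(t)=q(t-t_0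^*,h_0).$$
   Context: Setting. $x=(x_1,x_2)^\top\in\mathbb R^2$, and $\varepsilon\in\mathbb R$ is a small parameter. The functions $f(x)$ and $g(t,x,\varepsilon)$ are of class $C^{r_0}$ with $r_0\ge3$, and $g$ is periodic in $t$ of period $T_1>0$. There is a function $H:\mathbb R^2\to\mathbb R$ of class $C^{r_1}$, $r_1\ge4$, with $f=(H_{x_2},-H_{x_1})^\top$; $DH=(H_{x_1},H_{x_2})$ denotes the row-vector gradient. There is an open interval $V$ such that for each $h\in V$ the level set $\{H=h\}$ contains a smooth closed curve $L_h$ which is a periodic orbit of $\dot x=f(x)$ with period $T(h)$. Put $\Omega(h)=2\pi/T(h)$. For each $h\in V$, $t\mapsto q(t,h)$ is a $T(h)$-periodic solution of $\dot x=f(x)$ parametrizing $L_h$ (by time), where the parametrization is chosen so that $G(\theta,h)=q(\theta/\Omega(h),h)$ ($2\pi$-periodic in $\theta$) is of class $C^{r_0}$ in $(\theta,h)$. Impulses. (i) $\cdots<t_{-1}<t_0<t_1<\cdots$ with $t_n\to\pm\infty$ as $n\to\pm\infty$. (ii) There are a constant $T_2>0$ and an integer $\nu\ge1$ with $t_{k+\nu}-t_k=T_2$ and $l_{k+\nu}=l_k$ for all $k\in\mathbb Z$. (iii) $T_2/T_1=p/s$ with $p,s\ge1$ coprime integers; put $T=pT_1=sT_2$, so that the system $(S_\varepsilon)$ is $T$-periodic in time. (iv) Each $l_k(x,\varepsilon)\in\mathbb R^2$ is $C^{r_0}$ in $x$ and continuous in $(x,\varepsilon)$. Resonance. $h_0\in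 V$ satisfies $T(h_0)/T=m/K$ with $m,K\ge1$ coprime integers. Solutions of $(S_\varepsilon)$ are piecewise continuous functions of $t$: they satisfy the differential equation on each interval $(t_{k-1},t_k)$, are continuous from the left at each $t_k$, and have discontinuities of the first kind at $t_k$ satisfying the jump condition. A solution $x(t)$ with $x((t+mT)\pm)=x(t\pm)$ for all $t\in\mathbb R$ (i.e. $mT$-periodic) is called harmonic if $m=1$ and subharmonic of order $m$ if $m>1$. Melnikov function. For $r\in V$ and $\bar t_0\in(t_{j-1},t_j]$, $j\in\mathbb Z$, $$M(\bar t_0,r)=\int_{\bar t_0}^{\bar t_0+mT}DH(q(\tau-\bar t_0,r))\,g(\tau,q(\tau-\bar t_0,r),0)\,d\tau+\sum_{k=j}^{j+ms\nu-1}DH(q(t_k-\bar t_0,r))\,l_k(q(t_k-\bar t_0,r),0).$$ *)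

(* Defs.v *)
From HB Require Import structures.
From mathcomp Require Import all_boot all_order all_algebra.
From mathcomp Require Import all_classical all_reals all_analysis.

Set Implicit Arguments.
Unset Strict Implicit.
Unset Printing Implicit Defensive.

Import Order.TTheory GRing.Theory Num.Theory.
Import numFieldNormedType.Exports.

Local Open Scope classical_set_scope.
Local Open Scope ring_scope.

(* Class C^k on an open set U.  Stated with directional derivatives, which for
   finite-dimensional E is the usual notion: taking v along a basis, all
   iterated partial derivatives of order <= k exist and are continuous on U. *)
Fixpoint class_C {R : realType} {E W : normedModType R} (k : nat) (U : set E)
    (F : E -> W) : Prop :=
  (forall x, U x -> {for x, continuous F}) /\
  match k with
  | 0 => True
  | k'.+1 => forall v : E,
      (forall x, U x -> derivable F x v) /\ class_C k' U (fun x => 'D_v F x)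
  end.

Definition partial {R : realType} (H : 'cV[R]_2 -> R) (i : 'I_2)
  (x : 'cV[R]_2) : R := 'D_(delta_mx i 0) H x.

Definition DH {R : realType} (H : 'cV[R]_2 -> R) (x : 'cV[R]_2) : 'rV[R]_2 :=
  \row_(i < 2) partial H i x.

Definition hamiltonian_field {R : realType} (H : 'cV[R]_2 -> R)
    (x : 'cV[R]_2) : 'cV[R]_2 :=
  \col_(i < 2) (if i == 0 then partial H 1 x else - partial H 0 x).

Definition Omega {R : realType} (Tper : R -> R) (h : R) : R :=
  2 * pi / Tper h.

(* [q s h] is q(s,h), with s the time and h the energy. *)
Record periodic_family {R : realType} (r0 : nat) (f : 'cV[R]_2 -> 'cV[R]_2)
    (H : 'cV[R]_2 -> R) (V : set R) (L : R -> set 'cV[R]_2) (Tper : R -> R)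
    (q : R -> R -> 'cV[R]_2) : Prop := PeriodicFamily {
  family_level : forall h, V h -> L h `<=` [set x | H x = h];
  family_param : forall h, V h -> L h = range (fun s => q s h);
  (* L h is a smooth curve traced by a periodic orbit, not an equilibrium *)
  family_regular : forall h x, V h -> L h x -> f x != 0;
  family_solution : forall (h s : R), V h ->
    is_derive s (1 : R) (fun s' => q s' h) (f (q s h));
  family_period_gt0 : forall h, V h -> 0 < Tper h;
  family_periodic : forall (h s : R), V h -> q (s + Tper h) h = q s h;
  family_smooth :
    class_C r0 [set z : R * R | V z.2]
      (fun z : R * R => q (z.1 / Omega Tper z.2) z.2) }.

Record impulse_data {R : realType} (r0 : nat) (T2 : R) (nu : nat)
    (t : int -> R) (l : int -> 'cV[R]_2 -> R -> 'cV[R]_2) : Prop :=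
  ImpulseData {
  impulse_incr : forall i j : int, i < j -> t i < t j;
  impulse_pinfty : t n%:Z @[n --> \oo] --> +oo;
  impulse_ninfty : t (- n%:Z) @[n --> \oo] --> -oo;
  impulse_T2_gt0 : 0 < T2;
  impulse_nu_gt0 : (0 < nu)%N;
  impulse_t_periodic : forall k : int, t (k + nu%:Z) - t k = T2;
  impulse_l_periodic : forall k : int, l (k + nu%:Z) = l k;
  impulse_smooth : forall (k : int) (eps : R),
    class_C r0 setT (fun x : 'cV[R]_2 => l k x eps);
  impulse_continuous : forall k : int,
    continuous (fun z : 'cV[R]_2 * R => l k z.1 z.2) }.

Definition impulsive_solution {R : realType} (f : 'cV[R]_2 -> 'cV[R]_2)
    (g : R -> 'cV[R]_2 -> R -> 'cV[R]_2) (t : int -> R)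
    (l : int -> 'cV[R]_2 -> R -> 'cV[R]_2) (eps : R) (x : R -> 'cV[R]_2) :
    Prop :=
  (forall (k : int) (s : R), t (k - 1) < s < t k ->
     is_derive s (1 : R) x (f (x s) + eps *: g s (x s) eps)) /\
  (forall k : int, exists xm xp : 'cV[R]_2,
     [/\ x s @[s --> (t k)^'-] --> xm,
         x s @[s --> (t k)^'+] --> xp,
         x (t k) = xm
       & xp - xm = eps *: l k xm eps]).

(* x((s+P)-) = x(s-) and x((s+P)+) = x(s+); both one-sided limits exist
   everywhere for an [impulsive_solution], so [lim] is never a default value. *)
Definition onesided_periodic {R : realType} (P : R) (x : R -> 'cV[R]_2) :
    Prop :=
  forall s : R,
    lim (x u @[u --> (s + P)^'-]) = lim (x u @[u --> s^'-]) /\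
    lim (x u @[u --> (s + P)^'+]) = lim (x u @[u --> s^'+]).

Definition periodic_solution {R : realType} (f : 'cV[R]_2 -> 'cV[R]_2)
    (g : R -> 'cV[R]_2 -> R -> 'cV[R]_2) (t : int -> R)
    (l : int -> 'cV[R]_2 -> R -> 'cV[R]_2) (P eps : R) (x : R -> 'cV[R]_2) :
    Prop :=
  impulsive_solution f g t l eps x /\ onesided_periodic P x.

Definition harmonic_solution {R : realType} (f : 'cV[R]_2 -> 'cV[R]_2)
    (g : R -> 'cV[R]_2 -> R -> 'cV[R]_2) (t : int -> R)
    (l : int -> 'cV[R]_2 -> R -> 'cV[R]_2) (T eps : R) (x : R -> 'cV[R]_2) :
    Prop :=
  periodic_solution f g t l T eps x.

Definition subharmonic_solution {R : realType} (f : 'cV[R]_2 -> 'cV[R]_2)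
    (g : R -> 'cV[R]_2 -> R -> 'cV[R]_2) (t : int -> R)
    (l : int -> 'cV[R]_2 -> R -> 'cV[R]_2) (T : R) (m : nat) (eps : R)
    (x : R -> 'cV[R]_2) : Prop :=
  (1 < m)%N /\ periodic_solution f g t l (m%:R * T) eps x.

Definition melnikov {R : realType} (H : 'cV[R]_2 -> R)
    (g : R -> 'cV[R]_2 -> R -> 'cV[R]_2) (t : int -> R)
    (l : int -> 'cV[R]_2 -> R -> 'cV[R]_2) (q : R -> R -> 'cV[R]_2)
    (T : R) (s nu m : nat) (tb r : R) : R :=
  (* the unique j with tb in (t_{j-1}, t_j] *)
  let j : int := xget 0 [set j : int | t (j - 1) < tb <= t j] in
  \int[lebesgue_measure]_(tau in `[tb, tb + m%:R * T])
     (DH H (q (tau - tb) r) *m g tau (q (tau - tb) r) 0) 0 0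
  + \sum_(i < m * s * nu)
     (DH H (q (t (j + i%:Z) - tb) r)
        *m l (j + i%:Z) (q (t (j + i%:Z) - tb) r) 0) 0 0.

(* sup over time of the distance (in the maximum norm of R^2, equivalent to the
   Euclidean one) from the trajectory x to the set A *)
Definition sup_dist {R : realType} (A : set 'cV[R]_2) (x : R -> 'cV[R]_2) :
    \bar R :=
  ereal_sup (range (fun s : R => edist_inf A (x s))).

(* Main.v *)
(** Along a solution of the impulsive system the energy [H] changes over [m T]
    by [eps M + o(eps)], because [DH f = 0] and the solution stays close to an
    unperturbed orbit (Gronwall between impulses). For periodic solutions
    converging to [L h0] this gain is 0, and compactness of the circle of phases
    yields a zero of [M].

    Conversely, start the system from the point of phase [tb] and energy [h] of
    the unperturbed family. The end point agrees with the starting point as soon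
    as it has the same energy and the same component along [f]. The first
    defect, divided by [eps], is close to [M tb h0], which changes sign at
    [t0]; the second is close to the drift [m T - K T(h)] times a positive
    factor, which changes sign at [h0] since [Omega' (h0) <> 0]. The [l k] are
    only continuous in [eps], which excludes the implicit function theorem, and
    so a common zero is obtained from the Poincare-Miranda theorem, itself
    deduced from a signed count of the edges of a coloured grid. *)

Require Import Defs.
From HB Require Import structures.
From mathcomp Require Import all_boot all_order all_algebra.
From mathcomp Require Import all_classical all_reals all_analysis.
From mathcomp Require Import ring lra zify.

Import Order.TTheory GRing.Theory Num.Theory.
Import numFieldNormedType.Exports.

Local Open Scope classical_set_scope.
Local Open Scope ring_scope.

(** * Calculus in the plane *)

(** Every perturbation estimate is stated relative to one fixed unperturbed orbit: all chains within
    distance [d] of it gain [e M] up to [kappa |e|]. Nonvanishing of [M] at a single phase thus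
    excludes closed chains from a whole neighbourhood, which is what compactness consumes, and a
    sign of [M] at phase [t0 - delta] or [t0 + delta] and energy [h0] carries over to all starting
    energies close to [h0]. Hence the order of choices in the converse: [delta] first, then [eta]
    depending on [delta], and the bound on [eps] last.

    The two defects live on different scales. The energy defect is of order [eps], and closeness to
    the orbit alone does not decide its sign; the tangential defect is already nonzero for [eps = 0]
    on the sides [h0 - eta] and [h0 + eta], so there closeness is enough.

    An [impulsive_chain] replaces a piecewise continuous solution by finitely many functions
    continuous on the whole line, which turns one-sided limits into plain values; the translation is
    made once in each direction. *)

Lemma continuous_primitive {R : realType} (f : R -> R) (a : R) :
  continuous f ->
  exists W : R -> R, forall s, a < s -> is_derive s (1 : R) W (f s).
Proof.
move=> cf; exists (fun x => \int[lebesgue_measure]_(y in `[a, x]) f y) => s as_.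
have ss : s < s + 1 by rewrite ltrDl.
have fi : lebesgue_measure.-integrable `[a, s + 1] (EFin \o f).
  apply: continuous_compact_integrable; first exact: segment_compact.
  exact: continuous_subspaceT.
have [dW W's] := @continuous_FTC1_closed R f a s (s + 1) ss fi as_ (cf s).
by rewrite -W's derive1E; exact: derivableP.
Qed.

Lemma bounded_derive_increment {R : realType} (w dw : R -> R) (a b C : R) :
  a <= b -> continuous w ->
  (forall s, a < s < b -> is_derive s (1 : R) w (dw s)) ->
  (forall s, a < s < b -> `|dw s| <= C) -> `|w b - w a| <= C * (b - a).
Proof.
move=> ab cw dwE dwC.
have [<-|anb] := eqVneq a b; first by rewrite !subrr normr0 mulr0.
have ltab : a < b by rewrite lt_neqAle anb.
have dwI x : x \in `]a, b[ -> is_derive x 1 w (dw x).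
  by rewrite in_itv/=; exact: dwE.
have cwab : {within `[a, b], continuous w} by exact: continuous_subspaceT.
have [c cab ->] := MVT ltab dwI cwab.
rewrite normrM [`|b - a|]ger0_norm ?subr_ge0// ler_wpM2r ?subr_ge0//.
by apply: dwC; rewrite in_itv/= in cab.
Qed.

Lemma mx_entry_norm {R : realType} (v : 'cV[R]_2) (i : 'I_2) :
  `|v i 0| <= `|v|.
Proof.
rewrite [leRHS]/Num.Def.normr/= mx_normrE.
exact: (le_bigmax _ (fun i => `|v i.1 i.2|) (i, 0)).
Qed.

Lemma cV2_norm_le {R : realType} (v : 'cV[R]_2) (r : R) : 0 <= r ->
  (forall i, `|v i 0| <= r) -> `|v| <= r.
Proof.
move=> r0 vr; rewrite [leLHS]/Num.Def.normr/= mx_normrE.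
by apply: bigmax_le => // -[i j] _ /=; rewrite (ord1 j).
Qed.

Lemma continuous_cV2P {R : realType} (T : topologicalType)
    (F : T -> 'cV[R]_2) (x : T) :
  {for x, continuous F} <-> forall i, {for x, continuous (fun y => F y i 0)}.
Proof.
split=> [cF i|cF].
  exact: (continuous_comp cF (@coord_continuous R 2 1 i 0 (F x))).
apply/cvgrPdist_le => e e0; near=> y.
apply: cV2_norm_le => [|i]; first exact: ltW.
rewrite !mxE; move: i; near: y; apply: filter_forall => i.
by have /cvgrPdist_le/(_ e e0) := cF i.
Unshelve. all: by end_near. Qed.

Lemma is_derive_entry {R : realType} (V : normedModType R) (F : V -> 'cV[R]_2)
    (x v : V) (d : 'cV[R]_2) (i : 'I_2) :
  is_derive x v F d -> is_derive x v (fun y => F y i 0) (d i 0).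
Proof.
move=> dF; have dF1 : derivable F x v by [].
have := derive_mx dF1; rewrite derive_val => ->; rewrite mxE.
apply: derivableP; exact: (derivable_mxP _ _ _).1.
Qed.

Lemma is_derive_cV2 {R : realType} (V : normedModType R) (F : V -> 'cV[R]_2)
    (x v : V) (d : 'cV[R]_2) :
  (forall i, is_derive x v (fun y => F y i 0) (d i 0)) -> is_derive x v F d.
Proof.
move=> dF; have dF1 : derivable F x v.
  by apply/derivable_mxP => i j; rewrite (ord1 j); have := dF i.
suff -> : d = 'D_v F x by exact: derivableP.
rewrite derive_mx//; apply/matrixP => i j; rewrite mxE (ord1 j).
by rewrite derive_val.
Qed.

Lemma bounded_derive_increment_cV2 {R : realType} (w dw : R -> 'cV[R]_2)
    (a b C : R) :
  a <= b -> 0 <= C -> continuous w ->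
  (forall s, a < s < b -> is_derive s (1 : R) w (dw s)) ->
  (forall s, a < s < b -> `|dw s| <= C) -> `|w b - w a| <= C * (b - a).
Proof.
move=> ab C0 cw dwE dwC.
apply: cV2_norm_le => [|i]; first by rewrite mulr_ge0// subr_ge0.
rewrite !mxE.
apply: (@bounded_derive_increment R (fun s => w s i 0) (fun s => dw s i 0)) => //.
- by move=> s; apply: (continuous_cV2P _ _ _).1; exact: cw.
- by move=> s sab; exact: is_derive_entry (dwE s sab).
- by move=> s sab; apply: le_trans (dwC s sab); exact: mx_entry_norm.
Qed.

Definition mk2 {R : realType} (a b : R) : 'cV[R]_2 :=
  \col_(i < 2) (if i == 0 then a else b).

Lemma cV2_eq {R : realType} (u v : 'cV[R]_2) :
  u 0 0 = v 0 0 -> u 1 0 = v 1 0 -> u = v.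
Proof.
move=> u0 u1; apply/matrixP => i j; rewrite (ord1 j).
case: i => -[|[|//]] hi.
- by rewrite (_ : Ordinal hi = 0) //; exact: val_inj.
- by rewrite (_ : Ordinal hi = 1) //; exact: val_inj.
Qed.

Lemma forall_I2 (P : 'I_2 -> Prop) : P 0 -> P 1 -> forall i, P i.
Proof.
move=> P0 P1 -[[|[|//]] hi].
- by rewrite (_ : Ordinal hi = 0) //; exact: val_inj.
- by rewrite (_ : Ordinal hi = 1) //; exact: val_inj.
Qed.

Lemma continuous_pairing (X Y Z : topologicalType) (f : X -> Y) (g : X -> Z) (x : X) :
  {for x, continuous f} -> {for x, continuous g} ->
  {for x, continuous (fun y => (f y, g y))}.
Proof. by move=> cf cg; exact: (cvg_pair cf cg). Qed.

Lemma continuous_comp_at (X Y Z : topologicalType) (f : X -> Y) (g : Y -> Z) (x : X) :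
  {for x, continuous f} -> {for f x, continuous g} ->
  {for x, continuous (fun y => g (f y))}.
Proof. by move=> cf cg; exact: (cvg_comp _ _ cf cg). Qed.

Lemma near_norm_le {R : realType} (V : normedModType R) (x : V) (e : R) :
  0 < e -> \forall y \near x, `|x - y| <= e.
Proof.
by move=> e0; apply/nbhs_ballP; exists e => // y; rewrite -ball_normE /= => /ltW.
Qed.

Lemma is_derive_line {R : realType} (E W : normedModType R) (F : E -> W)
    (x v : E) (s : R) :
  derivable F (x + s *: v) v ->
  is_derive s (1 : R) (fun u => F (x + u *: v)) ('D_v F (x + s *: v)).
Proof.
move=> dF.
have eqQ : (fun h : R => h^-1 *: (((fun u : R => F (x + u *: v)) \o shift s) (h *: (1
  : R))
      - F (x + s *: v))) =
    (fun h : R => h^-1 *: ((F \o shift (x + s *: v)) (h *: v) - F (x + s *: v))).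
  apply/funext => h /=; congr (_ *: (F _ - _)).
  by rewrite [h *: 1]mulr1 scalerDl addrCA addrA.
split; first by rewrite /derivable eqQ.
by rewrite /derive eqQ.
Qed.

(** The mean value theorem is applied to [s -> phi (x + s c e_i)] on [[0, 1]], which treats both
    signs of [c] at once. *)
Lemma partial_mean_value {R : realType} (phi : 'cV[R]_2 -> R) (i : 'I_2)
    (x : 'cV[R]_2) (c : R) :
  (forall y, derivable phi y (delta_mx i 0)) ->
  exists2 th : R, 0 <= th <= 1 &
    phi (x + c *: delta_mx i 0) - phi x =
    c * partial phi i (x + (th * c) *: delta_mx i 0).
Proof.
move=> dphi.
pose psi (s : R) := phi (x + s *: delta_mx i 0).
have dpsi (s : R) : is_derive s (1 : R) psi (partial phi i (x + s *: delta_mx i 0)).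
  exact: is_derive_line.
have dcomp (s : R) : is_derive s (1 : R) (psi \o (fun s => s * c))
    (c * partial phi i (x + (s * c) *: delta_mx i 0)).
  have ds : is_derive s (1 : R) (fun s : R => s * c) c.
    apply: (is_derive_eq (is_deriveM (is_derive_id s 1) (is_derive_cst c s 1))).
    by rewrite scaler0 add0r [c *: 1]mulr1.
  have := @is_derive1_comp R psi (fun s => s * c) s _ _ (dpsi (s * c)) ds.
  by rewrite mulrC.
have cont : {within `[0, 1], continuous (psi \o (fun s => s * c))}.
  apply: continuous_subspaceT => s; apply: differentiable_continuous.
  by apply/derivable1_diffP; have := dcomp s.
have [th th01] := MVT_segment ler01 (fun s _ => dcomp s) cont.
rewrite /psi/= mul1r mul0r scale0r addr0 subr0 mulr1 => ->.
by exists th => //; rewrite in_itv/= in th01.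
Qed.

Lemma convex_norm_le {R : realType} (a c th B : R) : 0 <= th <= 1 ->
  `|a| <= B -> `|a + c| <= B -> `|a + th * c| <= B.
Proof.
move=> /andP[th0 th1]; rewrite !ler_norml => /andP[a1 a2] /andP[c1 c2].
by apply/andP; split; nra.
Qed.

(** The move from [x] to [x + v] is made one coordinate at a time, with one mean value point per
    leg. Both points lie in the coordinate box spanned by [x] and [x + v], hence in every max-norm
    ball around 0 that contains these two corners. *)
Lemma partial_increment {R : realType} (phi : 'cV[R]_2 -> R) (x v : 'cV[R]_2) :
  (forall y i, derivable phi y (delta_mx i 0)) ->
  exists xi : 'I_2 -> 'cV[R]_2,
    [/\ forall i, `|xi i - x| <= `|v|,
        forall i B, `|x| <= B -> `|x + v| <= B -> `|xi i| <= B
      & phi (x + v) - phi x = \sum_(i < 2) partial phi i (xi i) * v i 0].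
Proof.
move=> dphi.
have [t0 t01 E0] := partial_mean_value _ 0 x (v 0 0) (fun y => dphi y 0).
set y := x + v 0 0 *: delta_mx 0 0 in E0.
have [t1 t11 E1] := partial_mean_value _ 1 y (v 1 0) (fun y => dphi y 1).
have xvE : y + v 1 0 *: delta_mx 1 0 = x + v.
  by apply: cV2_eq; rewrite !mxE/=; ring.
(* Row [i] lists the fractions of the coordinates of [v] travelled at the [i]-th mean value point:
   [(t0, 0)] on the first leg, [(1, t1)] on the second. *)
pose th (i j : 'I_2) : R := if i == 0 then (if j == 0 then t0 else 0)
   else (if j == 0 then 1 else t1).
have th01 i j : 0 <= th i j <= 1.
  by rewrite /th; case: (i == 0); case: (j == 0); rewrite ?lexx ?ler01.
pose xi (i : 'I_2) := x + \col_(j < 2) (th i j * v j 0).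
exists xi; split.
- move=> i; rewrite /xi addrC addKr; apply: cV2_norm_le => // j.
  rewrite mxE normrM; have /andP[h0 h1] := th01 i j.
  by rewrite ger0_norm// (le_trans (ler_piMl _ h1))// mx_entry_norm.
- move=> i B xB xvB; apply: cV2_norm_le => [|j]; first exact: le_trans xB.
  rewrite !mxE; apply: convex_norm_le => //.
    by apply: le_trans xB; exact: mx_entry_norm.
  by apply: le_trans xvB; have := mx_entry_norm (x + v) j; rewrite !mxE.
- rewrite big_ord_recl big_ord1 -xvE -(subrK (phi y) (phi (_ + _))) -addrA E0 E1.
  rewrite addrC mulrC [v 1 0 * _]mulrC; congr (partial _ _ _ * _ + partial _ _ _ * _).
  + by apply: cV2_eq; rewrite !mxE/= /th/=; ring.
  + by exact: val_inj.
  + by apply: cV2_eq; rewrite !mxE/= /th/=; ring.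
  + by congr (v _ _); exact: val_inj.
Qed.

(** The difference quotient of [phi \o x] is a sum of partial derivatives at mean value points,
    which tend to [x s], times the difference quotients of the coordinates; continuity of the
    partial derivatives gives the limit. *)
Lemma is_derive_comp_partial {R : realType} (phi : 'cV[R]_2 -> R)
    (x : R -> 'cV[R]_2) (s : R) (d : 'cV[R]_2) :
  (forall y i, derivable phi y (delta_mx i 0)) ->
  (forall i, continuous (partial phi i)) ->
  is_derive s (1 : R) x d ->
  is_derive s (1 : R) (phi \o x) (\sum_(i < 2) partial phi i (x s) * d i 0).
Proof.
move=> dphi cphi dx.
pose v (h : R) := x (h *: 1 + s) - x s.
have /choice[xi xiP] : forall h, exists xi : 'I_2 -> 'cV[R]_2,
    (forall i, `|xi i - x s| <= `|v h|) /\
    phi (x (h *: 1 + s)) - phi (x s) = \sum_(i < 2) partial phi i (xi i) * v h i 0.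
  move=> h; have [xi [h1 _ h2]] := partial_increment phi (x s) (v h) dphi.
  by exists xi; split => //; rewrite -h2 /v [x s + _]addrC subrK.
have cvgv : v h @[h --> 0^'] --> (0 : 'cV[R]_2).
  have cx : {for s, continuous x}.
    by apply: differentiable_continuous; apply/derivable1_diffP; have := dx.
  have c0 : (h *: 1 + s) @[h --> (0:R)^'] --> s.
    have c0 : {for 0, continuous (fun h : R => h *: (1 : R) + s)}.
      by apply: cvgD; [apply: cvgM; [exact: cvg_id|exact: cvg_cst]|exact: cvg_cst].
    have h0 : h @[h --> (0 : R)^'] --> (0 : R) by exact: cvg_within.
    have := cvg_comp _ _ h0 c0.
    by rewrite scale0r add0r.
  rewrite -(subrr (x s)); apply: cvgB; last exact: cvg_cst.
  exact: (cvg_comp _ _ c0 cx).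
have cvgxi i : xi h i @[h --> 0^'] --> x s.
  apply/cvgrPdist_le => e e0; near=> h.
  rewrite distrC; apply: le_trans ((xiP h).1 i) _.
  near: h; have /cvgrPdist_le/(_ e e0) := cvgv.
  by apply: filterS => h; rewrite sub0r normrN.
have cvgq i : (h^-1 * v h i 0) @[h --> 0^'] --> d i 0.
  have [dd dE] := is_derive_entry _ _ _ _ _ i dx.
  rewrite -dE; move: dd; rewrite /derivable /derive.
  by under eq_fun do rewrite /= -[_ *: (_ - _)]/(_ * _);
    under [X in _ -> X @ _ --> _]eq_fun do rewrite !mxE.
have lim : (h^-1 *: (((phi \o x) \o shift s) (h *: 1) - (phi \o x) s)) @[h --> 0^'] -->
    \sum_(i < 2) partial phi i (x s) * d i 0.
  have -> : (fun h => h^-1 *: (((phi \o x) \o shift s) (h *: 1) - (phi \o x) s)) =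
     (fun h => partial phi 0 (xi h 0) * (h^-1 * v h 0 0) +
               partial phi 1 (xi h 1) * (h^-1 * v h 1 0)).
    apply/funext => h /=; rewrite (xiP h).2 big_ord_recl big_ord1.
    rewrite (_ : lift _ _ = 1); last exact: val_inj.
    by rewrite -[_ *: _]/(_ * _) mulrDr !(mulrCA h^-1).
  rewrite big_ord_recl big_ord1 (_ : lift _ _ = 1); last exact: val_inj.
  suff cvgi i : (partial phi i (xi h i) * (h^-1 * v h i 0)) @[h --> 0^'] -->
      partial phi i (x s) * d i 0 by apply: cvgD.
  apply: cvgM; last exact: cvgq.
  exact: (cvg_comp _ _ (cvgxi i) (cphi i (x s))).
split; first by apply/cvg_ex; exists (\sum_(i < 2) partial phi i (x s) * d i 0).
exact/cvg_lim.
Unshelve. all: by end_near. Qed.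

Lemma partial_lipschitz {R : realType} (phi : 'cV[R]_2 -> R) (B C : R) :
  (forall y i, derivable phi y (delta_mx i 0)) ->
  (forall y i, `|y| <= B -> `|partial phi i y| <= C) ->
  forall x y, `|x| <= B -> `|y| <= B -> `|phi x - phi y| <= (2 * C) * `|x - y|.
Proof.
move=> dphi phiC x y xB yB.
have [xi [_ xiB E]] := partial_increment phi y (x - y) dphi.
rewrite addrC subrK in xiB E; rewrite E; apply: le_trans (ler_norm_sum _ _ _) _.
apply: (@le_trans _ _ (\sum_(i < 2) C * `|x - y|)).
  apply: ler_sum => i _; rewrite normrM ler_pM//; last exact: mx_entry_norm.
  by apply: phiC; exact: xiB.
by rewrite big_ord_recl big_ord1; lra.
Qed.

(** * Gronwall inequality and Picard theorem *)

Definition clamp {R : realType} (a b x : R) : R := Num.max a (Num.min b x).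

Lemma clamp_lipschitz {R : realType} (a b x y : R) :
  `|clamp a b x - clamp a b y| <= `|x - y|.
Proof.
rewrite /clamp /Order.max /Order.min.
by rewrite ler_norml; case: (lerP 0 (x - y)) => h0;
  [rewrite (ger0_norm h0)|rewrite (ltr0_norm h0)];
  case: (ltP b x) => h1; case: (ltP b y) => h2;
  case: ltP => h3; case: ltP => h4; apply/andP; split; lra.
Qed.

Lemma clamp_itv {R : realType} (a b x : R) : a <= b -> a <= clamp a b x <= b.
Proof.
by move=> ab; rewrite /clamp le_max lexx/= ge_max ab/= ge_min lexx.
Qed.

Lemma clamp_id {R : realType} (a b x : R) : a <= x <= b -> clamp a b x = x.
Proof.
move=> /andP[ax xb]; rewrite /clamp /Order.min.
by case: ltP => [bx|_]; [lra|rewrite /Order.max; case: ltP => // ?; lra].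
Qed.

(** A nearest-point retraction onto the box of radius [B]. It does not increase max-norm distances,
    so precomposition with it turns a Lipschitz bound on the box into a global one. *)
Definition clampV {R : realType} (B : R) (x : 'cV[R]_2) : 'cV[R]_2 :=
  \col_(i < 2) clamp (- B) B (x i 0).

Lemma clampV_lipschitz {R : realType} (B : R) (x y : 'cV[R]_2) :
  `|clampV B x - clampV B y| <= `|x - y|.
Proof.
apply: cV2_norm_le => // i; rewrite !mxE.
apply: le_trans (clamp_lipschitz _ _ _ _) _.
by have := mx_entry_norm (x - y) i; rewrite !mxE.
Qed.

Lemma clampV_norm {R : realType} (B : R) (x : 'cV[R]_2) :
  0 <= B -> `|clampV B x| <= B.
Proof.
move=> B0; apply: cV2_norm_le => // i; rewrite mxE ler_norml.
by apply: clamp_itv; lra.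
Qed.

Lemma clampV_id {R : realType} (B : R) (x : 'cV[R]_2) :
  `|x| <= B -> clampV B x = x.
Proof.
move=> xB; apply/matrixP => i j; rewrite mxE (ord1 j) clamp_id//.
by rewrite -ler_norml; apply: le_trans xB; exact: mx_entry_norm.
Qed.

Lemma locally_lipschitz_continuous {R : realType} (E W : normedModType R)
    (F : E -> W) (L : R) (x : E) :
  (forall y, `|x - y| <= 1 -> `|F x - F y| <= L * `|x - y|) ->
  {for x, continuous F}.
Proof.
move=> lipF; apply/cvgrPdist_le => e e0.
have L0 : 0 < `|L| + 1 by rewrite ltr_wpDl.
near=> y; have xy1 : `|x - y| <= 1 by near: y; exact: near_norm_le.
apply: le_trans (lipF y xy1) _.
apply: (@le_trans _ _ ((`|L| + 1) * `|x - y|)).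
  by rewrite ler_wpM2r// (le_trans (ler_norm L))// lerDl.
by rewrite mulrC -ler_pdivlMr//; near: y; apply: near_norm_le; exact: divr_gt0.
Unshelve. all: by end_near. Qed.

Lemma lipschitz_continuous {R : realType} (E W : normedModType R) (F : E -> W)
    (L : R) :
  (forall x y, `|F x - F y| <= L * `|x - y|) -> continuous F.
Proof. by move=> lipF x; apply: (@locally_lipschitz_continuous _ _ _ _ L). Qed.

Lemma continuous_clamp {R : realType} (a b : R) : continuous (clamp a b).
Proof.
apply: (@lipschitz_continuous R R^o R^o _ 1) => x y.
by rewrite mul1r; exact: clamp_lipschitz.
Qed.

Lemma continuous_clampV {R : realType} (B : R) : continuous (@clampV R B).
Proof.
by apply: (@lipschitz_continuous R _ _ _ 1) => x y; rewrite mul1r clampV_lipschitz.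
Qed.

(** The product [u s * expR (- C * (s - a))] has derivative at most 0, whatever the signs of [u] and
    [C]. *)
Lemma gronwall_scalar {R : realType} (u du : R -> R) (a b C : R) :
  continuous u ->
  (forall s, a < s < b -> is_derive s (1 : R) u (du s)) ->
  (forall s, a < s < b -> du s <= C * u s) ->
  forall s, a <= s <= b -> u s <= u a * expR (C * (s - a)).
Proof.
move=> cu duE duC s /andP[as_ sb].
pose e (r : R) := expR (- C * (r - a)).
have de (r : R) : is_derive r (1 : R) e (- C * e r).
  have dl : is_derive r (1 : R) (fun r : R => - C * (r - a)) (- C).
    have dr : is_derive r (1 : R) (fun r : R => r - a) 1.
      apply: (is_derive_eq (is_deriveB (is_derive_id r 1) (is_derive_cst a r 1))).
      by rewrite subr0.
    apply: (is_derive_eq (is_deriveM (is_derive_cst (- C) r 1) dr)).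
    by rewrite scaler0 addr0 [_ *: 1]mulr1.
  have := @is_derive1_comp R expR (fun r => - C * (r - a)) r _ _ (is_derive_expR _) dl.
  by rewrite mulrC.
have ce : continuous e.
  by move=> r; apply: differentiable_continuous; apply/derivable1_diffP; have := de r.
have dv r : a < r < b -> is_derive r (1 : R) (u * e) ((du r - C * u r) * e r).
  move=> rab; have := duE r rab => dur.
  by apply: (is_derive_eq (is_deriveM dur (de r))); rewrite -![_ *: _]/(_ * _); ring.
have cv : {within `[a, s], continuous (u * e)}.
  by apply: continuous_subspaceT => r; apply: cvgM; [exact: cu|exact: ce].
have dvI r : r \in `]a, s[ -> is_derive r 1 (u * e) ((du r - C * u r) * e r).
  by rewrite in_itv/= => /andP[ar rs]; apply: dv; rewrite ar (lt_le_trans rs).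
have [<-|neq] := eqVneq a s; first by rewrite subrr mulr0 expR0 mulr1.
have lts : a < s by rewrite lt_neqAle neq.
have [c cI E] := MVT lts dvI cv.
have : (u * e) s - (u * e) a <= 0.
  rewrite E; move: cI; rewrite in_itv/= => /andP[ac cs].
  rewrite mulr_le0_ge0 ?subr_ge0// mulr_le0_ge0 ?expR_ge0// subr_le0.
  by apply: duC; rewrite ac (lt_le_trans cs).
rewrite -[(u * e) s]/(u s * e s) -[(u * e) a]/(u a * e a) /e subrr mulr0 expR0 mulr1.
rewrite subr_le0 mulNr expRN -ler_pdivlMr ?invr_gt0 ?expR_gt0//.
by rewrite invrK.
Qed.

Lemma gronwall {R : realType} (w dw : R -> 'cV[R]_2) (a b L d : R) :
  0 <= L -> 0 <= d -> continuous w ->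
  (forall s, a < s < b -> is_derive s (1 : R) w (dw s)) ->
  (forall s, a < s < b -> `|dw s| <= L * `|w s| + d) ->
  forall s, a <= s <= b ->
    `|w s| ^+ 2 <= 2 * (`|w a| ^+ 2 + d ^+ 2) * expR ((4 * L + 1) * (s - a)).
Proof.
move=> L0 d0 cw dwE dwL s sab.
(* Unlike the maximum norm, the squared Euclidean norm is differentiable; the
   additive constant turns the affine differential inequality into a linear one. *)
pose u (r : R) : R := w r 0 0 ^+ 2 + w r 1 0 ^+ 2 + 2 * d ^+ 2.
pose du (r : R) : R := 2 * (w r 0 0 * dw r 0 0) + 2 * (w r 1 0 * dw r 1 0).
have sqn (x : 'cV[R]_2) : `|x| ^+ 2 <= x 0 0 ^+ 2 + x 1 0 ^+ 2.
  set S := _ + _; have S0 : 0 <= S by rewrite addr_ge0 ?sqr_ge0.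
  rewrite -(sqr_sqrtr S0) lerXn2r ?nnegrE ?sqrtr_ge0//.
  apply: cV2_norm_le; first exact: sqrtr_ge0.
  move=> i; rewrite -sqrtr_sqr ler_sqrt//.
  by move: i; apply: forall_I2; rewrite ?lerDl ?lerDr sqr_ge0.
have qsn (x : 'cV[R]_2) : x 0 0 ^+ 2 + x 1 0 ^+ 2 <= 2 * `|x| ^+ 2.
  suff h i : x i 0 ^+ 2 <= `|x| ^+ 2 by have := h 0; have := h 1; lra.
  by rewrite -[leLHS]real_normK ?num_real// lerXn2r ?nnegrE// mx_entry_norm.
have cu : continuous u.
  move=> r; apply: cvgD; last exact: cvg_cst.
  have cwi i : (w x i 0) @[x --> r] --> w r i 0
    by exact: (continuous_cV2P _ _ _).1 (cw r) i.
  by apply: cvgD; apply: cvgM; exact: cwi.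
have duE r : a < r < b -> is_derive r (1 : R) u (du r).
  move=> rab; have dr := dwE r rab.
  have dri i := is_derive_entry _ _ _ _ _ i dr.
  apply: (is_derive_eq (is_deriveD (is_deriveD (is_deriveM (dri 0) (dri 0))
    (is_deriveM (dri 1) (dri 1))) (is_derive_cst (2 * d ^+ 2) r 1))).
  by rewrite /du -![_ *: _]/(_ * _); ring.
(* The bound [h] holds for each entry; the two together give [du r <= (4 L + 1) E + 2 d^2] with [E]
   the squared Euclidean norm, hence the rate [4 L + 1]. *)
have duC r : a < r < b -> du r <= (4 * L + 1) * u r.
  move=> rab; have := dwL r rab; have := sqn (w r).
  set n := `|w r|; set E := _ + _ => nE dn.
  have h i : 2 * (w r i 0 * dw r i 0) <= 2 * L * E + w r i 0 ^+ 2 + d ^+ 2.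
    apply: (@le_trans _ _ (2 * (`|w r i 0| * (L * n + d)))).
      rewrite ler_pM2l// (le_trans (ler_norm _))// normrM ler_wpM2l//.
      by apply: le_trans dn; exact: mx_entry_norm.
    have wn : `|w r i 0| <= n := mx_entry_norm _ _.
    have w0 : 0 <= `|w r i 0| by [].
    rewrite -[w r i 0 ^+ 2]real_normK ?num_real//.
    set k := `|w r i 0| in wn w0 *.
    have : k * n <= E by apply: le_trans nE; rewrite expr2 ler_wpM2r// (le_trans w0).
    have := sqr_ge0 (k - d).
    nra.
  have := h 0; have := h 1; rewrite /du /u -/E.
  have := sqr_ge0 d; have E0 : 0 <= E by rewrite addr_ge0 ?sqr_ge0.
  rewrite -/E /E; nra.
have := gronwall_scalar u du a b _ cu duE duC s sab.
move=> h; apply: le_trans (sqn _) _; apply: (@le_trans _ _ (u s)).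
  by rewrite /u lerDl mulr_ge0 ?sqr_ge0.
apply: le_trans h _; rewrite ler_wpM2r ?expR_ge0//.
by rewrite mulrDr /u lerD2r; exact: qsn.
Qed.

Lemma le0_half_pow {R : realType} (x C : R) :
  (forall n : nat, x <= C / 2 ^+ n) -> x <= 0.
Proof.
move=> xC; rewrite leNgt; apply/negP => x0.
have C0 : 0 < C by have := xC 0; rewrite expr0 divr1; exact: lt_le_trans.
have := xC (Num.bound (C / x)); rewrite ler_pdivlMr ?exprn_gt0//.
apply/negP; rewrite -ltNge mulrC -ltr_pdivrMr//.
have h : C / x < (Num.bound (C / x))%:R.
  by apply: archi_boundP; rewrite divr_ge0// ltW.
apply: lt_trans h _; rewrite -natrX ltr_nat; exact: ltn_expl.
Qed.

(** Comparison with a geometric series: the tail after [n] is at most [2 A / 2 ^+ n] uniformly in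
    [t], so the limit inherits continuity. *)
Lemma geometric_uniform_limit {R : realType} (u : nat -> R -> 'cV[R]_2) (A : R) :
  0 <= A -> (forall n, continuous (u n)) ->
  (forall n t, `|u n.+1 t - u n t| <= A / 2 ^+ n) ->
  exists v : R -> 'cV[R]_2,
    continuous v /\ forall n t, `|v t - u n t| <= 2 * A / 2 ^+ n.
Proof.
move=> A0 cu uA.
(* Subtracting the tail that remains after [n + k] makes the induction step on [k] an identity. *)
have tail n k t : `|u (n + k)%N t - u n t| <= 2 * A / 2 ^+ n - 2 * A / 2 ^+ (n + k).
  elim: k => [|k ih]; first by rewrite addn0 !subrr normr0.
  rewrite addnS -(subrK (u (n + k)%N t) (u _ t)) -addrA.
  apply: le_trans (ler_normD _ _) _; apply: le_trans (lerD (uA _ _) ih) _.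
  have p0 : (2 : R) ^+ (n + k) != 0 by rewrite expf_neq0.
  rewrite exprS invfM; set p := (2 ^+ (n + k))^-1.
  have -> : 2 * A * (2^-1 * p) = A * p by field.
  by rewrite le_eqVlt; apply/orP; left; apply/eqP; ring.
have tail0 n k t : (n <= k)%N -> `|u k t - u n t| <= 2 * A / 2 ^+ n.
  move=> nk; rewrite -(subnKC nk); apply: le_trans (tail _ _ _) _.
  by rewrite gerBl divr_ge0// ?mulr_ge0// exprn_ge0.
have small (e : R) : 0 < e -> exists n, 2 * A / 2 ^+ n < e.
  move=> e0; apply: contrapT => /forallNP h.
  have : e <= 0 by apply: (@le0_half_pow _ _ (2 * A)) => n; have := h n; move/negP;
    rewrite -leNgt.
  by rewrite leNgt e0.
have cvgu t : cvg (u n t @[n --> \oo]).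
  apply/cauchy_cvgP; apply/cauchy_exP => e e0.
  have [n hn] := small e e0; exists (u n t); exists n => // k /= nk.
  rewrite -ball_normE/= distrC; exact: le_lt_trans (tail0 _ _ _ nk) hn.
have limu n t : `|lim (u n t @[n --> \oo]) - u n t| <= 2 * A / 2 ^+ n.
  have h : `|u k t - u n t| @[k --> \oo] --> `|lim (u n t @[n --> \oo]) - u n t|.
    by apply: cvg_norm; apply: cvgB; [exact: cvgu|exact: cvg_cst].
  rewrite -(cvg_lim _ h)//; apply: limr_le; first exact: cvgP h.
  by exists n => // k /=; exact: tail0.
exists (fun t => lim (u n t @[n --> \oo])); split; last exact: limu.
move=> t; apply/cvgrPdist_le => e e0.
have e3 : 0 < e / 3 by rewrite divr_gt0.
have [n hn] := small _ e3.
near=> r.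
have h1 := limu n t; have h2 := limu n r.
have h3 : `|u n t - u n r| <= e / 3.
  by near: r; have /cvgrPdist_le/(_ _ e3) := cu n t.
set x := lim _ in h1 *; set y := lim _ in h2 *.
have -> : x - y = (x - u n t) + (u n t - u n r) - (y - u n r).
  by rewrite addrA subrK opprB addrA subrK.
apply: le_trans (ler_normB _ _) _.
apply: le_trans (lerD (ler_normD _ _) (lexx _)) _.
lra.
Unshelve. all: by end_near. Qed.

(** Freezing the primitive outside [[a, b]] makes a bound on [[a, b]] a bound on the whole line, as
    [geometric_uniform_limit] demands. *)
Lemma clamped_primitive {R : realType} (k : R -> 'cV[R]_2) (a b : R)
    (x0 : 'cV[R]_2) :
  a < b -> continuous k ->
  exists v : R -> 'cV[R]_2, [/\ continuous v, v a = x0,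
    forall s, a < s < b -> is_derive s (1 : R) v (k s)
    & forall t, v t = v (clamp a b t)].
Proof.
move=> ab ck.
have ex i : exists W : R -> R, forall s, a - 1 < s -> is_derive s (1 : R) W (k s i 0).
  by apply: continuous_primitive => s; apply: (continuous_cV2P _ _ _).1; exact: ck.
have [W0 dW0] := ex 0; have [W1 dW1] := ex 1.
pose W (s : R) : 'cV[R]_2 := mk2 (W0 s) (W1 s).
have dW s : a - 1 < s -> is_derive s (1 : R) W (k s).
  move=> s1; apply: is_derive_cV2; apply: forall_I2.
    have -> : (fun y => W y 0 0) = W0 by apply/funext => y; rewrite mxE.
    exact: dW0.
  have -> : (fun y => W y 1 0) = W1 by apply/funext => y; rewrite mxE.
  exact: dW1.
pose v (t : R) := x0 + (W (clamp a b t) - W a).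
have ca : clamp a b a = a by rewrite clamp_id// lexx ltW.
have cc t : clamp a b (clamp a b t) = clamp a b t.
  by rewrite clamp_id// clamp_itv// ltW.
exists v; split.
- move=> t; apply: cvgD; first exact: cvg_cst.
  apply: cvgB; last exact: cvg_cst.
  have h : a - 1 < clamp a b t.
    by have /andP[h _] := clamp_itv a b t (ltW ab); lra.
  have cW : {for clamp a b t, continuous W}.
    apply: differentiable_continuous; apply/derivable1_diffP.
    by have := dW _ h.
  exact: (cvg_comp _ _ (@continuous_clamp R a b t) cW).
- by rewrite /v ca subrr addr0.
- move=> s /andP[as_ sb].
  have h : a - 1 < s by lra.
  have ds := dW s h.
  have hd : is_derive s (1 : R) (fun t => x0 + (W t - W a)) (k s).
    apply: (is_derive_eq (is_deriveD (is_derive_cst x0 s 1)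
      (is_deriveB ds (is_derive_cst (W a) s 1)))).
    by rewrite subr0 add0r.
  refine (near_eq_is_derive _ hd).
  near=> t; rewrite /v clamp_id//; apply/andP; split; apply: ltW; near: t.
    exact: lt_nbhsr.
  exact: lt_nbhsl.
- by move=> t; rewrite /v cc.
Unshelve. all: by end_near. Qed.

Lemma picard {R : realType} (F : R -> 'cV[R]_2 -> 'cV[R]_2) (a b L : R)
    (x0 : 'cV[R]_2) :
  a < b -> 0 <= L -> continuous (fun z : R * 'cV[R]_2 => F z.1 z.2) ->
  (forall s x y, a < s < b -> `|F s x - F s y| <= L * `|x - y|) ->
  exists u : R -> 'cV[R]_2, [/\ continuous u, u a = x0
    & forall s, a < s < b -> is_derive s (1 : R) u (F s (u s))].
Proof.
move=> ab L0 cF lipF.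
have cFu (u : R -> 'cV[R]_2) : continuous u -> continuous (fun s => F s (u s)).
  move=> cu s.
  apply: (@continuous_comp_at _ _ _ (fun s => (s, u s))
    (fun z : R * 'cV[R]_2 => F z.1 z.2)); last exact: cF.
  by apply: continuous_pairing; [exact: cvg_id|exact: cu].
(* Continuity sits inside the relation, so that [Phi] is total on functions; at a discontinuous [u]
   its value is arbitrary. *)
have /choice[Phi PhiP] : forall u : R -> 'cV[R]_2, exists v : R -> 'cV[R]_2,
    continuous u -> [/\ continuous v, v a = x0,
    forall s, a < s < b -> is_derive s (1 : R) v (F s (u s))
    & forall t, v t = v (clamp a b t)].
  move=> u; have [cu|ncu] := pselect (continuous u); last by exists u.
  by have [v vP] := clamped_primitive _ a b x0 ab (cFu u cu); exists v.
have diffP u1 u2 s : continuous u1 -> continuous u2 -> a < s < b ->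
    is_derive s (1 : R) (fun s => Phi u1 s - Phi u2 s) (F s (u1 s) - F s (u2 s)).
  move=> /PhiP[_ _ d1 _] /PhiP[_ _ d2 _] sab.
  exact: is_deriveB (d1 s sab) (d2 s sab).
have diffC u1 u2 : continuous u1 -> continuous u2 ->
    continuous (fun s => Phi u1 s - Phi u2 s).
  by move=> /PhiP[c1 _ _ _] /PhiP[c2 _ _ _] s; apply: cvgB; [exact: c1|exact: c2].
pose u := fix u n := if n is n'.+1 then Phi (u n') else cst x0.
have cu n : continuous (u n).
  elim: n => [|n ih]; first by move=> s; exact: cvg_cst.
  by have [] := PhiP _ ih.
have ucl n t : u n t = u n (clamp a b t).
  by case: n => [|n] //; have [_ _ _] := PhiP _ (cu n); exact.
have ua n : u n a = x0.
  by case: n => [|n] //; have [_ ? _ _] := PhiP _ (cu n).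
(* The increments of the iterates decay like [2 ^- n] once divided by the weight
   [expR (K * (t - a))]. *)
pose K := 2 * L + 1.
have K0 : 0 < K by rewrite /K; lra.
have [A A0 hA] : exists2 A, 0 <= A & forall t, a <= t <= b -> `|u 1%N t - u 0%N t| <= A.
  have cn : {within `[a, b], continuous (fun t => `|u 1%N t - u 0%N t|)}.
    apply: continuous_subspaceT => t; apply: cvg_norm.
    by apply: cvgB; [exact: (cu 1%N)|exact: (cu 0%N)].
  have [c _ hc] := EVT_max (ltW ab) cn.
  by exists (`|u 1%N c - u 0%N c|) => // t tab; apply: hc; rewrite in_itv.
have exp1 t : a <= t -> 1 <= expR (K * (t - a)).
  by move=> at_; rewrite -expR0 ler_expR mulr_ge0 ?subr_ge0// ltW.
have step n t : a <= t <= b ->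
    `|u n.+1 t - u n t| <= A / 2 ^+ n * expR (K * (t - a)).
  elim: n t => [|n ih] t tab.
    rewrite expr0 divr1; apply: le_trans (hA _ tab) _.
    by rewrite ler_peMr// exp1//; have /andP[] := tab.
  set C := A / 2 ^+ n.+1; have C0 : 0 <= C by rewrite divr_ge0// exprn_ge0.
  have CE : A / 2 ^+ n = 2 * C.
    by rewrite /C exprS; field; rewrite expf_neq0.
  have de (s : R) : is_derive s (1 : R) (fun s => C * expR (K * (s - a)))
      (C * K * expR (K * (s - a))).
    have dl : is_derive s (1 : R) (fun r : R => K * (r - a)) K.
      have dr : is_derive s (1 : R) (fun r : R => r - a) 1.
        apply: (is_derive_eq (is_deriveB (is_derive_id s 1) (is_derive_cst a s 1))).
        by rewrite subr0.
      apply: (is_derive_eq (is_deriveM (is_derive_cst K s 1) dr)).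
      by rewrite scaler0 addr0 [_ *: 1]mulr1.
    have dE : is_derive s (1 : R) (fun s => expR (K * (s - a))) (expR (K * (s - a)) * K).
      exact: @is_derive1_comp R expR (fun r => K * (r - a)) s _ _ (is_derive_expR _) dl.
    apply: (is_derive_eq (is_deriveM (is_derive_cst C s 1) dE)).
    by rewrite scaler0 addr0 -[_ *: _]/(_ * _) /cst; ring.
  have ce : continuous (fun s => C * expR (K * (s - a))).
    by move=> r; apply: differentiable_continuous; apply/derivable1_diffP; have := de r.
  (* Signed entries stand in for the norm, which is not differentiable. With rate 0,
     [gronwall_scalar] says that [w] does not increase: the derivative of [C * expR (K * (s - a))]
     dominates [L] times the previous bound because [2 * L <= K]. *)
  have entry (sg : bool) i :
      (-1) ^+ sg * (u n.+2 t - u n.+1 t) i 0 <= C * expR (K * (t - a)).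
    pose w s := (-1) ^+ sg * (u n.+2 s - u n.+1 s) i 0 - C * expR (K * (s - a)).
    pose dw s := (-1) ^+ sg * (F s (u n.+1 s) - F s (u n s)) i 0 - C * K * expR (K *
      (s - a)).
    have cw : continuous w.
      move=> s; apply: cvgB; last exact: ce.
      apply: cvgM; first exact: cvg_cst.
      by have /continuous_cV2P := diffC _ _ (cu n.+1) (cu n) s; apply.
    have dwE s : a < s < b -> is_derive s (1 : R) w (dw s).
      move=> sab; have di := is_derive_entry _ _ _ _ _ i (diffP _ _ _ (cu n.+1) (cu
        n) sab).
      have d1 := is_deriveM (is_derive_cst ((-1) ^+ sg : R) s (1 : R)) di.
      apply: (is_derive_eq (is_deriveB d1 (de s))).
      by rewrite scaler0 addr0.
    have dw0 s : a < s < b -> dw s <= 0 * w s.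
      move=> sab; rewrite mul0r /dw subr_le0.
      apply: le_trans (ler_norm _) _; rewrite normrMsign.
      apply: le_trans (mx_entry_norm _ _) _; apply: le_trans (lipF _ _ _ sab) _.
      have sab' : a <= s <= b by case/andP: sab => /ltW-> /ltW->.
      apply: le_trans (ler_wpM2l L0 (ih s sab')) _.
      rewrite CE mulrA ler_wpM2r ?expR_ge0// /K; nra.
    have := gronwall_scalar w dw a b 0 cw dwE dw0 t tab.
    rewrite mul0r expR0 mulr1 /w !ua (subrr x0) [(0 : 'cV[R]_2) i 0]mxE mulr0 sub0r => h.
    by rewrite -subr_le0; apply: le_trans h _; rewrite oppr_le0 mulr_ge0// expR_ge0.
  apply: cV2_norm_le; first by rewrite mulr_ge0// expR_ge0.
  move=> i; have := entry false i; have := entry true i.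
  rewrite expr0 expr1 mul1r mulN1r ler_norml lerNl => h1 h2.
  by rewrite h1 h2.
pose A' := A * expR (K * (b - a)).
have A'0 : 0 <= A' by rewrite mulr_ge0// expR_ge0.
have stepA n t : `|u n.+1 t - u n t| <= A' / 2 ^+ n.
  rewrite (ucl n.+1) (ucl n).
  have tab := clamp_itv a b t (ltW ab).
  apply: le_trans (step _ _ tab) _; rewrite /A' mulrAC ler_wpM2r ?invr_ge0 ?exprn_ge0//.
  by rewrite ler_wpM2l// ler_expR ler_pM2l// lerD2r; case/andP: tab.
have [v [cv hv]] := geometric_uniform_limit u A' A'0 cu stepA.
have [cPv Pva dPv Pvcl] := PhiP _ cv.
(* The iterates [u n.+1 = Phi (u n)] approach [v] by construction and [Phi v] by the Lipschitz
   bound, both at rate [2 ^- n]. *)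
have PvE t : Phi v t = v t.
  apply/eqP; rewrite -subr_eq0 -normr_le0.
  apply: (@le0_half_pow _ _ (L * (2 * A') * (b - a) + 2 * A')) => n.
  have h1 : `|Phi v t - u n.+1 t| <= L * (2 * A' / 2 ^+ n) * (b - a).
    rewrite Pvcl (ucl n.+1); set r := clamp a b t.
    have /andP[ar rb] : a <= r <= b by exact: clamp_itv (ltW ab).
    have c0 : 0 <= L * (2 * A' / 2 ^+ n).
      by rewrite mulr_ge0// divr_ge0 ?mulr_ge0// exprn_ge0.
    have := @bounded_derive_increment_cV2 R (fun s => Phi v s - Phi (u n) s)
      (fun s => F s (v s) - F s (u n s)) a r (L * (2 * A' / 2 ^+ n)) ar c0
      (diffC _ _ cv (cu n)).
    have [_ Puna _ _] := PhiP _ (cu n).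
    rewrite Pva Puna subrr subr0 => h; apply: le_trans (h _ _) _.
    - move=> s /andP[as_ sr]; apply: diffP => //.
      by rewrite as_ (lt_le_trans sr).
    - move=> s /andP[as_ sr]; apply: le_trans (lipF _ _ _ _) _.
        by rewrite as_ (lt_le_trans sr).
      by rewrite ler_wpM2l.
    - by rewrite ler_wpM2l// lerD2r.
  have h2 := hv n.+1 t.
  have -> : Phi v t - v t = (Phi v t - u n.+1 t) - (v t - u n.+1 t).
    by rewrite opprB addrA subrK.
  apply: le_trans (ler_normB _ _) _; apply: le_trans (lerD h1 h2) _.
  rewrite [leRHS]mulrDl lerD//; last first.
    rewrite ler_wpM2l ?mulr_ge0// lef_pV2 ?posrE ?exprn_gt0//.
    by rewrite ler_eXn2l// ltr1n.
  by rewrite le_eqVlt; apply/orP; left; apply/eqP; ring.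
have PvE' : Phi v = v by apply/funext.
by exists v; split => //; [rewrite -PvE|rewrite -{1}PvE'].
Qed.

(** * Compactness and the Poincare-Miranda theorem *)

(** Around each [s] of [K] the estimate holds for all [s'] near [s] and all small [d]; the covering
    form of compactness then yields one [d] for all of [K]. *)
Lemma compact_tube {R : realType} (T N M : normedModType R) (K : set T)
    (F : T * N -> M) (gam : T -> N) :
  compact K -> (forall s, K s -> {for s, continuous gam}) ->
  (forall s, K s -> {for (s, gam s), continuous F}) ->
  forall e : R, 0 < e -> exists2 d : R, 0 < d &
    forall s x, K s -> `|x - gam s| <= d -> `|F (s, x) - F (s, gam s)| <= e.
Proof.
move=> /compact_near_coveringP cK cgam cF e e0.
have e2 : 0 < e / 2 by rewrite divr_gt0.
have h s : K s -> \forall s' \near s & d \near (0 : R)^'+,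
    forall x, `|x - gam s'| <= d -> `|F (s', x) - F (s', gam s')| <= e.
  move=> Ks; have /cvgrPdist_le/(_ _ e2)/nbhs_ballP[r /= r0 hr] := cF s Ks.
  have r2 : 0 < r / 2 by rewrite divr_gt0.
  near=> s' d => x /= xd.
  have s'r : ball s r s' by near: s'; exact: nbhsx_ballx.
  have gs' : `|gam s - gam s'| < r / 2.
    by near: s'; have /cvgrPdist_lt/(_ _ r2) := cgam s Ks.
  have dr : d < r / 2 by near: d; exact: nbhs_right_lt.
  have h1 : `|F (s, gam s) - F (s', gam s')| <= e / 2.
    apply: hr; split => //=; rewrite -ball_normE/=.
    by apply: lt_trans gs' _; rewrite ltr_pdivrMr// ltr_pMr// ltr1n.
  have h2 : `|F (s, gam s) - F (s', x)| <= e / 2.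
    apply: hr; split => //=; rewrite -ball_normE/=.
    rewrite -(subrK (gam s') (gam s)) -addrA; apply: le_lt_trans (ler_normD _ _) _.
    by rewrite [`|gam s' - x|]distrC; lra.
  rewrite -(subrK (F (s, gam s)) (F (s', x))) -addrA.
  apply: le_trans (ler_normD _ _) _.
  by rewrite [`|_ - F (s, _)|]distrC; lra.
have := cK R (0 : R)^'+ (fun d s => forall x, `|x - gam s| <= d ->
  `|F (s, x) - F (s, gam s)| <= e) _ h => H.
near (0 : R)^'+ => d; exists d.
  by near: d; exact: nbhs_right_gt.
by move=> s x Ks; move: s Ks x; near: d; exact: H.
Unshelve. all: by end_near. Qed.

(** * A Sperner-type lemma on the square grid *)

Section signed_edges.
Variables A B : nat -> nat -> bool.
Implicit Types p q r : nat * nat.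

Let D p q : int := (A p.1 p.2 && B q.1 q.2)%:Z - (B p.1 p.2 && A q.1 q.2)%:Z.

Let neither p := ~~ A p.1 p.2 && ~~ B p.1 p.2.

Let D_antisym p q : D p q = - D q p.
Proof. by rewrite /D opprB [B q.1 _ && _]andbC [A q.1 _ && _]andbC. Qed.

(** If [A] or [B] is absent from the triangle, every term is 0. If every vertex has one of these two
    colours, [D p q] is the difference of the indicators of [A] at [p] and [q], and the cyclic sum
    telescopes. *)
Let D_triangle p q r :
  (forall u v w, u \in [:: p; q; r] -> v \in [:: p; q; r] -> w \in [:: p; q; r] ->
    A u.1 u.2 -> B v.1 v.2 -> neither w -> False) ->
  (forall u, ~~ (A u.1 u.2 && B u.1 u.2)) ->
  D p q + D q r + D r p = 0.
Proof.
move=> H dis.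
have mp : p \in [:: p; q; r] by rewrite inE eqxx.
have mq : q \in [:: p; q; r] by rewrite !inE eqxx orbT.
have mr : r \in [:: p; q; r] by rewrite !inE eqxx !orbT.
have := dis p; have := dis q; have := dis r.
have := H p q r mp mq mr; have := H p r q mp mr mq; have := H q p r mq mp mr.
have := H q r p mq mr mp; have := H r p q mr mp mq; have := H r q p mr mq mp.
rewrite /D /neither.
by case: (A p.1 p.2); case: (A q.1 q.2); case: (A r.1 r.2);
  case: (B p.1 p.2); case: (B q.1 q.2); case: (B r.1 r.2) => //= h1 h2 h3 h4 h5 h6 _ _ _;
  solve [by []|by case: h1|by case: h2|by case: h3|by case: h4|by case: h5|by case: h6].
Qed.

(* Discrete Stokes: [D] counts the edges from an [A]-vertex to a [B]-vertex with
   sign, so its circulation around a triangle that misses one of the three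
   colours vanishes, while its circulation around the whole grid is 1. *)
Lemma tricolored_square (n : nat) :
  (forall i j, ~~ (A i j && B i j)) ->
  (forall j, (j <= n)%N -> A 0 j) -> (forall j, (j <= n)%N -> ~~ A n j) ->
  (forall i, (i <= n)%N -> A i 0 || B i 0) -> (forall i, (i <= n)%N -> ~~ B i n) ->
  exists i j, [/\ (i < n)%N, (j < n)%N & exists p q r,
    [/\ forall u, u \in [:: p; q; r] -> (i <= u.1 <= i.+1)%N && (j <= u.2 <= j.+1)%N,
        A p.1 p.2, B q.1 q.2, ~~ A r.1 r.2 & ~~ B r.1 r.2]].
Proof.
move=> dis left right bottom top; apply: contrapT => none.
(* The diagonal cuts the cell into two triangles traversed in the same sense; it is run through once
   in each direction and drops out. *)
have sq i j : (i < n)%N -> (j < n)%N ->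
    D (i, j) (i.+1, j) - D (i, j.+1) (i.+1, j.+1) +
    (D (i.+1, j) (i.+1, j.+1) - D (i, j) (i, j.+1)) = 0.
  move=> iltn jn.
  have dis' u : ~~ (A u.1 u.2 && B u.1 u.2) by exact: dis.
  have tri p q r : (forall u, u \in [:: p; q; r] ->
      (i <= u.1 <= i.+1)%N && (j <= u.2 <= j.+1)%N) -> D p q + D q r + D r p = 0.
    move=> hu; apply: D_triangle => // u v w mu mv mw Au Bv /andP[nAw nBw].
    apply: none; exists i, j; split => //; exists u, v, w; split => //.
    by move=> x; rewrite !inE => /or3P[] /eqP->; exact: hu.
  have t1 := tri (i, j) (i.+1, j) (i.+1, j.+1) _.
  have t2 := tri (i, j) (i.+1, j.+1) (i, j.+1) _.
  have {}t1 : D (i, j) (i.+1, j) + D (i.+1, j) (i.+1, j.+1) + D (i.+1, j.+1) (i, j) = 0.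
    by apply: t1 => u; rewrite !inE => /or3P[] /eqP-> /=; lia.
  have {}t2 : D (i, j) (i.+1, j.+1) + D (i.+1, j.+1) (i, j.+1) + D (i, j.+1) (i, j) = 0.
    by apply: t2 => u; rewrite !inE => /or3P[] /eqP-> /=; lia.
  rewrite [D (i.+1, j.+1) (i, j)]D_antisym in t1.
  rewrite [D (i.+1, j.+1) (i, j.+1)]D_antisym [D (i, j.+1) (i, j)]D_antisym in t2.
  lia.
pose h i j := D (i, j) (i.+1, j); pose v i j := D (i, j) (i, j.+1).
have tele (f : nat -> int) : \sum_(0 <= k < n) (f k.+1 - f k) = f n - f 0%N.
  exact: telescope_sumr.
have E : \sum_(0 <= i < n) (h i 0%N - h i n) + \sum_(0 <= j < n) (v n j - v 0%N j) = 0.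
  have -> : \sum_(0 <= i < n) (h i 0%N - h i n) =
      \sum_(0 <= i < n) \sum_(0 <= j < n) (h i j - h i j.+1).
    apply: eq_bigr => i _; rewrite -[LHS]opprB -(tele (h i)) -sumrN.
    by apply: eq_bigr => j _; rewrite opprB.
  have -> : \sum_(0 <= j < n) (v n j - v 0%N j) =
      \sum_(0 <= i < n) \sum_(0 <= j < n) (v i.+1 j - v i j).
    rewrite exchange_big; apply: eq_bigr => j _.
    exact: (esym (tele (fun i => v i j))).
  rewrite -big_split big_nat big1// => i /andP[_ iltn].
  rewrite -big_split big_nat big1// => j /andP[_ jn].
  exact: sq.
(* The right side carries no [A] and the left side nothing but [A], so no edge on them joins [A] to
   [B]. *)
have vL j : (j < n)%N -> v n j - v 0%N j = 0.
  move=> jn; rewrite /v /D/= (negPf (right j (ltnW jn))) (negPf (right _ jn)).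
  have := dis 0 j; have := dis 0 j.+1; rewrite !left// 1?ltnW//=.
  by move=> /negPf-> /negPf->; rewrite andbF.
(* The top has no [B] and contributes 0; on the bottom every vertex is [A] or [B], so [D] is a
   difference of indicators of [A]. Since [A] holds at the left corner and fails at the right one,
   the sum is 1, whereas [E] demands 0. *)
have hB i : (i < n)%N -> h i 0%N - h i n = - ((A i.+1 0)%:Z - (A i 0)%:Z).
  move=> iltn; rewrite /h /D/= (negPf (top i (ltnW iltn))) (negPf (top _ iltn)).
  have := bottom i (ltnW iltn); have := bottom _ iltn.
  have := dis i 0%N; have := dis i.+1 0%N; rewrite !andbF/=.
  by case: (A i 0); case: (A i.+1 0); case: (B i 0); case: (B i.+1 0).
move: E; rewrite big_nat [X in _ + X]big_nat [X in _ + X]big1; last first.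
  by move=> j /andP[_ jn]; exact: vL.
under eq_bigr => i /andP[_ iltn] do rewrite hB//.
rewrite -big_nat sumrN (tele (fun i => (A i 0)%:Z)) left// (negPf (right _ _))//.
Qed.

End signed_edges.

Lemma natr_dist_le1 {R : realType} (a b k : nat) :
  (k <= a <= k.+1)%N -> (k <= b <= k.+1)%N -> `|a%:R - b%:R : R| <= 1.
Proof.
have le1 (c d : nat) : (k <= c <= k.+1)%N -> (k <= d <= k.+1)%N -> (c - d <= 1)%N.
  by lia.
move=> ak bk; have [ab|ba] := leqP a b.
  by rewrite distrC -natrB// normr_nat lern1 le1.
by rewrite -natrB 1?ltnW// normr_nat lern1 le1.
Qed.

(** Without a common zero, [|f1| + |f2|] has a positive minimum [c] on the square. On a grid so fine
    that both functions vary by at most [c / 4] within a cell, a vertex is coloured [A] if [f1 < 0]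
    and [B] if [f1 >= 0 > f2]. In a cell with all three kinds of vertices, both functions are at
    most [c / 4] in absolute value at the [B]-vertex, below the minimum. *)
Lemma poincare_miranda_unit {R : realType} (f1 f2 : R * R -> R) :
  continuous f1 -> continuous f2 ->
  (forall y : R, 0 <= y <= 1 -> f1 (0, y) < 0 /\ 0 < f1 (1, y)) ->
  (forall x : R, 0 <= x <= 1 -> f2 (x, 0) < 0 /\ 0 < f2 (x, 1)) ->
  exists z : R * R, [/\ 0 <= z.1 <= 1, 0 <= z.2 <= 1, f1 z = 0 & f2 z = 0].
Proof.
move=> c1 c2 s1 s2; apply: contrapT => none.
pose Q : set (R * R) := `[0, 1] `*` `[0, 1].
have QE z : Q z <-> 0 <= z.1 <= 1 /\ 0 <= z.2 <= 1.
  by rewrite /Q /= !in_itv.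
have cQ : compact Q by apply: compact_setX; exact: segment_compact.
have Q0 : Q !=set0 by exists (0, 0); apply/QE => /=; rewrite lexx ler01.
have cg : {within Q, continuous (fun z => `|f1 z| + `|f2 z|)}.
  apply: continuous_subspaceT => z; apply: cvgD; apply: cvg_norm; [exact: c1|exact: c2].
have [zm zmQ zmin] := compact_EVT_min Q0 cQ cg.
set c := `|f1 zm| + `|f2 zm| in zmin.
have c0 : 0 < c.
  rewrite lt_neqAle addr_ge0// andbT eq_sym; apply/eqP => /eqP.
  rewrite paddr_eq0// !normr_eq0 => /andP[/eqP h1 /eqP h2]; apply: none.
  by exists zm; move: zmQ; rewrite inE => /QE[].
have uc (f : R * R -> R) : continuous f -> exists2 d : R, 0 < d &
    forall z w, Q z -> `|w - z| <= d -> `|f w - f z| <= c / 4.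
  move=> cf; have c4 : 0 < c / 4 by rewrite divr_gt0.
  (* Uniform continuity on [Q], obtained as a tube around the graph of the identity. *)
  apply: (@compact_tube R (R * R)%type (R * R)%type R Q (fun z => f z.2) id cQ _ _ _ c4).
  - by move=> z _; exact: cvg_id.
  - by move=> z _; apply: continuous_comp_at; [exact: cvg_snd|exact: cf].
have [d1 d10 u1] := uc _ c1; have [d2 d20 u2] := uc _ c2.
pose d := Num.min d1 d2; have d0 : 0 < d by rewrite lt_min d10.
have [n n0 nd] : exists2 n : nat, (0 : R) < n%:R & n%:R^-1 <= d.
  exists (Num.bound d^-1).+1; first by rewrite ltr0n.
  rewrite -[leRHS]invrK lef_pV2 ?posrE ?invr_gt0 ?ltr0n//.
  have h : d^-1 < (Num.bound d^-1)%:R by apply: archi_boundP; rewrite invr_ge0 ltW.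
  by apply: ltW (lt_le_trans h _); rewrite ler_nat.
pose pt (i j : nat) : R * R := (i%:R / n%:R, j%:R / n%:R).
have unit01 (i : nat) : (i <= n)%N -> 0 <= (i%:R / n%:R : R) <= 1.
  by move=> iltn; apply/andP; split;
    [exact: divr_ge0|rewrite ler_pdivrMr// mul1r ler_nat].
have nn : n%:R / n%:R = 1 :> R by rewrite divff// gt_eqF.
pose A i j := f1 (pt i j) < 0.
pose B i j := ~~ A i j && (f2 (pt i j) < 0).
have [|||||i [j [iltn jn [p [q [r [hu Ap /andP[nAq Bq] nAr nBr]]]]]]] :=
  @tricolored_square A B n.
- by move=> i j; rewrite /B; case: (A i j).
- by move=> j jn; rewrite /A /pt mul0r; exact: (s1 _ (unit01 j jn)).1.
- by move=> j jn; rewrite /A /pt nn -leNgt ltW//; exact: (s1 _ (unit01 j jn)).2.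
- move=> i iltn; rewrite /B; case: (A i 0%N) => //=.
  by rewrite /pt mul0r; exact: (s2 _ (unit01 i iltn)).1.
- move=> i iltn; apply/negP => /andP[_]; apply/negP; rewrite -leNgt /pt nn.
  by rewrite ltW//; exact: (s2 _ (unit01 i iltn)).2.
have ptQ u : u \in [:: p; q; r] -> Q (pt u.1 u.2).
  move=> /hu /andP[/andP[_ h1] /andP[_ h2]]; apply/QE; split; apply: unit01.
    exact: leq_trans h1 iltn.
  exact: leq_trans h2 jn.
have near_grid (a b k : nat) : (k <= a <= k.+1)%N -> (k <= b <= k.+1)%N ->
    `|a%:R / n%:R - b%:R / n%:R| <= d.
  move=> ak bk; rewrite -mulrBl normrM [`|n%:R^-1|]ger0_norm; last
    by rewrite invr_ge0 ltW.
  apply: le_trans nd; rewrite -[leRHS]mul1r ler_wpM2r ?invr_ge0 ?(ltW n0)//.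
  exact: natr_dist_le1 ak bk.
have close u v : u \in [:: p; q; r] -> v \in [:: p; q; r] ->
    `|pt u.1 u.2 - pt v.1 v.2| <= d.
  move=> /hu/andP[h1 h2] /hu/andP[h3 h4].
  by rewrite /Num.norm/= ge_max; apply/andP; split;
    [exact: near_grid h1 h3|exact: near_grid h2 h4].
have mp : p \in [:: p; q; r] by rewrite inE eqxx.
have mq : q \in [:: p; q; r] by rewrite !inE eqxx orbT.
have mr : r \in [:: p; q; r] by rewrite !inE eqxx !orbT.
have e1 : `|f1 (pt p.1 p.2) - f1 (pt q.1 q.2)| <= c / 4.
  by apply: u1 (ptQ _ mq) (le_trans (close _ _ mp mq) _); rewrite /d ge_min lexx.
have e2 : `|f2 (pt r.1 r.2) - f2 (pt q.1 q.2)| <= c / 4.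
  by apply: u2 (ptQ _ mq) (le_trans (close _ _ mr mq) _); rewrite /d ge_min lexx orbT.
have := zmin (pt q.1 q.2); rewrite inE => /(_ (ptQ _ mq)) /=.
move: nBr Ap nAq; rewrite /B nAr /= -leNgt /A => f2r f1p; rewrite -leNgt => f1q.
move: e1 e2; rewrite !ler_norml => /andP[e11 e12] /andP[e21 e22].
by rewrite ger0_norm// ltr0_norm//; lra.
Qed.

Lemma poincare_miranda {R : realType} (f1 f2 : R * R -> R) (a b c d : R) :
  a < b -> c < d -> continuous f1 -> continuous f2 ->
  (forall y : R, c <= y <= d -> f1 (a, y) < 0 /\ 0 < f1 (b, y)) ->
  (forall x : R, a <= x <= b -> f2 (x, c) < 0 /\ 0 < f2 (x, d)) ->
  exists z : R * R, [/\ a <= z.1 <= b, c <= z.2 <= d, f1 z = 0 & f2 z = 0].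
Proof.
move=> ab cd c1 c2 s1 s2.
pose phi (z : R * R) : R * R := (a + (b - a) * z.1, c + (d - c) * z.2).
have affine (u v : R) : continuous (fun x : R => u + v * x).
  move=> x; apply: cvgD; first exact: cvg_cst.
  by apply: cvgM; [exact: cvg_cst|exact: cvg_id].
have cphi : continuous phi.
  move=> z; apply: (@continuous_pairing _ _ _ (fun z : R * R => a + (b - a) * z.1)
      (fun z : R * R => c + (d - c) * z.2)).
    exact: (@continuous_comp_at _ _ _ (@fst R R) (fun x => a + (b - a) * x) _
      (@cvg_fst _ _ _ _ _) (affine _ _ _)).
  exact: (@continuous_comp_at _ _ _ (@snd R R) (fun x => c + (d - c) * x) _ (@cvg_snd
    _ _ _ _ _) (affine _ _ _)).
have aff (u v x : R) : u < v -> 0 <= x <= 1 -> u <= u + (v - u) * x <= v.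
  by move=> uv /andP[x0 x1]; apply/andP; split; nra.
have [||||z [z1 z2 h1 h2]] := poincare_miranda_unit (f1 \o phi) (f2 \o phi).
- by move=> z; exact: continuous_comp_at (cphi z) (c1 _).
- by move=> z; exact: continuous_comp_at (cphi z) (c2 _).
- move=> y y01; rewrite /= /phi/= mulr0 addr0 mulr1 subrKC.
  by apply: s1; exact: aff.
- move=> x x01; rewrite /= /phi/= mulr0 addr0 mulr1 subrKC.
  by apply: s2; exact: aff.
- by exists (phi z); split => //; exact: aff.
Qed.

(** * Impulsive chains and the energy balance *)

Lemma class_CS {R : realType} {E W : normedModType R} (k : nat) (U : set E)
    (F : E -> W) : (0 < k)%N -> class_C k U F ->
  [/\ forall x, U x -> {for x, continuous F},
      forall v x, U x -> derivable F x v
    & forall v x, U x -> {for x, continuous (fun y => 'D_v F y)}].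
Proof.
case: k => // k _ [cF dF]; split => // v x Ux; first by have [h _] := dF v; exact: h.
by have [_] := dF v; case: k {dF} => [|k] [h _]; exact: h.
Qed.

Lemma continuous_mk2 {R : realType} :
  continuous (fun z : R * R => mk2 z.1 z.2).
Proof.
move=> z; apply/continuous_cV2P; apply: forall_I2.
- have -> : (fun y : R * R => mk2 y.1 y.2 0 0) = fst.
    by apply/funext => y; rewrite mxE.
  exact: cvg_fst.
- have -> : (fun y : R * R => mk2 y.1 y.2 1 0) = snd.
    by apply/funext => y; rewrite mxE.
  exact: cvg_snd.
Qed.

Lemma compact_box {R : realType} (B : R) :
  compact [set x : 'cV[R]_2 | `|x| <= B].
Proof.
have [B0|B0] := ltP B 0.
  rewrite (_ : [set x | _] = set0); first exact: compact0.
  apply/seteqP; split => // x /= xB.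
  by have := le_trans (normr_ge0 x) xB; rewrite leNgt B0.
have -> : [set x : 'cV[R]_2 | `|x| <= B] =
    (fun z : R * R => mk2 z.1 z.2) @` (`[- B, B] `*` `[- B, B]).
  apply/seteqP; split => x /=.
    move=> xB; exists (x 0 0, x 1 0) => /=; last by apply: cV2_eq; rewrite !mxE.
    by rewrite !in_itv/= -!ler_norml !(le_trans (mx_entry_norm _ _) xB).
  move=> [z [/= z1 z2] <-]; rewrite !in_itv/= -!ler_norml in z1 z2.
  by apply: cV2_norm_le => //; apply: forall_I2; rewrite mxE.
apply: continuous_compact.
  by apply: continuous_subspaceT; exact: continuous_mk2.
by apply: compact_setX; exact: segment_compact.
Qed.

Lemma continuous_compact_bounded {R : realType} (T : topologicalType)
    (V : normedModType R) (K : set T) (F : T -> V) :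
  compact K -> continuous F ->
  exists2 C : R, 0 <= C & forall x, K x -> `|F x| <= C.
Proof.
move=> cK cF.
have cFK : compact (F @` K).
  by apply: continuous_compact => //; exact: continuous_subspaceT.
have [C [Creal hC]] := compact_bounded cFK.
exists (`|C| + 1); first by rewrite addr_ge0.
move=> x Kx; apply: hC; last by exists x.
by rewrite (le_lt_trans (ler_norm C))// ltrDl.
Qed.

Lemma vector_lipschitz {R : realType} (F : 'cV[R]_2 -> 'cV[R]_2) (B C : R) :
  0 <= C -> (forall y v, derivable F y v) ->
  (forall y i, `|y| <= B -> `|'D_(delta_mx i 0) F y| <= C) ->
  forall x y, `|x| <= B -> `|y| <= B -> `|F x - F y| <= 2 * C * `|x - y|.
Proof.
move=> C0 dF FC x y xB yB; apply: cV2_norm_le.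
  by rewrite mulr_ge0// mulr_ge0.
move=> j; rewrite !mxE.
have dj z v : is_derive z v (fun x => F x j 0) ('D_v F z j 0).
  by apply: is_derive_entry; exact: derivableP.
apply: (partial_lipschitz (fun x => F x j 0) B C) => //.
move=> z i zB; apply: le_trans (FC z i zB).
rewrite /partial (@derive_val _ _ _ _ _ _ _ (dj z (delta_mx i 0))).
exact: mx_entry_norm.
Qed.

Lemma class_C_box_lipschitz {R : realType} (k : nat) (F : 'cV[R]_2 -> 'cV[R]_2)
    (B : R) : (0 < k)%N -> class_C k setT F ->
  exists2 L, 0 <= L &
    forall x y, `|x| <= B -> `|y| <= B -> `|F x - F y| <= L * `|x - y|.
Proof.
move=> k0 /(class_CS _ _ _ k0)[_ dF cdF].
have bd i := continuous_compact_bounded _ _ _ _ (compact_box B)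
  (fun x => cdF (delta_mx i 0) x I).
have [C0 C00 h0] := bd 0; have [C1 C10 h1] := bd 1.
have C01 : 0 <= C0 + C1 by rewrite addr_ge0.
exists (2 * (C0 + C1)); first by rewrite mulr_ge0.
apply: vector_lipschitz => //; first by move=> y v; exact: dF.
move=> y i yB; move: i; apply: forall_I2.
  by apply: le_trans (h0 y yB) _; rewrite lerDl.
by apply: le_trans (h1 y yB) _; rewrite lerDr.
Qed.

Definition param_box {R : realType} (a b B : R) : set (R * 'cV[R]_2 * R) :=
  (`[a, b] `*` [set x : 'cV[R]_2 | `|x| <= B]) `*` `[-1, 1].

Lemma compact_param_box {R : realType} (a b B : R) : compact (param_box a b B).
Proof.
apply: compact_setX; last exact: segment_compact.
by apply: compact_setX; [exact: segment_compact|exact: compact_box].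
Qed.

Lemma param_boxP {R : realType} (a b B s e : R) (x : 'cV[R]_2) :
  a <= s <= b -> `|x| <= B -> `|e| <= 1 -> param_box a b B (s, x, e).
Proof.
by move=> sab xB e1; split; [split|]; rewrite /= ?in_itv//= -ler_norml.
Qed.

(** The derivative of [g] in [x] is that of the joint map in the direction [(0, v, 0)], which is
    continuous on the compact [param_box]; this makes the Lipschitz constant uniform in time and
    parameter. *)
Lemma class_C_param_lipschitz {R : realType} (k : nat)
    (g : R -> 'cV[R]_2 -> R -> 'cV[R]_2) (a b B : R) :
  (0 < k)%N -> class_C k setT (fun z : R * 'cV[R]_2 * R => g z.1.1 z.1.2 z.2) ->
  exists2 L, 0 <= L & forall s e x y, a <= s <= b -> `|e| <= 1 ->
    `|x| <= B -> `|y| <= B -> `|g s x e - g s y e| <= L * `|x - y|.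
Proof.
move=> k0 /(class_CS _ _ _ k0)[_]; set G := (fun z : R * 'cV[R]_2 * R => _) => dG cdG.
pose dir (v : 'cV[R]_2) : R * 'cV[R]_2 * R := (0, v, 0).
have dgE s e (y v : 'cV[R]_2) :
    is_derive y v (fun x => g s x e) ('D_(dir v) G (s, y, e)).
  have dz : derivable G (s, y, e) (dir v) by exact: dG.
  have eqQ : (fun h : R => h^-1 *: (((fun x => g s x e) \o shift y) (h *: v) - g s y e)) =
      (fun h : R => h^-1 *: ((G \o shift (s, y, e)) (h *: dir v) - G (s, y, e))).
    apply/funext => h; congr (_ *: (_ - _)); rewrite /G /dir/=.
    by rewrite [h *: 0]mulr0 !add0r.
  split; first by rewrite /derivable eqQ.
  by rewrite /derive eqQ.
have bd i := continuous_compact_bounded _ _ _ _ (compact_param_box a b B)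
  (fun x => cdG (dir (delta_mx i 0)) x I).
have [C0 C00 h0] := bd 0; have [C1 C10 h1] := bd 1.
have C01 : 0 <= C0 + C1 by rewrite addr_ge0.
exists (2 * (C0 + C1)); first by rewrite mulr_ge0.
move=> s e x y sab e1 xB yB.
apply: (vector_lipschitz (fun x => g s x e) B) => //.
move=> z i zB; rewrite (@derive_val _ _ _ _ _ _ _ (dgE s e z (delta_mx i 0)));
  move: i; apply: forall_I2.
  by apply: le_trans (h0 _ (param_boxP _ _ _ _ _ _ sab zB e1)) _; rewrite lerDl.
by apply: le_trans (h1 _ (param_boxP _ _ _ _ _ _ sab zB e1)) _; rewrite lerDr.
Qed.

Lemma steps_le {R : realType} (tau : nat -> R) :
  (forall i, tau i < tau i.+1) -> forall i j, (i <= j)%N -> tau i <= tau j.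
Proof.
move=> tauS i j ij; rewrite -(subnKC ij); elim: (j - i)%N => [|k ih].
  by rewrite addn0.
by rewrite addnS (le_trans ih)// ltW.
Qed.

(** [U i] follows the equation between two impulses and only matters on [[tau i, tau i.+1]]; [Y i]
    is the state just after time [tau i]. The chain starts after the impulse at [tau 0] and ends
    after the one at [tau N], so that [Y N = Y 0] expresses periodicity. *)
Definition impulsive_chain {R : realType} (F : R -> 'cV[R]_2 -> 'cV[R]_2)
    (J : nat -> 'cV[R]_2 -> 'cV[R]_2) (tau : nat -> R) (N : nat)
    (U : nat -> R -> 'cV[R]_2) (Y : nat -> 'cV[R]_2) : Prop :=
  forall i, (i < N)%N ->
    [/\ continuous (U i), U i (tau i) = Y i,
        forall s, tau i < s < tau i.+1 -> is_derive s (1 : R) (U i) (F s (U i s))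
      & Y i.+1 = J i (U i (tau i.+1))].

(** Gronwall with forcing 0 bounds the squares with the factor [2 E], where [E] is the exponential;
    as [E >= 1], the factor [2 E] also serves after taking roots. *)
Lemma ode_lipschitz_dependence {R : realType} (F : R -> 'cV[R]_2 -> 'cV[R]_2)
    (a b L : R) (u v : R -> 'cV[R]_2) :
  a <= b -> 0 <= L ->
  (forall s x y, a < s < b -> `|F s x - F s y| <= L * `|x - y|) ->
  continuous u -> continuous v ->
  (forall s, a < s < b -> is_derive s (1 : R) u (F s (u s))) ->
  (forall s, a < s < b -> is_derive s (1 : R) v (F s (v s))) ->
  `|u b - v b| <= 2 * expR ((4 * L + 1) * (b - a)) * `|u a - v a|.
Proof.
move=> ab L0 lipF cu cv du dv.
set E := expR _; have E1 : 1 <= E.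
  by rewrite -expR0 ler_expR mulr_ge0 ?subr_ge0//; lra.
have cw : continuous (fun s => u s - v s).
  by move=> s; apply: cvgB; [exact: cu|exact: cv].
have := @gronwall R (fun s => u s - v s) (fun s => F s (u s) - F s (v s)) a b L 0
  L0 (lexx _) cw.
have dw s : a < s < b -> is_derive s (1 : R) (fun s => u s - v s) (F s (u s) - F s (v s)).
  by move=> sab; exact: is_deriveB (du s sab) (dv s sab).
move=> /(_ dw); have lw s : a < s < b ->
    `|F s (u s) - F s (v s)| <= L * `|u s - v s| + 0.
  by move=> sab; rewrite addr0; exact: lipF.
move=> /(_ lw b); rewrite ab lexx => /(_ isT); rewrite -/E expr0n/= addr0 => h.
rewrite -(@ler_pXn2r _ 2) ?nnegrE ?mulr_ge0//; try lra.
apply: le_trans h _.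
by have := sqr_ge0 `|u a - v a|; nra.
Qed.

(** Solutions are picked separately for each piece and each initial value;
    [ode_lipschitz_dependence] holds for any two solutions and therefore makes the picked end point
    continuous in the initial value. *)
Lemma impulsive_flow {R : realType} (F : R -> 'cV[R]_2 -> 'cV[R]_2)
    (J : nat -> 'cV[R]_2 -> 'cV[R]_2) (tau : nat -> R) (N : nat) (L : R) :
  0 <= L -> (forall i, tau i < tau i.+1) ->
  continuous (fun z : R * 'cV[R]_2 => F z.1 z.2) ->
  (forall s x y, tau 0%N < s < tau N -> `|F s x - F s y| <= L * `|x - y|) ->
  (forall i, continuous (J i)) ->
  exists (U : 'cV[R]_2 -> nat -> R -> 'cV[R]_2) (Y : 'cV[R]_2 -> nat -> 'cV[R]_2),
    (forall x, Y x 0%N = x /\ impulsive_chain F J tau N (U x) (Y x)) /\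
    forall i, (i <= N)%N -> continuous (fun x => Y x i).
Proof.
move=> L0 tauS cF lipF cJ.
have tau_le := steps_le tau tauS.
have lipFi i : (i < N)%N ->
    forall s x y, tau i < s < tau i.+1 -> `|F s x - F s y| <= L * `|x - y|.
  move=> iN s x y /andP[s1 s2]; apply: lipF; rewrite (le_lt_trans _ s1) ?tau_le//=.
  by rewrite (lt_le_trans s2)// tau_le.
have /choice[S SP] : forall ix : nat * 'cV[R]_2, exists u : R -> 'cV[R]_2,
    (ix.1 < N)%N -> [/\ continuous u, u (tau ix.1) = ix.2
    & forall s, tau ix.1 < s < tau ix.1.+1 -> is_derive s (1 : R) u (F s (u s))].
  move=> [i x] /=; have [iN|_] := boolP (i < N)%N; last by exists (cst 0).
  have [u uP] := picard F (tau i) (tau i.+1) L x (tauS i) L0 cF (lipFi i iN).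
  by exists u.
pose Y x := fix Y n := if n is i.+1 then J i (S (i, Y i) (tau i.+1)) else x.
exists (fun x i => S (i, Y x i)), Y; split.
  by move=> x; split => // i iN; have [h1 h2 h3] := SP (i, Y x i) iN; split.
elim=> [|i ih] iN; first by move=> x; exact: cvg_id.
move=> x; apply: (@continuous_comp_at _ _ _ (fun x => S (i, Y x i) (tau i.+1)) (J i));
  last exact: cJ.
apply: (@continuous_comp_at _ _ _ (fun x => Y x i) (fun y => S (i, y) (tau i.+1))).
  by apply: ih; exact: ltnW.
move: (Y x i); apply: lipschitz_continuous => y z.
have [cy y0 dy] := SP (i, y) iN; have [cz z0 dz] := SP (i, z) iN.
rewrite /= in y0 z0 cy cz dy dz.
have := ode_lipschitz_dependence F _ _ _ _ _ (ltW (tauS i)) L0 (lipFi i iN) cy cz dy dz.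
by rewrite y0 z0; exact.
Qed.

(* [f], [g], [lam] are truncated outside the box of radius [B]: the vector field
   becomes globally Lipschitz, and nothing changes for a chain in the box. *)
Lemma chain_closeness {R : realType} (f : 'cV[R]_2 -> 'cV[R]_2)
    (g : R -> 'cV[R]_2 -> R -> 'cV[R]_2) (lam : nat -> 'cV[R]_2 -> R -> 'cV[R]_2)
    (tau : nat -> R) (N : nat) (B L Cg Cl : R) :
  0 <= B -> 0 <= L -> 0 <= Cg -> 0 <= Cl -> (forall i, tau i < tau i.+1) ->
  (forall x y, `|x| <= B -> `|y| <= B -> `|f x - f y| <= L * `|x - y|) ->
  (forall s x e, tau 0%N < s < tau N -> `|x| <= B -> `|e| <= 1 -> `|g s x e| <= Cg) ->
  (forall i x e, (i < N)%N -> `|x| <= B -> `|e| <= 1 -> `|lam i x e| <= Cl) ->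
  forall d, 0 < d -> exists2 d', 0 < d' &
    forall (e : R) (y : R -> 'cV[R]_2) U Y, `|e| <= d' ->
      (forall s, is_derive s (1 : R) y (f (y s))) -> (forall s, `|y s| <= B) ->
      impulsive_chain (fun s x => f (clampV B x) + e *: g s (clampV B x) e)
        (fun i x => x + e *: lam i (clampV B x) e) tau N U Y ->
      `|Y 0%N - y (tau 0%N)| <= d' ->
      (forall i s, (i < N)%N -> tau i <= s <= tau i.+1 -> `|U i s - y s| <= d) /\
      (forall i, (i <= N)%N -> `|Y i - y (tau i)| <= d).
Proof.
move=> B0 L0 Cg0 Cl0 tauS lipf gC lamC.
have tau_le := steps_le tau tauS.
pose good (n : nat) (d e : R) (y : R -> 'cV[R]_2) (U : nat -> R -> 'cV[R]_2) (Y : nat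
  -> 'cV[R]_2) :=
  (forall i s, (i < n)%N -> tau i <= s <= tau i.+1 -> `|U i s - y s| <= d) /\
      (forall i, (i <= n)%N -> `|Y i - y (tau i)| <= d).
suff H n : (n <= N)%N -> forall d, 0 < d -> exists2 d', 0 < d' &
    forall (e : R) (y : R -> 'cV[R]_2) U Y, `|e| <= d' ->
      (forall s, is_derive s (1 : R) y (f (y s))) -> (forall s, `|y s| <= B) ->
      impulsive_chain (fun s x => f (clampV B x) + e *: g s (clampV B x) e)
        (fun i x => x + e *: lam i (clampV B x) e) tau N U Y ->
      `|Y 0%N - y (tau 0%N)| <= d' -> good n d e y U Y by exact: H.
elim: n => [_ d d0|n ih nN d d0].
  exists d => // e y U Y _ _ _ _ h; split => // i; rewrite leqn0 => /eqP->.
  exact: h.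
(* [Q] is the Gronwall factor for an initial error [eta] and a forcing [eta * Cg]: the squared error
   on the new piece is at most [eta ^+ 2 * Q], which is below [(d / 2) ^+ 2], and the jump adds at
   most [eta * Cl <= d / 2]. The radius [eta] in turn becomes a target for the preceding pieces. *)
pose E := expR ((4 * L + 1) * (tau n.+1 - tau n)).
pose Q := 2 * (1 + Cg ^+ 2) * E.
have E0 : 0 <= E by exact: expR_ge0.
have Q0 : 0 <= Q by rewrite !mulr_ge0// addr_ge0// sqr_ge0.
pose eta := Num.min 1 (Num.min (d / 2 / (Q + 1)) (d / 2 / (Cl + 1))).
have eta0 : 0 < eta by rewrite !lt_min ltr01 !divr_gt0//; lra.
have eta1 : eta <= 1 by rewrite /eta ge_min lexx.
have etaQ : eta * (Q + 1) <= d / 2.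
  by rewrite -ler_pdivlMr; [rewrite /eta !ge_min lexx !orbT|lra].
have etaC : eta * (Cl + 1) <= d / 2.
  by rewrite -ler_pdivlMr; [rewrite /eta !ge_min lexx !orbT|lra].
have md0 : 0 < Num.min d eta by rewrite lt_min d0.
have [d' d'0 hd'] := ih (ltnW nN) _ md0.
exists (Num.min d' eta); first by rewrite lt_min d'0.
move=> e y U Y; rewrite le_min => /andP[ed' eeta] dy yB ch; rewrite le_min => /andP[Y0 _].
have [g1 g2] := hd' e y U Y ed' dy yB ch Y0.
have e1 : `|e| <= 1 by exact: le_trans eta1.
have [cU Un dU YS] := ch n nN.
have cy : continuous y.
  by move=> s; apply: differentiable_continuous; apply/derivable1_diffP; have := dy s.
have step s : tau n <= s <= tau n.+1 -> `|U n s - y s| <= d / 2.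
  move=> sI.
  have cw : continuous (fun s => U n s - y s).
    by move=> r; apply: cvgB; [exact: cU|exact: cy].
  have dw r : tau n < r < tau n.+1 -> is_derive r (1 : R) (fun s => U n s - y s)
      (f (clampV B (U n r)) + e *: g r (clampV B (U n r)) e - f (y r)).
    by move=> rI; exact: is_deriveB (dU r rI) (dy r).
  have lw r : tau n < r < tau n.+1 ->
     `|f (clampV B (U n r)) + e *: g r (clampV B (U n r)) e - f (y r)|
       <= L * `|U n r - y r| + eta * Cg.
    move=> /andP[r1 r2]; rewrite addrAC; apply: le_trans (ler_normD _ _) _.
    apply: lerD.
      apply: le_trans (lipf _ _ (clampV_norm _ _ B0) (yB r)) _.
      rewrite ler_wpM2l// -{1}(clampV_id B (y r))//; exact: clampV_lipschitz.
    rewrite normrZ ler_pM// gC ?clampV_norm//.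
    by rewrite (le_lt_trans _ r1) ?tau_le//= (lt_le_trans r2)// tau_le.
  have eC : 0 <= eta * Cg by rewrite mulr_ge0// ltW.
  have := @gronwall R _ _ _ _ _ _ L0 eC cw dw lw s sI => h.
  have hn : `|U n (tau n) - y (tau n)| <= eta.
    by rewrite Un; apply: le_trans (g2 n (leqnn n)) _; rewrite ge_min lexx orbT.
  have hE : expR ((4 * L + 1) * (s - tau n)) <= E.
    rewrite ler_expR ler_wpM2l//; first by lra.
    by rewrite lerD2r; case/andP: sI.
  rewrite -(@ler_pXn2r _ 2) ?nnegrE//; last by lra.
  apply: le_trans h _.
  have hn2 : `|U n (tau n) - y (tau n)| ^+ 2 <= eta ^+ 2.
    by rewrite lerXn2r ?nnegrE// ltW.
  apply: (@le_trans _ _ (2 * (eta ^+ 2 + (eta * Cg) ^+ 2) * E)).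
    apply: ler_pM => //; last 1 first.
    - by rewrite ler_wpM2l// lerD2r.
    - by rewrite mulr_ge0// addr_ge0// sqr_ge0.
  have -> : 2 * (eta ^+ 2 + (eta * Cg) ^+ 2) * E = eta ^+ 2 * Q by rewrite /Q; ring.
  have etaQ0 : 0 <= eta * (Q + 1) by rewrite mulr_ge0//; lra.
  apply: (@le_trans _ _ ((eta * (Q + 1)) ^+ 2)).
    rewrite exprMn ler_wpM2l ?sqr_ge0//; nra.
  by rewrite lerXn2r ?nnegrE//; lra.
have tnn : tau n <= tau n.+1 <= tau n.+1 by rewrite lexx ltW.
split.
- move=> i s; rewrite ltnS leq_eqVlt => /predU1P[-> /step h|iltn sI].
    by apply: le_trans h _; lra.
  by apply: le_trans (g1 i s iltn sI) _; rewrite ge_min lexx.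
- move=> i; rewrite leq_eqVlt ltnS => /predU1P[->|iltn]; last first.
    by apply: le_trans (g2 i iltn) _; rewrite ge_min lexx.
  rewrite YS addrAC; apply: le_trans (ler_normD _ _) _.
  have h1 := step _ tnn.
  have h2 : `|e *: lam n (clampV B (U n (tau n.+1))) e| <= eta * Cl.
    by rewrite normrZ ler_pM// lamC// clampV_norm.
  nra.
Qed.

Lemma DH_mulmx {R : realType} (H : 'cV[R]_2 -> R) (x v : 'cV[R]_2) :
  (DH H x *m v) 0 0 = \sum_(j < 2) partial H j x * v j 0.
Proof. by rewrite mxE; apply: eq_bigr => j _; rewrite mxE. Qed.

Lemma DH_mulmx2 {R : realType} (H : 'cV[R]_2 -> R) (x v : 'cV[R]_2) :
  (DH H x *m v) 0 0 = partial H 0 x * v 0 0 + partial H 1 x * v 1 0.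
Proof.
rewrite DH_mulmx big_ord_recl big_ord1.
by rewrite (_ : lift _ _ = 1) //; exact: val_inj.
Qed.

Lemma continuous_DH_mulmx {R : realType} (T : topologicalType)
    (H : 'cV[R]_2 -> R) (x v : T -> 'cV[R]_2) (t : T) :
  (forall i, continuous (partial H i)) ->
  {for t, continuous x} -> {for t, continuous v} ->
  {for t, continuous (fun s => (DH H (x s) *m v s) 0 0)}.
Proof.
move=> cH cx cv.
have -> : (fun s => (DH H (x s) *m v s) 0 0) =
  (fun s => partial H 0 (x s) * v s 0 0 + partial H 1 (x s) * v s 1 0).
  by apply/funext => s; rewrite DH_mulmx2.
have h i : {for t, continuous (fun s => partial H i (x s) * v s i 0)}.
  apply: cvgM; first exact: (@continuous_comp_at _ _ _ x (partial H i) t cx (cH i _)).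
  exact: ((continuous_cV2P _ _ _).1 cv i).
by apply: cvgD; exact: h.
Qed.

Lemma continuous_of_partials {R : realType} (H : 'cV[R]_2 -> R) :
  (forall y i, derivable H y (delta_mx i 0)) ->
  (forall i, continuous (partial H i)) -> continuous H.
Proof.
move=> dH cH x.
have [C C0 hC] : exists2 C : R, 0 <= C & forall y i, `|y| <= `|x| + 1 -> `|partial H
  i y| <= C.
  have bd i := continuous_compact_bounded _ _ _ _ (compact_box (`|x| + 1)) (cH i).
  have [Ca Ca0 ha] := bd 0; have [Cb Cb0 hb] := bd 1.
  exists (Ca + Cb); first by rewrite addr_ge0.
  move=> y i yB; move: i; apply: forall_I2.
    by apply: le_trans (ha y yB) _; rewrite lerDl.
  by apply: le_trans (hb y yB) _; rewrite lerDr.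
have lip := partial_lipschitz H (`|x| + 1) C dH hC.
apply: (@locally_lipschitz_continuous _ _ _ _ (2 * C)) => y xy1.
apply: lip; first by rewrite lerDl.
rewrite -(subrK x y) addrC; apply: le_trans (ler_normD _ _) _.
by rewrite lerD2l distrC.
Qed.

(** The increment of [H] is [e] times a sum of partial derivatives at mean value points against the
    entries of [lam u e]. These points differ from [u], so they are a separate argument of [Th],
    which is continuous at [(x0, (x0, 0))]. *)
Lemma jump_energy {R : realType} (H : 'cV[R]_2 -> R)
    (lam : 'cV[R]_2 -> R -> 'cV[R]_2) (x0 : 'cV[R]_2) :
  (forall y i, derivable H y (delta_mx i 0)) ->
  (forall i, continuous (partial H i)) ->
  continuous (fun z : 'cV[R]_2 * R => lam z.1 z.2) ->
  forall kappa, 0 < kappa -> exists2 d, 0 < d & forall e u,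
    `|e| <= d -> `|u - x0| <= d ->
    `|H (u + e *: lam u e) - H u - e * (DH H x0 *m lam x0 0) 0 0| <= kappa * `|e|.
Proof.
move=> dH cH cl kappa k0.
have k2 : 0 < kappa / 2 by rewrite divr_gt0.
pose Th i (z : 'cV[R]_2 * ('cV[R]_2 * R)) := partial H i z.1 * lam z.2.1 z.2.2 i 0.
have cTh i : continuous (Th i).
  move=> z; apply: cvgM.
    by apply: (@continuous_comp_at _ _ _ fst (partial H i)); [exact: cvg_fst|exact: cH].
  have c1 : {for z, continuous (fun z : 'cV[R]_2 * ('cV[R]_2 * R) => lam z.2.1 z.2.2)}.
    by apply: (@continuous_comp_at _ _ _ snd (fun z : 'cV[R]_2 * R => lam z.1 z.2));
      [exact: cvg_snd|exact: cl].
  exact: ((continuous_cV2P _ _ _).1 c1 i).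
have nearTh i : exists2 r, 0 < r & forall x u e, `|x - x0| <= r -> `|u - x0| <= r ->
    `|e| <= r -> `|Th i (x, (u, e)) - Th i (x0, (x0, 0))| <= kappa / 2.
  have /cvgrPdist_le/(_ _ k2)/nbhs_ballP[r /= r0 hr] := cTh i (x0, (x0, 0)).
  exists (r / 2); first by rewrite divr_gt0.
  have lt : r / 2 < r by rewrite ltr_pdivrMr// ltr_pMr// ltr1n.
  move=> x u e hx hu he; rewrite distrC; apply: hr; split; [|split];
    rewrite -ball_normE/= distrC ?subr0; exact: le_lt_trans lt.
have nearl : exists2 r, 0 < r & forall u e, `|u - x0| <= r ->
    `|e| <= r -> `|lam u e| <= `|lam x0 0| + 1.
  have /cvgrPdist_le/(_ _ ltr01)/nbhs_ballP[r /= r0 hr] := cl (x0, 0).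
  exists (r / 2); first by rewrite divr_gt0.
  have lt : r / 2 < r by rewrite ltr_pdivrMr// ltr_pMr// ltr1n.
  move=> u e hu he; rewrite -(subrK (lam x0 0) (lam u e)) addrC.
  apply: le_trans (ler_normD _ _) _; rewrite lerD2l distrC.
  apply: (hr (u, e)); split;
    rewrite -ball_normE/= distrC ?subr0; exact: le_lt_trans lt.
have [r0 r00 h0] := nearTh 0; have [r1 r10 h1] := nearTh 1; have [r2 r20 h2] := nearl.
set C := `|lam x0 0| + 1 in h2; have C0 : 0 < C by rewrite ltr_wpDl.
pose m := Num.min (Num.min r0 r1) r2.
have m0 : 0 < m by rewrite !lt_min r00 r10.
have [mr0 mr1 mr2] : [/\ m <= r0, m <= r1 & m <= r2].
  by split; rewrite /m !ge_min lexx ?orbT.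
(* A mean value point is within [|e| * C] of [u], and [u] is within [d] of [x0]; [d * (C + 1) = m]
   keeps the point within [m] of [x0]. *)
exists (m / (C + 1)); first by rewrite divr_gt0//; lra.
set d := m / (C + 1).
have dE : d * (C + 1) = m by rewrite /d divfK//; lra.
have d0 : 0 < d by rewrite divr_gt0//; lra.
have dm : d <= m by rewrite -dE ler_peMr//; lra.
move=> e u ed ud.
have [xi [hxi _ ->]] := partial_increment H u (e *: lam u e) dH.
have lC : `|lam u e| <= C by apply: h2; apply: le_trans mr2; exact: le_trans dm.
have xim i : `|xi i - x0| <= m.
  rewrite -(subrK u (xi i)) -addrA; apply: le_trans (ler_normD _ _) _.
  apply: le_trans (lerD (hxi i) ud) _; rewrite normrZ -dE mulrDr mulr1 lerD2r.
  by rewrite ler_pM.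
rewrite big_ord_recl big_ord1 (_ : lift _ _ = 1); last exact: val_inj.
rewrite DH_mulmx2 !mxE.
have := h0 (xi 0) u e (le_trans (xim 0) mr0) (le_trans ud (le_trans dm mr0))
  (le_trans ed (le_trans dm mr0)).
have := h1 (xi 1) u e (le_trans (xim 1) mr1) (le_trans ud (le_trans dm mr1))
  (le_trans ed (le_trans dm mr1)).
rewrite /Th/= => b1 b0.
set a1 := _ - _ in b1; set a0 := _ - _ in b0.
rewrite (_ : _ - _ = e * (a0 + a1)); last by rewrite /a0 /a1; ring.
rewrite normrM mulrC ler_wpM2r//; apply: le_trans (ler_normD _ _) _; lra.
Qed.

(** Between impulses, [H (U i s) - e * W s] has as derivative [e] times the difference of [DH g]
    along the chain and along [gam], since [DH f = 0]; closeness makes that difference small. A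
    primitive [W] instead of an integral lets the contributions of the pieces telescope. *)
Lemma energy_balance {R : realType} (H : 'cV[R]_2 -> R) (f : 'cV[R]_2 -> 'cV[R]_2)
    (g : R -> 'cV[R]_2 -> R -> 'cV[R]_2) (lam : nat -> 'cV[R]_2 -> R -> 'cV[R]_2)
    (tau : nat -> R) (N : nat) (gam : R -> 'cV[R]_2) (W : R -> R) :
  (forall y i, derivable H y (delta_mx i 0)) ->
  (forall i, continuous (partial H i)) ->
  (forall x, (DH H x *m f x) 0 0 = 0) ->
  continuous (fun z : R * 'cV[R]_2 * R => g z.1.1 z.1.2 z.2) ->
  (forall i, continuous (fun z : 'cV[R]_2 * R => lam i z.1 z.2)) ->
  (forall i, tau i < tau i.+1) -> continuous gam -> continuous W ->
  (forall s, tau 0%N < s < tau N ->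
     is_derive s (1 : R) W ((DH H (gam s) *m g s (gam s) 0) 0 0)) ->
  forall kappa, 0 < kappa -> exists2 d, 0 < d & forall e U Y, `|e| <= d ->
    impulsive_chain (fun s x => f x + e *: g s x e)
      (fun i x => x + e *: lam i x e) tau N U Y ->
    (forall i s, (i < N)%N -> tau i <= s <= tau i.+1 -> `|U i s - gam s| <= d) ->
    `|H (Y N) - H (Y 0%N) - e * (W (tau N) - W (tau 0%N) +
       \sum_(0 <= i < N) (DH H (gam (tau i.+1)) *m lam i (gam (tau i.+1)) 0) 0 0)|
      <= kappa * `|e|.
Proof.
move=> dH cH orth cg cl tauS cgam cW dW.
have tau_le := steps_le tau tauS.
suff Hn n : (n <= N)%N -> forall kappa, 0 < kappa -> exists2 d, 0 < d & forall e U Y,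
  `|e| <= d ->
    impulsive_chain (fun s x => f x + e *: g s x e)
      (fun i x => x + e *: lam i x e) tau N U Y ->
    (forall i s, (i < N)%N -> tau i <= s <= tau i.+1 -> `|U i s - gam s| <= d) ->
    `|H (Y n) - H (Y 0%N) - e * (W (tau n) - W (tau 0%N) +
       \sum_(0 <= i < n) (DH H (gam (tau i.+1)) *m lam i (gam (tau i.+1)) 0) 0 0)|
      <= kappa * `|e| by exact: Hn.
elim: n => [_ kappa k0|n ih nN kappa k0].
  by exists 1 => // e U Y _ _ _; rewrite big_nil !subrr addr0 mulr0 subr0 normr0
    mulr_ge0// ltW.
(* Half of [kappa] pays for the earlier pieces, a quarter for the flow on the last one and a quarter
   for its jump; [k3] is such a quarter divided by the length of the piece. *)
have k2 : 0 < kappa / 2 by rewrite divr_gt0.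
have k4 : 0 < kappa / 4 by rewrite divr_gt0.
have [d1 d10 h1] := ih (ltnW nN) _ k2.
have [d2 d20 h2] := jump_energy H (lam n) (gam (tau n.+1)) dH cH (cl n) _ k4.
pose D := tau n.+1 - tau n; have D0 : 0 < D by rewrite subr_gt0.
pose k3 := kappa / 4 / D; have k30 : 0 < k3 by rewrite divr_gt0.
pose Fm (z : R * ('cV[R]_2 * R)) := (DH H z.2.1 *m g z.1 z.2.1 z.2.2) 0 0.
have cFm (z : R * ('cV[R]_2 * R)) : {for z, continuous Fm}.
  have c21 : {for z, continuous (fun z : R * ('cV[R]_2 * R) => z.2.1)}.
    by apply: (@continuous_comp_at _ _ _ snd fst); [exact: cvg_snd|exact: cvg_fst].
  have c22 : {for z, continuous (fun z : R * ('cV[R]_2 * R) => z.2.2)}.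
    by apply: (@continuous_comp_at _ _ _ snd snd); [exact: cvg_snd|exact: cvg_snd].
  have c1 : {for z, continuous (fun z : R * ('cV[R]_2 * R) => z.1)} by exact: cvg_fst.
  have cG := continuous_comp_at _ _ _ _ (fun z : R * 'cV[R]_2 * R => g z.1.1 z.1.2 z.2)
    _ (continuous_pairing _ _ _ _ _ _ (continuous_pairing _ _ _ _ _ _ c1 c21) c22) (cg _).
  exact: (continuous_DH_mulmx _ H _ _ z cH c21 cG).
have cgam0 (s : R) : {for s, continuous (fun s => (gam s, 0 : R))}.
  by apply: (@continuous_pairing _ _ _ gam (cst (0 : R))); [exact: cgam|exact: cvg_cst].
have [d3 d30 h3] := @compact_tube R R^o ('cV[R]_2 * R)%type R^o `[tau n, tau n.+1] Fm
  (fun s => (gam s, 0)) (@segment_compact _ _ _) (fun s _ => cgam0 s) (fun s _ => cFm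
    _) k3 k30.
exists (Num.min (Num.min d1 d2) d3); first by rewrite !lt_min d10 d20.
move=> e U Y; rewrite !le_min => /andP[/andP[ed1 ed2] ed3] ch close.
have close1 i s : (i < N)%N -> tau i <= s <= tau i.+1 -> `|U i s - gam s| <= d1.
  by move=> iN sI; apply: le_trans (close i s iN sI) _; rewrite !ge_min lexx.
have A1 := h1 e U Y ed1 ch close1.
have [cU Un dU YS] := ch n nN.
have ltau : tau n <= tau n.+1 by rewrite ltW.
have A2 : `|H (Y n.+1) - H (U n (tau n.+1)) -
    e * (DH H (gam (tau n.+1)) *m lam n (gam (tau n.+1)) 0) 0 0| <= kappa / 4 * `|e|.
  rewrite YS; apply: h2 => //.
  apply: le_trans (close n _ nN _) _; first by rewrite lexx andbT.
  by rewrite !ge_min lexx !orbT.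
pose w s := H (U n s) - e * W s.
have cw : continuous w.
  move=> s; apply: cvgB; last by apply: cvgM; [exact: cvg_cst|exact: cW].
  apply: (@continuous_comp_at _ _ _ (U n) H); first exact: cU.
  exact: continuous_of_partials.
pose dw s := e * (Fm (s, (U n s, e)) - Fm (s, (gam s, 0))).
have dwE s : tau n < s < tau n.+1 -> is_derive s (1 : R) w (dw s).
  move=> sI; have sN : tau 0%N < s < tau N.
    case/andP: sI => s1 s2; rewrite (le_lt_trans _ s1) ?tau_le//=.
    by rewrite (lt_le_trans s2)// tau_le.
  have d1' := is_derive_comp_partial H (U n) s _ dH cH (dU s sI).
  have d2' := is_deriveM (is_derive_cst e s (1 : R)) (dW s sN).
  apply: (is_derive_eq (is_deriveB d1' d2')).
  have := orth (U n s); rewrite /dw /Fm/= scaler0 addr0 !DH_mulmx2.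
  rewrite big_ord_recl big_ord1 (_ : lift _ _ = 1); last exact: val_inj.
  rewrite !mxE -[_ *: _]/(_ * _) /cst => o.
  by rewrite -[RHS]addr0 -o; ring.
have dwC s : tau n < s < tau n.+1 -> `|dw s| <= `|e| * k3.
  move=> /andP[s1 s2]; rewrite /dw normrM ler_wpM2l//.
  apply: (h3 s (U n s, e)); first by rewrite /= in_itv/= !ltW.
  rewrite prod_normE ge_max; apply/andP; split; last by rewrite /= subr0.
  apply: le_trans (close n s nN _) _; first by rewrite !ltW.
  by rewrite !ge_min lexx !orbT.
have := bounded_derive_increment w dw _ _ _ ltau cw dwE dwC.
rewrite /w Un -/D -mulrA {1}/k3 divfK ?gt_eqF// => A3.
rewrite big_nat_recr//=.
set S := \sum_(0 <= i < n) _ in A1 *; set q := (DH H (gam (tau n.+1)) *m _) 0 0 in A2 *.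
have -> : H (Y n.+1) - H (Y 0%N) - e * (W (tau n.+1) - W (tau 0%N) + (S + q)) =
  (H (Y n) - H (Y 0%N) - e * (W (tau n) - W (tau 0%N) + S)) +
  ((H (U n (tau n.+1)) - e * W (tau n.+1)) - (H (Y n) - e * W (tau n))) +
  (H (Y n.+1) - H (U n (tau n.+1)) - e * q) by ring.
apply: le_trans (ler_normD _ _) _; apply: le_trans (lerD (ler_normD _ _) (lexx _)) _.
by lra.
Qed.

(** * The periodic family and the Melnikov function *)

Lemma periodic_int {R : realType} (X : Type) (u : R -> X) (P : R) :
  (forall s, u (s + P) = u s) -> forall (s : R) (k : int), u (s + k%:~R * P) = u s.
Proof.
move=> uP s k; have nat_case (n : nat) r : u (r + n%:R * P) = u r.
  elim: n r => [|n ih] r; first by rewrite mul0r addr0.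
  by rewrite -natr1 mulrDl mul1r addrA uP ih.
case: k => n; first exact: nat_case.
rewrite NegzE mulrNz mulNr; have := nat_case n.+1 (s - n.+1%:R * P).
by rewrite subrK pmulrn => ->.
Qed.

Lemma reduce_mod {R : realType} (P s : R) : 0 < P ->
  exists k : int, 0 <= s + k%:~R * P <= P.
Proof.
move=> P0; exists (- Num.floor (s / P)).
have h1 := floor_le_tmp (s / P); have h2 := floorD1_gt (s / P).
rewrite mulrNz mulNr.
set k := (Num.floor (s / P))%:~R in h1 *.
move: h1 h2; rewrite intrD -/k ler_pdivlMr// ltr_pdivrMr// mulrDl mul1r => h1 h2.
by apply/andP; split; lra.
Qed.

Section family.
Context {R : realType} (r0 : nat) (f : 'cV[R]_2 -> 'cV[R]_2) (H : 'cV[R]_2 -> R)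
  (V : set R) (L : R -> set 'cV[R]_2) (Tper : R -> R) (q : R -> R -> 'cV[R]_2).
Hypothesis r0_gt0 : (0 < r0)%N.
Hypothesis hfam : periodic_family r0 f H V L Tper q.
Hypothesis Vopen : open V.
Hypothesis cf : continuous f.

Lemma family_nonsingular h s : V h -> f (q s h) != 0.
Proof.
move=> Vh; apply: (family_regular hfam Vh).
by rewrite (family_param hfam Vh); exists s.
Qed.

Lemma family_continuous_time h : V h -> continuous (fun s => q s h).
Proof.
move=> Vh s; apply: differentiable_continuous; apply/derivable1_diffP.
by have := family_solution hfam s Vh.
Qed.

Lemma Omega_gt0 h : V h -> 0 < Omega Tper h.
Proof.
move=> Vh; rewrite /Omega divr_gt0//; last exact: (family_period_gt0 hfam Vh).
by rewrite mulr_gt0// pi_gt0.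
Qed.

Let G (z : R * R) := q (z.1 / Omega Tper z.2) z.2.

(** Regularity with respect to [h] is assumed for [G] alone; this formula makes [Omega] visible in
    the derivatives of [G]. *)
Lemma derive_angle (z : R * R) : V z.2 ->
  'D_((1, 0) : R * R) G z = (Omega Tper z.2)^-1 *: f (G z).
Proof.
move=> Vz; set c := (Omega Tper z.2)^-1.
have dphi : is_derive z.1 (1 : R) (fun u => q (u * c) z.2) (c *: f (q (z.1 * c) z.2)).
  apply: is_derive_cV2 => i; rewrite mxE mulrC.
  have dq := is_derive_entry _ _ _ _ _ i (family_solution hfam (z.1 * c) Vz).
  have dl : is_derive z.1 (1 : R) (fun u : R => u * c) c.
    apply: (is_derive_eq (is_deriveM (is_derive_id z.1 1) (is_derive_cst c z.1 1))).
    by rewrite scaler0 add0r [c *: 1]mulr1.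
  exact: (@is_derive1_comp R (fun s => q s z.2 i 0) (fun u => u * c) z.1 _ _ dq dl).
rewrite -[RHS](@derive_val _ _ _ _ _ _ _ dphi) /derive.
have -> : (fun h : R => h^-1 *: ((G \o shift z) (h *: ((1, 0) : R * R)) - G z)) =
    (fun h : R => h^-1 *: (((fun u => q (u * c) z.2) \o shift z.1) (h *: (1 : R)) -
      q (z.1 * c) z.2)).
  apply/funext => h /=; congr (_ *: (_ - _)).
  by rewrite /G /= [h *: 0]mulr0 add0r.
by [].
Qed.

(** By [derive_angle], [1 / Omega] is the norm of the angular derivative of [G] divided by that of
    [f (G (0, h))], which is nonzero because the orbits contain no equilibrium. *)
Let continuous_Omega_inv h : V h -> {for h, continuous (fun h => (Omega Tper h)^-1)}.
Proof.
move=> Vh; have [cG dG cdG] := class_CS _ _ _ r0_gt0 (family_smooth hfam).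
pose D (h : R) := 'D_((1, 0) : R * R) G (0, h).
have c0 : {for h, continuous (fun h : R => (0 : R, h))}.
  by apply: continuous_pairing; [exact: cvg_cst|exact: cvg_id].
have cD : {for h, continuous D}.
  exact: (continuous_comp_at _ _ _ _ _ _ c0 (cdG (1, 0) (0, h) Vh)).
have cfG : {for h, continuous (fun h => f (G (0, h)))}.
  apply: (@continuous_comp_at _ _ _ (fun h => G (0, h)) f); last exact: cf.
  exact: (continuous_comp_at _ _ _ _ _ _ c0 (cG (0, h) Vh)).
have nf : `|f (G (0, h))| != 0 by rewrite normr_eq0; exact: family_nonsingular.
have cq : {for h, continuous (fun h => `|D h| / `|f (G (0, h))|)}.
  by apply: cvgM; [exact: cvg_norm cD|apply: cvgV => //; exact: cvg_norm cfG].
have E k : V k -> `|D k| / `|f (G (0, k))| = (Omega Tper k)^-1.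
  move=> Vk; rewrite /D derive_angle// normrZ ger0_norm; last first.
    by rewrite invr_ge0 ltW// Omega_gt0.
  by rewrite mulfK// normr_eq0; exact: family_nonsingular.
have cq' : `|D k| / `|f (G (0, k))| @[k --> h] --> (Omega Tper h)^-1.
  by rewrite -(E h Vh); exact: cq.
refine (cvg_trans (near_eq_cvg _) cq'); near=> k; apply: E.
by near: k; exact: open_nbhs_nbhs.
Unshelve. all: by end_near. Qed.

Lemma continuous_Omega h : V h -> {for h, continuous (Omega Tper)}.
Proof.
move=> Vh.
have n0 : (Omega Tper h)^-1 != 0 by rewrite invr_neq0// gt_eqF// Omega_gt0.
rewrite (_ : Omega Tper = fun h => ((Omega Tper h)^-1)^-1); last first.
  by apply/funext => k; rewrite invrK.
by apply: cvgV => //; exact: continuous_Omega_inv.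
Qed.

(** Undoing the change of time, [q s h] is [G (Omega Tper h * s, h)], and [Omega] is now known to be
    continuous. *)
Lemma family_continuous (z : R * R) : V z.2 ->
  {for z, continuous (fun z : R * R => q z.1 z.2)}.
Proof.
move=> Vz; have [cG _ _] := class_CS _ _ _ r0_gt0 (family_smooth hfam).
have cO : {for z, continuous (fun z : R * R => Omega Tper z.2)}.
  by apply: (@continuous_comp_at _ _ _ snd (Omega Tper));
    [exact: cvg_snd|exact: continuous_Omega].
have cs : {for z, continuous (fun z : R * R => (Omega Tper z.2 * z.1, z.2))}.
  apply: continuous_pairing; last exact: cvg_snd.
  by apply: cvgM; [exact: cO|exact: cvg_fst].
have cGz := continuous_comp_at _ _ _ _ _ _ cs (cG (Omega Tper z.2 * z.1, z.2) Vz).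
have E (w : R * R) : V w.2 -> G (Omega Tper w.2 * w.1, w.2) = q w.1 w.2.
  by move=> Vw; rewrite /G/= mulrC mulKf// gt_eqF// Omega_gt0.
have c : G (Omega Tper w.2 * w.1, w.2) @[w --> z] --> q z.1 z.2.
  by rewrite -(E z Vz); exact: cGz.
refine (cvg_trans (near_eq_cvg _) c); near=> w; apply: E.
near: w; have := @cvg_snd _ _ (nbhs z.1) (nbhs z.2) _; apply.
exact: open_nbhs_nbhs.
Unshelve. all: by end_near. Qed.

(** Continuity of [1 / Omega] bounds the periods for [h] in [[c, d]], and reduction modulo the
    period brings every time into one compact interval. Clamping [h] replaces continuity on [V] by
    continuity everywhere. *)
Lemma family_bounded (c d : R) : (forall h, c <= h <= d -> V h) ->
  exists2 B, 0 <= B & forall h s, c <= h <= d -> `|q s h| <= B.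
Proof.
move=> cdV; have [cd|dc] := leP c d; last first.
  by exists 0 => // h s /andP[ch hd]; have := le_trans ch hd; rewrite leNgt dc.
have Vcl h : V (clamp c d h) by apply: cdV; exact: clamp_itv.
have cO : {within `[c, d], continuous (fun h => (Omega Tper (clamp c d h))^-1)}.
  apply: continuous_subspaceT => h.
  apply: (@continuous_comp_at _ _ _ (clamp c d) (fun h => (Omega Tper h)^-1)).
    exact: continuous_clamp.
  exact: continuous_Omega_inv.
have [hm _ hmax] := EVT_max cd cO.
pose Tm := 2 * pi * (Omega Tper (clamp c d hm))^-1.
have TE h : V h -> Tper h = 2 * pi * (Omega Tper h)^-1.
  move=> Vh; rewrite /Omega invf_div mulrC divfK// gt_eqF// mulr_gt0//.
  exact: pi_gt0.
have TTm h : c <= h <= d -> Tper h <= Tm.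
  move=> hcd; have := hmax h; rewrite in_itv => /(_ hcd).
  rewrite clamp_id// TE; last exact: cdV.
  by move=> hh; rewrite ler_wpM2l// mulr_ge0// pi_ge0.
have cq : continuous (fun z : R * R => q z.1 (clamp c d z.2)).
  move=> z; apply: (@continuous_comp_at _ _ _ (fun z : R * R => (z.1, clamp c d z.2))
    (fun z : R * R => q z.1 z.2)); last by apply: family_continuous; exact: Vcl.
  apply: continuous_pairing; first exact: cvg_fst.
  apply: (@continuous_comp_at _ _ _ snd (clamp c d)); first exact: cvg_snd.
  exact: continuous_clamp.
have [B B0 hB] := continuous_compact_bounded _ _ _ _
  (compact_setX (@segment_compact _ 0 Tm) (@segment_compact _ c d)) cq.
exists B => // h s hcd; have Vh := cdV h hcd.
have [k hk] := reduce_mod _ s (family_period_gt0 hfam Vh).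
rewrite -(periodic_int _ (fun s => q s h) (Tper h) (fun s => family_periodic hfam s
  Vh) s k).
have := hB (s + k%:~R * Tper h, h); rewrite /= clamp_id//; apply.
split; rewrite /= in_itv//=.
by case/andP: hk => -> /= hk; apply: le_trans hk _; exact: TTm.
Qed.

End family.

Lemma zero_derive_constant {R : realType} (u : R -> R) (a b : R) :
  a <= b -> continuous u ->
  (forall s, a < s < b -> is_derive s (1 : R) u 0) -> u b = u a.
Proof.
move=> ab cu du; apply/eqP; rewrite -subr_eq0 -normr_le0.
have := bounded_derive_increment u (fun=> 0) a b 0 ab cu du.
by rewrite mul0r; apply => s _; rewrite normr0.
Qed.

Lemma Rintegral_primitive {R : realType} (k W : R -> R) (c a b : R) :
  c < a -> a < b -> continuous k ->
  (forall s, c < s -> is_derive s (1 : R) W (k s)) ->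
  (\int[lebesgue_measure]_(x in `[a, b]) k x)%R = W b - W a.
Proof.
move=> ca ab ck dW.
have cW s : c < s -> {for s, continuous W}.
  move=> cs; apply: differentiable_continuous; apply/derivable1_diffP.
  by have := dW s cs.
rewrite /Rintegral (@continuous_FTC2 R k W a b ab)//.
- exact: continuous_subspaceT.
- split.
  + by move=> x; rewrite in_itv/= => /andP[ax _]; have := dW x (lt_trans ca ax).
  + exact: cvg_at_right_filter (cW a ca).
  + exact: cvg_at_left_filter (cW b (lt_trans ca ab)).
- move=> x; rewrite in_itv/= => /andP[ax _]; rewrite derive1E.
  exact: (@derive_val _ _ _ _ _ _ _ (dW x (lt_trans ca ax))).
Qed.

Lemma periodic_sum_shift {R : realType} (a : int -> R) (N : nat) (j : int) :
  (forall k, a (k + N%:Z) = a k) ->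
  \sum_(i < N) a (j + i%:Z) = \sum_(i < N) a i%:Z.
Proof.
move=> aN; case: N aN => [|N] aN; first by rewrite !big_ord0.
have step k : \sum_(i < N.+1) a (k + 1 + i%:Z) = \sum_(i < N.+1) a (k + i%:Z).
  rewrite big_ord_recr [RHS]big_ord_recl /= addr0 addrC; congr (_ + _).
    by rewrite -(aN k) -addn1 PoszD; congr a; lia.
  by apply: eq_bigr => i _; congr a; rewrite /bump /=; lia.
have nat_case (n : nat) k : \sum_(i < N.+1) a (k + n%:Z + i%:Z) = \sum_(i < N.+1) a
  (k + i%:Z).
  elim: n => [|n ih]; first by under eq_bigr do rewrite addr0.
  rewrite -ih -[RHS]step; apply: eq_bigr => i _; congr a; lia.
case: j => n.
  rewrite -[LHS]/(\sum_(i < N.+1) a (n%:Z + i%:Z)).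
  transitivity (\sum_(i < N.+1) a (0 + n%:Z + i%:Z)); last first.
    by rewrite nat_case; apply: eq_bigr => i _; congr a; lia.
  by apply: eq_bigr => i _; congr a; lia.
rewrite -(nat_case n.+1 (Negz n)); apply: eq_bigr => i _; congr a; rewrite NegzE; lia.
Qed.

Section melnikov_facts.
Context {R : realType} (H : 'cV[R]_2 -> R) (g : R -> 'cV[R]_2 -> R -> 'cV[R]_2)
  (t : int -> R) (l : int -> 'cV[R]_2 -> R -> 'cV[R]_2) (q : R -> R -> 'cV[R]_2)
  (T T2 h0 : R) (s nu m : nat).
Hypothesis TE : T = s%:R * T2.
Hypothesis t_nu : forall k : int, t (k + nu%:Z) - t k = T2.
Hypothesis l_nu : forall k : int, l (k + nu%:Z) = l k.

Let N := (m * s * nu)%N.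
Let P := m%:R * T.
Let M := melnikov H g t l q T s nu m.

Lemma impulse_shift (n : nat) (k : int) :
  t (k + (n * nu)%N%:Z) = t k + n%:R * T2 /\ l (k + (n * nu)%N%:Z) = l k.
Proof.
elim: n => [|n [ih1 ih2]]; first by rewrite mul0n mul0r !addr0.
have E : k + (n.+1 * nu)%N%:Z = (k + (n * nu)%N%:Z) + nu%:Z by lia.
by rewrite E l_nu ih2 -(subrK (t (k + (n * nu)%N%:Z)) (t (_ + nu%:Z))) t_nu ih1
  -natr1 mulrDl mul1r;
  split => //; ring.
Qed.

Lemma impulse_shift_period (k : int) : t (k + N%:Z) = t k + P /\ l (k + N%:Z) = l k.
Proof.
have := impulse_shift (m * s) k; rewrite -/N => -[-> ->]; split => //.
by rewrite /P TE natrM mulrA.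
Qed.

Hypothesis cH : forall i, continuous (partial H i).
Hypothesis cg : continuous (fun z : R * 'cV[R]_2 * R => g z.1.1 z.1.2 z.2).
Hypothesis gT : forall tau x eps, g (tau + T) x eps = g tau x eps.
Hypothesis T0 : 0 < T.
Hypothesis m0 : (0 < m)%N.
Hypothesis cq : continuous (fun u => q u h0).
Hypothesis qP : forall u, q (u + m%:R * T) h0 = q u h0.

Let dens tb u : R := (DH H (q (u - tb) h0) *m g u (q (u - tb) h0) 0) 0 0.

Let cqs tb : continuous (fun u => q (u - tb) h0).
Proof.
move=> u; apply: (@continuous_comp_at _ _ _ (fun u => u - tb) (fun u => q u h0));
  last exact: cq.
by apply: cvgB; [exact: cvg_id|exact: cvg_cst].
Qed.

Let cdens tb : continuous (dens tb).
Proof.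
move=> u; have c0 : {for u, continuous (fun=> 0 : R)} by exact: cvg_cst.
have cid : {for u, continuous (@id R)} by exact: cvg_id.
have cG := continuous_comp_at _ _ _ _ (fun z : R * 'cV[R]_2 * R => g z.1.1 z.1.2 z.2)
    _ (continuous_pairing _ _ _ _ _ _ (continuous_pairing _ _ _ _ _ _ cid (cqs tb u))
      c0) (cg _).
exact: (continuous_DH_mulmx _ H _ _ u cH (cqs tb u) cG).
Qed.

Let gP tau x : g (tau + P) x 0 = g tau x 0.
Proof.
rewrite /P; elim: m => [|n ih]; first by rewrite mul0r addr0.
by rewrite -natr1 mulrDl mul1r addrA gT.
Qed.

Let densP tb u : dens tb (u + P) = dens tb u.
Proof. by rewrite /dens gP addrAC qP. Qed.

Let jump tb (k : int) : R :=
  (DH H (q (t k - tb) h0) *m l k (q (t k - tb) h0) 0) 0 0.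

Let jumpN tb k : jump tb (k + N%:Z) = jump tb k.
Proof. by rewrite /jump; have [-> ->] := impulse_shift_period k; rewrite addrAC qP. Qed.

Let P0 : 0 < P. Proof. by rewrite mulr_gt0// ltr0n. Qed.

(** [melnikov] starts its sum at an index [j] picked by [xget] and depending on [tb]. The jump terms
    have period [N] in the index, so a sum of [N] consecutive ones may start anywhere, and [j]
    disappears whatever value [xget] returns. *)
Lemma melnikov_sum tb :
  M tb h0 = (\int[lebesgue_measure]_(u in `[tb, tb + P]) dens tb u)%R +
    \sum_(i < N) jump tb i%:Z.
Proof.
rewrite /M /melnikov; congr (_ + _).
exact: (@periodic_sum_shift R (jump tb) N _ (jumpN tb)).
Qed.

(** The orbit is only known to have period [m T], but shifting time and [tb] together by [T] leaves
    [u - tb] unchanged, while [g] and the impulses have period [T], the latter through an index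
    shift by [s * nu]. *)
Lemma melnikov_period tb : M (tb + T) h0 = M tb h0.
Proof.
rewrite !melnikov_sum; congr (_ + _).
- have [W dW] := continuous_primitive (dens (tb + T)) (tb + T - 1) (cdens _).
  have dWT u : tb - 1 < u -> is_derive u (1 : R) (fun u => W (u + T)) (dens tb u).
    move=> tbu; have du : is_derive u (1 : R) (fun u : R => u + T) 1.
      by apply: (is_derive_eq (is_deriveD (is_derive_id u 1) (is_derive_cst T u 1)));
        rewrite addr0.
    have dWu : is_derive (u + T) (1 : R) W (dens (tb + T) (u + T)) by apply: dW; lra.
    have := @is_derive1_comp R W (fun u => u + T) u _ _ dWu du.
    by rewrite mulr1 /dens gT (_ : u + T - (tb + T) = u - tb)//; ring.
  have lt1 (x : R) : x - 1 < x by rewrite gtrBl.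
  have ltP (x : R) : x < x + P by rewrite ltrDl.
  rewrite (Rintegral_primitive _ _ _ _ _ (lt1 _) (ltP _) (cdens _) dW).
  rewrite (Rintegral_primitive _ _ _ _ _ (lt1 _) (ltP _) (cdens _) dWT).
  by rewrite addrAC.
- rewrite -(@periodic_sum_shift R (jump (tb + T)) N (s * nu)%N%:Z (jumpN _)).
  apply: eq_bigr => i _; rewrite (addrC (s * nu)%N%:Z) /jump.
  have [-> ->] := impulse_shift s i%:Z.
  by rewrite -TE (_ : t i%:Z + T - (tb + T) = t i%:Z - tb)//; ring.
Qed.

(** Moves the window of integration from [[tb, tb + m T]] to [[t 0, t N]], the window of a chain,
    whose impulses have the indices 1 to [N]. The integrand has period [P = m T], so its integral
    over a period does not depend on the starting point. *)
Lemma melnikov_primitive tb : exists W : R -> R, [/\ continuous W,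
    forall u, t 0 < u < t N%:Z -> is_derive u (1 : R) W (dens tb u)
  & M tb h0 = W (t N%:Z) - W (t 0) + \sum_(0 <= i < N) jump tb i.+1%:Z].
Proof.
have tN : t N%:Z = t 0 + P by have [] := impulse_shift_period 0; rewrite add0r.
pose c := Num.min tb (t 0) - 1.
have [c1 c2] : c < tb /\ c < t 0.
  have h1 : Num.min tb (t 0) <= tb by rewrite ge_min lexx.
  have h2 : Num.min tb (t 0) <= t 0 by rewrite ge_min lexx orbT.
  by split; rewrite /c; lra.
have [W dW] := continuous_primitive (dens tb) c (cdens tb).
have cW u : c < u -> {for u, continuous W}.
  move=> cs; apply: differentiable_continuous; apply/derivable1_diffP.
  by have := dW u cs.
have t0N : t 0 < t N%:Z by rewrite tN ltrDl.
exists (fun u => W (clamp (t 0) (t N%:Z) u)); split.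
- move=> u; apply: (@continuous_comp_at _ _ _ (clamp (t 0) (t N%:Z)) W).
    exact: continuous_clamp.
  by apply: cW; have /andP[h _] := clamp_itv (t 0) (t N%:Z) u (ltW t0N); lra.
- move=> u /andP[u1 u2]; have du := dW u (lt_trans c2 u1).
  refine (near_eq_is_derive _ du); near=> v; rewrite clamp_id//.
  by apply/andP; split; apply: ltW; near: v; [exact: lt_nbhsr|exact: lt_nbhsl].
- rewrite !clamp_id ?lexx ?ltW// melnikov_sum; congr (_ + _).
    have ltP : tb < tb + P by rewrite ltrDl.
    rewrite (Rintegral_primitive _ _ _ _ _ c1 ltP (cdens tb) dW).
    rewrite tN; pose D u := W (u + P) - W u.
    have dD u : c < u -> is_derive u (1 : R) D 0.
      move=> cu; have du : is_derive u (1 : R) (fun u : R => u + P) 1.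
        by apply: (is_derive_eq (is_deriveD (is_derive_id u 1) (is_derive_cst P u
          1))); rewrite addr0.
      have dWu : is_derive (u + P) (1 : R) W (dens tb (u + P)) by apply: dW;
        have := P0; lra.
      have d1 : is_derive u (1 : R) (fun u => W (u + P)) (dens tb (u + P) * 1).
        exact: (@is_derive1_comp R W (fun u => u + P) u _ _ dWu du).
      by apply: (is_derive_eq (is_deriveB d1 (dW u cu))); rewrite mulr1 densP subrr.
    have cst (a b : R) : c < a -> a <= b -> D b = D a.
      move=> ca ab; pose D' u := D (clamp a b u).
      have -> : D b = D' b by rewrite /D' clamp_id// lexx andbT.
      have -> : D a = D' a by rewrite /D' clamp_id// lexx.
      apply: zero_derive_constant => // u.
        apply: (@continuous_comp_at _ _ _ (clamp a b) D); first exact: continuous_clamp.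
        apply: differentiable_continuous; apply/derivable1_diffP.
        have h : c < clamp a b u by have /andP[h _] := clamp_itv a b u ab; lra.
        by have := dD _ h.
      move=> /andP[au ub]; refine (near_eq_is_derive _ (dD u (lt_trans ca au))).
      near=> v; rewrite /D' clamp_id//.
      by apply/andP; split; apply: ltW; near: v; [exact: lt_nbhsr|exact: lt_nbhsl].
    rewrite -/(D tb) -/(D (t 0)).
    by have [h|h] := leP tb (t 0); [exact: esym (cst _ _ c1 h)|exact: cst _ _ c2 (ltW h)].
  rewrite -(@periodic_sum_shift R (jump tb) N 1 (jumpN tb)) big_mkord.
  by apply: eq_bigr => i _; congr (jump tb _); lia.
Unshelve. all: by end_near. Qed.

End melnikov_facts.

(** * From solutions to chains *)

Lemma sup_dist_lt {R : realType} (A : set 'cV[R]_2) (x : R -> 'cV[R]_2) (r : R) :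
  (sup_dist A x < r%:E)%E -> forall s, exists2 a, A a & `|x s - a| < r.
Proof.
move=> xr s; have : (edist_inf A (x s) < r%:E)%E.
  by apply: le_lt_trans xr; apply: ereal_sup_ubound; exists s.
move=> /ereal_inf_lt[_ [a Aa <-]] /edist_lt_ball /=.
by rewrite -ball_normE => h; exists a.
Qed.

Lemma continuous_clamp_comp {R : realType} (T : topologicalType) (u : R -> T)
    (a b : R) : a <= b -> {within `[a, b], continuous u} ->
  continuous (fun s => u (clamp a b s)).
Proof.
move=> ab /subspace_continuousP cu s.
have rI r : `[a, b]%classic (clamp a b r) by rewrite /= in_itv/=; exact: clamp_itv.
have h1 : clamp a b r @[r --> s] --> within `[a, b] (nbhs (clamp a b s)).
  move=> Q /= hQ; have hQ' := @continuous_clamp R a b s _ hQ.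
  have hQ2 : \forall r \near s, `[a, b]%classic (clamp a b r) -> Q (clamp a b r)
    by exact: hQ'.
  suff : \forall r \near s, Q (clamp a b r) by [].
  by near=> r; apply: (near hQ2 r) => //; exact: rI.
exact: (cvg_comp _ _ h1 (cu _ (rI s))).
Unshelve. all: by end_near. Qed.

(** In use, [x a] is the value before the jump at [a]; [xt] replaces it by the right limit [xp], and
    clamping extends the piece to the whole line. *)
Lemma piece_extension {R : realType} (V : normedModType R) (x : R -> V) (a b : R)
    (xp : V) : a < b ->
  (forall s, a < s < b -> {for s, continuous x}) ->
  x s @[s --> a^'+] --> xp -> x s @[s --> b^'-] --> x b ->
  exists U : R -> V, [/\ continuous U, U a = xp & forall s, a < s <= b -> U s = x s].
Proof.
move=> ab cx xa xb; pose xt u := if u <= a then xp else x u.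
have xtE u : a < u -> xt u = x u by move=> au; rewrite /xt leNgt au.
have xta : xt a = xp by rewrite /xt lexx.
have cxt : {within `[a, b], continuous xt}.
  apply/(continuous_within_itvP _ ab); split.
  - move=> s; rewrite in_itv/= => /andP[as_ sb].
    have h : x r @[r --> s] --> xt s by rewrite xtE//; apply: cx; rewrite as_ sb.
    refine (cvg_trans (near_eq_cvg _) h); near=> r; apply/esym/xtE.
    by near: r; exact: lt_nbhsr.
  - rewrite xta; refine (cvg_trans (near_eq_cvg _) xa); near=> r; apply/esym/xtE.
    by near: r; exact: nbhs_right_gt.
  - rewrite xtE//; refine (cvg_trans (near_eq_cvg _) xb); near=> r; apply/esym/xtE.
    by near: r; exact: nbhs_left_gt.
exists (fun s => xt (clamp a b s)); split.
- exact: continuous_clamp_comp (ltW ab) cxt.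
- by rewrite clamp_id// lexx ltW.
- by move=> s /andP[as_ sb]; rewrite clamp_id ?sb ?andbT ?ltW// xtE.
Unshelve. all: by end_near. Qed.

Lemma impulse_interval {R : realType} (t : int -> R) (s : R) :
  (forall i j : int, i < j -> t i < t j) ->
  t n%:Z @[n --> \oo] --> +oo -> t (- n%:Z) @[n --> \oo] --> -oo ->
  exists k : int, t (k - 1) < s <= t k.
Proof.
move=> tinc tp tm.
have [n0 _ hn0] := (cvgryPge _).1 tp s.
have [n1 _ hn1] := (cvgrNyPlt _).1 tm s.
pose Q (i : nat) := s <= t (- n1%:Z + i%:Z).
have exQ : exists i, Q i.
  exists (n1 + n0)%N; rewrite /Q (_ : - n1%:Z + _ = n0%:Z); last by lia.
  by apply: hn0 => /=.
have [i Qi imin] := ex_minnP exQ.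
exists (- n1%:Z + i%:Z); apply/andP; split; last exact: Qi.
case: i Qi imin => [|i] Qi imin.
  have := hn1 n1 (leqnn _); move: Qi; rewrite /Q addr0 => h1 h2.
  by have := le_lt_trans h1 h2; rewrite ltxx.
rewrite ltNge; apply/negP => h.
have : (i.+1 <= i)%N.
  by apply: imin; rewrite /Q; move: h; congr (_ <= t _); lia.
by rewrite ltnn.
Qed.

Lemma impulsive_solution_left_limit {R : realType} (f : 'cV[R]_2 -> 'cV[R]_2)
    (g : R -> 'cV[R]_2 -> R -> 'cV[R]_2) (t : int -> R)
    (l : int -> 'cV[R]_2 -> R -> 'cV[R]_2) (eps : R) (x : R -> 'cV[R]_2) (s : R) :
  (exists k : int, t (k - 1) < s <= t k) ->
  impulsive_solution f g t l eps x -> lim (x u @[u --> s^'-]) = x s.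
Proof.
move=> [k /andP[ks]]; rewrite le_eqVlt => /predU1P[->|sk] [dx jx].
  by have [xm [xp [h1 _ -> _]]] := jx k; exact: cvg_lim.
apply: cvg_lim => //; apply: cvg_at_left_filter.
apply: differentiable_continuous; apply/derivable1_diffP.
by have := dx k s; rewrite ks sk => /(_ isT).
Qed.

(** [Y i] is the right limit at [t i], so that periodicity of right limits closes the chain. The
    impulse that ends piece [i] has index [i + 1]. *)
Lemma chain_of_solution {R : realType} (f : 'cV[R]_2 -> 'cV[R]_2)
    (g : R -> 'cV[R]_2 -> R -> 'cV[R]_2) (t : int -> R)
    (l : int -> 'cV[R]_2 -> R -> 'cV[R]_2) (eps : R) (x : R -> 'cV[R]_2) (N : nat) :
  (forall i j : int, i < j -> t i < t j) ->
  impulsive_solution f g t l eps x ->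
  exists (U : nat -> R -> 'cV[R]_2) (Y : nat -> 'cV[R]_2),
    [/\ impulsive_chain (fun s x => f x + eps *: g s x eps)
          (fun i x => x + eps *: l i.+1%:Z x eps) (fun i => t i%:Z) N U Y,
        forall i, x s @[s --> (t i%:Z)^'+] --> Y i
      & forall i s, t i%:Z < s <= t i.+1%:Z -> U i s = x s].
Proof.
move=> tinc [dx jx].
have /choice[Y hY] : forall i : nat, exists xp : 'cV[R]_2,
    [/\ x s @[s --> (t i%:Z)^'+] --> xp, x s @[s --> (t i%:Z)^'-] --> x (t i%:Z)
      & xp = x (t i%:Z) + eps *: l i%:Z (x (t i%:Z)) eps].
  move=> i; have [xm [xp [h1 h2 h3 h4]]] := jx i%:Z.
  by exists xp; rewrite h3; split => //; rewrite -h4 addrC subrK.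
have tS (i : nat) : t i%:Z < t i.+1%:Z by apply: tinc; rewrite ltz_nat.
have dxi (i : nat) s : t i%:Z < s < t i.+1%:Z ->
    is_derive s (1 : R) x (f (x s) + eps *: g s (x s) eps).
  by move=> sI; apply: (dx i.+1%:Z); rewrite (_ : i.+1%:Z - 1 = i%:Z) //; lia.
have /choice[U hU] : forall i : nat, exists U : R -> 'cV[R]_2, [/\ continuous U,
    U (t i%:Z) = Y i & forall s, t i%:Z < s <= t i.+1%:Z -> U s = x s].
  move=> i; apply: piece_extension => //.
  - move=> s sI; apply: differentiable_continuous; apply/derivable1_diffP.
    by have := dxi i s sI.
  - by have [] := hY i.
  - by have [] := hY i.+1.
exists U, Y; split; last 2 first.
- by move=> i; have [] := hY i.
- by move=> i s sI; have [_ _ h] := hU i; exact: h.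
move=> i iN; have [h1 h2 h3] := hU i; split => //.
  move=> s /andP[s1 s2]; rewrite h3 ?s1 ?ltW//.
  have sI : t i%:Z < s < t i.+1%:Z by rewrite s1.
  refine (near_eq_is_derive _ (dxi i s sI)); near=> u; rewrite h3//.
  apply/andP; split; first by near: u; exact: lt_nbhsr.
  by apply: ltW; near: u; exact: lt_nbhsl.
by have [_ _] := hY i.+1; rewrite h3// tS lexx.
Unshelve. all: by end_near. Qed.

(* [lim] of a divergent filter is the default point 0, so a nonzero value of
   [derive1] witnesses derivability. *)
Lemma derive1_neq0_derivable {R : realType} (u : R -> R) (a : R) :
  derive1 u a != 0 -> derivable u a 1.
Proof.
move=> D0; apply: contrapT => nd; move/eqP: D0; apply.
by rewrite derive1E /derive dvgP.
Qed.

(** Multiplication by the derivative gives both increments a fixed sign, so positive and negative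
    derivatives are treated alike later on. *)
Lemma derive1_neq0_sign {R : realType} (u : R -> R) (a : R) :
  derive1 u a != 0 -> exists2 d0 : R, 0 < d0 & forall d, 0 < d <= d0 ->
    0 < derive1 u a * (u (a + d) - u a) /\ derive1 u a * (u (a - d) - u a) < 0.
Proof.
move=> D0; have du := derive1_neq0_derivable u a D0.
set D := derive1 u a in D0 *.
have D2 : 0 < `|D| / 2 by rewrite divr_gt0// normr_gt0.
have : (h^-1 *: ((u \o shift a) (h *: (1 : R)) - u a)) @[h --> 0^'] --> D.
  by rewrite /D derive1E; exact: du.
move=> /cvgrPdist_lt/(_ _ D2)/nbhs_ballP[r /= r0 hr].
have key (h : R) : `|h| < r -> h != 0 -> 0 < (D * (u (a + h) - u a)) * h^-1.
  move=> hltr hn0; have := hr h; rewrite -ball_normE/= sub0r normrN => /(_ hltr hn0).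
  rewrite /= [h *: 1]mulr1 (addrC h) -[_ *: _]/(_ * _) => hh.
  rewrite -mulrA [(u _ - _) * _]mulrC; set k := _^-1 * _ in hh *.
  move: hh; have [Dp|Dn] := ltP 0 D.
    by rewrite (gtr0_norm Dp) ltr_norml => /andP[h1 h2]; rewrite mulr_gt0//; lra.
  have {}Dn : D < 0 by rewrite lt_neqAle D0.
  by rewrite (ltr0_norm Dn) ltr_norml => /andP[h1 h2]; rewrite nmulr_rgt0//; lra.
exists (r / 2); first by rewrite divr_gt0.
move=> d /andP[d0 dr]; have dltr : d < r by lra.
have d1 : `|d| < r by rewrite gtr0_norm.
have d2 : `|- d| < r by rewrite normrN gtr0_norm.
have n1 : d != 0 by rewrite gt_eqF.
have n2 : - d != 0 by rewrite oppr_eq0.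
have := key _ d1 n1; have := key _ d2 n2.
rewrite invrN mulrN oppr_gt0 (pmulr_llt0 _ (_ : 0 < d^-1)) ?invr_gt0//.
by rewrite (pmulr_lgt0 _ (_ : 0 < d^-1)) ?invr_gt0.
Qed.

(* In the coordinates (energy, tangential component) two points near [z] with
   the same image differ by a multiple of the gradient, along which [H] is
   strictly monotone. *)
Lemma energy_tangent_injective {R : realType} (H : 'cV[R]_2 -> R) (z : 'cV[R]_2) :
  (forall y i, derivable H y (delta_mx i 0)) ->
  (forall i, continuous (partial H i)) ->
  0 < partial H 0 z ^+ 2 + partial H 1 z ^+ 2 ->
  exists2 r : R, 0 < r & forall x y, `|x - z| <= r -> `|y - z| <= r ->
    H x = H y ->
    partial H 1 z * x 0 0 - partial H 0 z * x 1 0 =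
      partial H 1 z * y 0 0 - partial H 0 z * y 1 0 -> x = y.
Proof.
set n0 := partial H 0 z; set n1 := partial H 1 z => dH cH nn.
set S := n0 ^+ 2 + n1 ^+ 2 in nn.
pose Cn := `|n0| + `|n1| + 1.
have Cn0 : 0 < Cn by rewrite ltr_wpDl// addr_ge0.
have e0 : 0 < S / 2 / Cn by rewrite !divr_gt0.
have nearp i : exists2 r : R, 0 < r & forall y, `|y - z| <= r ->
    `|partial H i y - partial H i z| <= S / 2 / Cn.
  have /cvgrPdist_le/(_ _ e0)/nbhs_ballP[r /= r0 hr] := cH i z.
  exists (r / 2); first by rewrite divr_gt0.
  move=> y yz; rewrite distrC; apply: hr; rewrite -ball_normE/= distrC.
  by apply: le_lt_trans yz _; rewrite ltr_pdivrMr// ltr_pMr// ltr1n.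
have [ra ra0 ha] := nearp 0; have [rb rb0 hb] := nearp 1.
(* The mean value points lie within [|x - y| <= 2 r] of [y], hence within [3 r] of [z]. *)
pose r := Num.min ra rb / 3.
have r0 : 0 < r by rewrite divr_gt0// lt_min ra0.
have r3a : 3 * r <= ra by rewrite /r mulrC divfK// ge_min lexx.
have r3b : 3 * r <= rb by rewrite /r mulrC divfK// ge_min lexx orbT.
exists r => // x y xz yz Hxy Txy.
have [xi [hxi _ E]] := partial_increment H y (x - y) dH.
have vr : `|x - y| <= 2 * r.
  rewrite -(subrK z x) -addrA; apply: le_trans (ler_normD _ _) _.
  by rewrite [`|z - y|]distrC; lra.
have xiz i : `|xi i - z| <= 3 * r.
  rewrite -(subrK y (xi i)) -addrA; apply: le_trans (ler_normD _ _) _.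
  by have := hxi i; lra.
have h0 := ha _ (le_trans (xiz 0) r3a); have h1 := hb _ (le_trans (xiz 1) r3b).
move: E; rewrite [y + _]addrC subrK Hxy subrr big_ord_recl big_ord1.
rewrite (_ : lift _ _ = 1); last exact: val_inj.
set p0 := partial H 0 (xi 0) in h0 *; set p1 := partial H 1 (xi 1) in h1 *.
rewrite -/n0 in h0; rewrite -/n1 in h1.
rewrite !mxE; set v0 := x 0 0 - y 0 0; set v1 := x 1 0 - y 1 0 => E.
have T : n1 * v0 = n0 * v1 by rewrite /v0 /v1; lra.
pose lam := (n0 * v0 + n1 * v1) / S.
have Sn0 : S != 0 by rewrite gt_eqF.
have v0E : v0 = lam * n0.
  apply: (mulIf Sn0); rewrite /lam mulrAC divfK// /S.
  have -> : v0 * (n0 ^+ 2 + n1 ^+ 2) = n0 ^+ 2 * v0 + n1 * (n1 * v0) by ring.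
  by rewrite T; ring.
have v1E : v1 = lam * n1.
  apply: (mulIf Sn0); rewrite /lam mulrAC divfK// /S.
  have -> : v1 * (n0 ^+ 2 + n1 ^+ 2) = n1 ^+ 2 * v1 + n0 * (n0 * v1) by ring.
  by rewrite -T; ring.
have pos : 0 < p0 * n0 + p1 * n1.
  have a0 : `|(p0 - n0) * n0| <= S / 2 / Cn * `|n0| by rewrite normrM ler_wpM2r.
  have a1 : `|(p1 - n1) * n1| <= S / 2 / Cn * `|n1| by rewrite normrM ler_wpM2r.
  have a2 : S / 2 / Cn * `|n0| + S / 2 / Cn * `|n1| < S / 2.
    have -> : S / 2 / Cn * `|n0| + S / 2 / Cn * `|n1| = S / 2 - S / 2 / Cn.
      have CnE : `|n0| + `|n1| = Cn - 1 by rewrite /Cn; ring.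
      by rewrite -mulrDr CnE mulrBr mulr1 divfK// gt_eqF.
    by rewrite gtrBl.
  move: a0 a1; rewrite !ler_norml => /andP[b0 _] /andP[b1 _].
  have -> : p0 * n0 + p1 * n1 = S + (p0 - n0) * n0 + (p1 - n1) * n1 by rewrite /S; ring.
  lra.
have lam0 : lam = 0.
  apply/eqP; rewrite -(mulIr_eq0 _ (mulIf (lt0r_neq0 pos))).
  by apply/eqP; rewrite [RHS]E v0E v1E; ring.
apply: cV2_eq; apply/eqP; rewrite -subr_eq0; apply/eqP.
  by rewrite -/v0 v0E lam0 mul0r.
by rewrite -/v1 v1E lam0 mul0r.
Qed.

Lemma norm_sub_half {R : realType} (V : normedModType R) (x y z : V) (c : R) :
  `|x - y| <= c / 2 -> `|y - z| <= c / 2 -> `|x - z| <= c.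
Proof.
move=> xy yz; rewrite -(subrK y x) -addrA; apply: le_trans (ler_normD _ _) _.
by rewrite [leRHS]splitr lerD.
Qed.

Lemma half_le {R : realType} (c : R) : 0 < c -> c / 2 <= c.
Proof. lra. Qed.

Lemma half_le_of_dist {R : realType} (a b : R) : `|a - b| <= a / 2 -> a / 2 <= b.
Proof. by rewrite ler_norml => /andP[_]; lra. Qed.

Lemma radius_le {R : realType} (a x r r' : R) : r <= r' ->
  a - r <= x <= a + r -> a - r' <= x <= a + r'.
Proof. by move=> rr /andP[h1 h2]; apply/andP; split; lra. Qed.

Lemma radius_ends {R : realType} (a r : R) : 0 < r ->
  [/\ a - r < a + r, a - r <= a <= a + r, a - r <= a - r <= a + r
    & a - r <= a + r <= a + r].
Proof. by move=> r0; split; try (apply/andP; split); lra. Qed.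

(** The factor [e] makes [e * E] close to [e ^+ 2 * m], whose sign is independent of that of [e];
    the error is at most half of its size. *)
Lemma first_order_sign {R : realType} (D e m E : R) : e != 0 ->
  `|E - e * m| <= `|m| / 2 * `|e| ->
  (0 < D * m -> 0 < D * (e * E)) /\ (D * m < 0 -> D * (e * E) < 0).
Proof.
move=> e0 hE; have e2 : 0 < e ^+ 2 by rewrite exprn_even_gt0.
have abse : `|e| * `|e| = e ^+ 2 by rewrite -expr2 real_normK// num_real.
have : `|D * (e * E) - e ^+ 2 * (D * m)| <= e ^+ 2 * (`|D * m| / 2).
  have -> : D * (e * E) - e ^+ 2 * (D * m) = D * e * (E - e * m) by ring.
  rewrite !normrM -abse; apply: le_trans (ler_wpM2l _ hE) _; first by rewrite mulr_ge0.
  by rewrite le_eqVlt; apply/orP; left; apply/eqP; ring.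
move=> h1; split=> h2; move: h1.
  by rewrite (gtr0_norm h2) ler_norml => /andP[h3 _]; have := mulr_gt0 e2 h2; lra.
rewrite (ltr0_norm h2) ler_norml => /andP[_ h3].
have h4 : 0 < - (D * m) by lra.
by have := mulr_gt0 e2 h4; lra.
Qed.

(** [b - c = beta * k] has absolute value at least [err], and replacing [b] by [a] changes it by at
    most half of [err]. *)
Lemma perturbed_shift_sign {R : realType} (D beta k a b c err : R) : 0 < err ->
  `|a - b| <= err / 2 -> b - c = beta * k -> 0 < k -> err <= `|beta| * k ->
  (0 < D * beta -> 0 < D * (a - c)) /\ (D * beta < 0 -> D * (a - c) < 0).
Proof.
move=> err0; rewrite ler_norml => /andP[a1 a2] bc k0 ek.
have [dpos|dneg|<-] := ltgtP 0 beta; last by rewrite mulr0 ltxx.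
- rewrite (gtr0_norm dpos) in ek; have ac : 0 < a - c by lra.
  by rewrite !pmulr_lgt0 ?pmulr_llt0//.
- rewrite (ltr0_norm dneg) in ek; have ac : a - c < 0 by lra.
  by rewrite !nmulr_lgt0 ?nmulr_llt0//.
Qed.

(** * The impulsive system *)

(** Used to pass, in both directions, between the truncated and the true system for a chain that
    stays in the box. *)
Lemma impulsive_chain_ext {R : realType} (F F' : R -> 'cV[R]_2 -> 'cV[R]_2)
    (J J' : nat -> 'cV[R]_2 -> 'cV[R]_2) (tau : nat -> R) (N : nat)
    (U : nat -> R -> 'cV[R]_2) (Y : nat -> 'cV[R]_2) (B : R) :
  (forall i, tau i < tau i.+1) ->
  (forall s x, `|x| <= B -> F s x = F' s x) ->
  (forall i x, `|x| <= B -> J i x = J' i x) ->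
  (forall i s, (i < N)%N -> tau i < s <= tau i.+1 -> `|U i s| <= B) ->
  impulsive_chain F J tau N U Y -> impulsive_chain F' J' tau N U Y.
Proof.
move=> tauS FF JJ UB ch i iN; have [h1 h2 h3 h4] := ch i iN; split => //.
- move=> s sI; rewrite -FF; first exact: h3.
  by case/andP: sI => s1 s2; apply: UB => //; rewrite s1 ltW.
- by rewrite -JJ//; apply: UB => //; rewrite tauS lexx.
Qed.

Section system.
Context {R : realType} (r0 r1 : nat)
  (f : 'cV[R]_2 -> 'cV[R]_2) (g : R -> 'cV[R]_2 -> R -> 'cV[R]_2)
  (H : 'cV[R]_2 -> R) (V : set R) (L : R -> set 'cV[R]_2) (Tper : R -> R)
  (q : R -> R -> 'cV[R]_2) (t : int -> R)
  (l : int -> 'cV[R]_2 -> R -> 'cV[R]_2)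
  (T1 T2 T h0 : R) (nu p s m K : nat).
Hypothesis r0_gt0 : (0 < r0)%N.
Hypothesis r1_gt0 : (0 < r1)%N.
Hypothesis hf : class_C r0 setT f.
Hypothesis hg : class_C r0 setT (fun z : R * 'cV[R]_2 * R => g z.1.1 z.1.2 z.2).
Hypothesis hT1 : 0 < T1.
Hypothesis hgT1 : forall (tau : R) (x : 'cV[R]_2) (eps : R),
  g (tau + T1) x eps = g tau x eps.
Hypothesis hH : class_C r1 setT H.
Hypothesis hfH : forall x : 'cV[R]_2, f x = hamiltonian_field H x.
Hypothesis Vopen : open V.
Hypothesis hfam : periodic_family r0 f H V L Tper q.
Hypothesis himp : impulse_data r0 T2 nu t l.
Hypothesis hp : (0 < p)%N.
Hypothesis hs : (0 < s)%N.
Hypothesis hT : T = p%:R * T1.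
Hypothesis hT' : T = s%:R * T2.
Hypothesis Vh0 : V h0.
Hypothesis hm : (0 < m)%N.
Hypothesis hK : (0 < K)%N.
Hypothesis hres : Tper h0 / T = m%:R / K%:R.

Let M := melnikov H g t l q T s nu m.
Let N := (m * s * nu)%N.
Let P := m%:R * T.
Let tau (i : nat) := t i%:Z.

Definition system_chain (e : R) (U : nat -> R -> 'cV[R]_2) (Y : nat -> 'cV[R]_2) :=
  impulsive_chain (fun s x => f x + e *: g s x e)
    (fun i x => x + e *: l i.+1%:Z x e) (fun i => t i%:Z) (m * s * nu) U Y.

Definition truncated_chain (B e : R) (U : nat -> R -> 'cV[R]_2) (Y : nat -> 'cV[R]_2) :=
  impulsive_chain (fun s x => f (clampV B x) + e *: g s (clampV B x) e)
    (fun i x => x + e *: l i.+1%:Z (clampV B x) e) (fun i => t i%:Z) (m * s * nu) U Y.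

Lemma T_gt0 : 0 < T.
Proof. by rewrite hT mulr_gt0// ltr0n. Qed.

Lemma period_gt0 : 0 < P.
Proof. by rewrite mulr_gt0 ?T_gt0// ltr0n. Qed.

Lemma resonance : P = K%:R * Tper h0.
Proof.
have T0 : T != 0 by rewrite gt_eqF// T_gt0.
have K0 : K%:R != 0 :> R by rewrite pnatr_eq0 -lt0n.
move: hres => /eqP; rewrite eqr_div// => /eqP E.
by rewrite /P -E mulrC.
Qed.

Lemma q_periodic u : q (u + P) h0 = q u h0.
Proof.
rewrite resonance -[K%:R]/(K%:Z%:~R).
exact: (periodic_int _ (fun u => q u h0) _ (fun s => family_periodic hfam s Vh0)).
Qed.

Lemma g_periodic u x e : g (u + T) x e = g u x e.
Proof.
rewrite hT -[p%:R]/(p%:Z%:~R).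
exact: (periodic_int _ (fun u => g u x e) _ (fun u => hgT1 u x e)).
Qed.

Lemma q_continuous : continuous (fun u => q u h0).
Proof. exact: (family_continuous_time _ _ _ _ _ _ _ hfam h0 Vh0). Qed.

Lemma f_continuous : continuous f.
Proof. by have [h _ _] := class_CS _ _ _ r0_gt0 hf; move=> x; exact: h. Qed.

Lemma g_continuous : continuous (fun z : R * 'cV[R]_2 * R => g z.1.1 z.1.2 z.2).
Proof. by have [h _ _] := class_CS _ _ _ r0_gt0 hg; move=> x; exact: h. Qed.

Lemma H_derivable y i : derivable H y (delta_mx i 0).
Proof. by have [_ h _] := class_CS _ _ _ r1_gt0 hH; exact: h. Qed.

Lemma H_partial_continuous i : continuous (partial H i).
Proof. by have [_ _ h] := class_CS _ _ _ r1_gt0 hH; move=> x; exact: h. Qed.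

Lemma H_continuous : continuous H.
Proof. exact: continuous_of_partials H_derivable H_partial_continuous. Qed.

Lemma DH_f x : (DH H x *m f x) 0 0 = 0.
Proof. by rewrite DH_mulmx2 hfH !mxE/=; ring. Qed.

Lemma tau_lt i : tau i < tau i.+1.
Proof. by apply: (impulse_incr himp); rewrite ltz_nat. Qed.

Lemma period_shift (k : int) : t (k + N%:Z) = t k + P /\ l (k + N%:Z) = l k.
Proof.
exact: (impulse_shift_period _ _ _ _ _ _ _ hT' (impulse_t_periodic himp)
  (impulse_l_periodic himp)).
Qed.

Lemma tauN : t N%:Z = t 0 + P.
Proof. by have [] := period_shift 0; rewrite add0r. Qed.

Lemma jump_bound (B : R) : exists2 C, 0 <= C & forall i x e, (i < N)%N ->
  `|x| <= B -> `|e| <= 1 -> `|l i.+1%:Z x e| <= C.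
Proof.
suff h n : exists2 C, 0 <= C & forall i x e, (i < n)%N ->
  `|x| <= B -> `|e| <= 1 -> `|l i.+1%:Z x e| <= C by exact: h.
elim: n => [|n [C C0 hC]]; first by exists 0.
have [D D0 hD] := continuous_compact_bounded _ _ _ _
  (compact_setX (compact_box B) (@segment_compact _ (-1) 1)) (@impulse_continuous _ _
    _ _ _ _ himp n.+1%:Z).
exists (C + D); first by rewrite addr_ge0.
move=> i x e; rewrite ltnS leq_eqVlt => /predU1P[->|iltn] xB e1; last first.
  by apply: le_trans (hC _ _ _ iltn xB e1) _; rewrite lerDl.
have := hD (x, e); rewrite /= => h; apply: le_trans (h _) _; last by rewrite lerDr.
by split; rewrite //= in_itv/= -ler_norml.
Qed.

Lemma truncated_chain_closeness (B : R) : 0 <= B ->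
  forall d, 0 < d -> exists2 d', 0 < d' &
    forall (e : R) (y : R -> 'cV[R]_2) U Y, `|e| <= d' ->
      (forall s, is_derive s (1 : R) y (f (y s))) -> (forall s, `|y s| <= B) ->
      truncated_chain B e U Y -> `|Y 0%N - y (tau 0%N)| <= d' ->
      (forall i s, (i < N)%N -> tau i <= s <= tau i.+1 -> `|U i s - y s| <= d) /\
      (forall i, (i <= N)%N -> `|Y i - y (tau i)| <= d).
Proof.
move=> B0 d d0.
have [Lf Lf0 hLf] := class_C_box_lipschitz _ _ B r0_gt0 hf.
have [Cg Cg0 hCg] := continuous_compact_bounded _ _ _ _
  (compact_param_box (tau 0) (tau N) B) g_continuous.
have [Cl Cl0 hCl] := jump_bound B.
have gC u x e : tau 0 < u < tau N -> `|x| <= B -> `|e| <= 1 -> `|g u x e| <= Cg.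
  move=> /andP[u1 u2] xB e1; apply: (hCg (u, x, e)).
  by apply: param_boxP => //; rewrite !ltW.
exact: (chain_closeness f g (fun i => l i.+1%:Z) tau N B Lf Cg Cl B0 Lf0 Cg0 Cl0 tau_lt
  hLf gC hCl d d0).
Qed.

Lemma orbit_solution h tb : V h ->
  forall u, is_derive u (1 : R) (fun u => q (u - tb) h) (f (q (u - tb) h)).
Proof.
move=> Vh u; apply: is_derive_cV2 => i.
have dq := is_derive_entry _ _ _ _ _ i (family_solution hfam (u - tb) Vh).
have du : is_derive u (1 : R) (fun u : R => u - tb) 1.
  by apply: (is_derive_eq (is_deriveB (is_derive_id u 1) (is_derive_cst tb u 1)));
    rewrite subr0.
have := @is_derive1_comp R (fun s => q s h i 0) (fun u => u - tb) u _ _ dq du.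
by rewrite mulr1.
Qed.

Lemma orbit_continuous h tb : V h -> continuous (fun u => q (u - tb) h).
Proof.
move=> Vh u; apply: differentiable_continuous; apply/derivable1_diffP.
by have := orbit_solution h tb Vh u.
Qed.

(** * The necessary condition *)

Lemma chain_energy (tb kappa : R) : 0 < kappa -> exists2 d, 0 < d &
  forall e U Y, `|e| <= d -> system_chain e U Y ->
    (forall i u, (i < N)%N -> tau i <= u <= tau i.+1 -> `|U i u - q (u - tb) h0| <= d) ->
    `|H (Y N) - H (Y 0%N) - e * M tb h0| <= kappa * `|e|.
Proof.
move=> k0.
have [W [cW dW ME]] := melnikov_primitive H g t l q T T2 h0 s nu m hT'
  (impulse_t_periodic himp)
  (impulse_l_periodic himp) H_partial_continuous g_continuous g_periodic T_gt0 hm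
  q_continuous q_periodic tb.
have [d d0 hd] := energy_balance H f g (fun i => l i.+1%:Z) tau N (fun u => q (u -
  tb) h0) W
  H_derivable H_partial_continuous DH_f g_continuous
  (fun i => @impulse_continuous _ _ _ _ _ _ himp i.+1%:Z) tau_lt (orbit_continuous h0
    tb Vh0) cW dW kappa k0.
by exists d => // e U Y ed ch close; rewrite /M ME; exact: (hd e U Y ed ch close).
Qed.

Lemma orbit_bound : exists2 B, 0 <= B & forall u, `|q u h0| <= B.
Proof.
have hV h : h0 <= h <= h0 -> V h by move=> /andP[h1 h2]; rewrite (_ : h = h0)//;
  apply: le_anti; rewrite h1 h2.
have [B B0 hB] := family_bounded _ _ _ _ _ _ _ r0_gt0 hfam Vopen f_continuous h0 h0 hV.
by exists B => // u; apply: hB; rewrite lexx.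
Qed.

(** A closed chain gains no energy, while [chain_energy] puts the gain within half of [|e * M|] of
    [e * M]. Closeness to the orbit is demanded of the starting point only;
    [truncated_chain_closeness] propagates it. *)
Lemma no_closed_chain (B tb : R) : 0 <= B -> (forall u, `|q u h0| <= B) ->
  M tb h0 != 0 -> exists2 r, 0 < r & forall e U Y, 0 < `|e| <= r ->
    truncated_chain B e U Y -> system_chain e U Y ->
    `|Y 0%N - q (tau 0%N - tb) h0| <= r -> Y N <> Y 0%N.
Proof.
move=> B0 qB Mtb.
have k0 : 0 < `|M tb h0| / 2 by rewrite divr_gt0// normr_gt0.
have [d d0 hd] := chain_energy tb _ k0.
have [d' d'0 hd'] := truncated_chain_closeness B B0 d d0.
exists (Num.min d d'); first by rewrite lt_min d0.
move=> e U Y; rewrite !le_min => /andP[e0 /andP[ed ed']] tch ch /andP[_ Yd'] YN.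
have [close _] := hd' e _ U Y ed' (orbit_solution h0 tb Vh0) (fun u => qB _) tch Yd'.
have := hd e U Y ed ch close.
rewrite YN subrr sub0r normrN normrM mulrC ler_pM2r// => h.
have := k0; lra.
Qed.

Lemma melnikov_necessary (x : R -> R -> 'cV[R]_2) :
  (\forall eps \near 0^', periodic_solution f g t l (m%:R * T) eps (x eps)) ->
  sup_dist (L h0) (x eps) @[eps --> 0^'] --> 0%E ->
  exists t0 : R, 0 <= t0 <= T /\ M t0 h0 = 0.
Proof.
move=> xsol xdist; apply: contrapT => none.
have Mper tb : M (tb + T) h0 = M tb h0.
  exact: (melnikov_period H g t l q T T2 h0 s nu m hT' (impulse_t_periodic himp)
  (impulse_l_periodic himp) H_partial_continuous g_continuous g_periodic T_gt0 hm
  q_continuous q_periodic tb).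
have M0 tb : M tb h0 != 0.
  apply/eqP => Mtb; have [k hk] := reduce_mod T tb T_gt0.
  apply: none; exists (tb + k%:~R * T); split => //.
  by rewrite (periodic_int _ (fun tb => M tb h0) T Mper).
have [B B0 qB] := orbit_bound.
have B10 : 0 <= B + 1 by rewrite addr_ge0.
have qB1 u : `|q u h0| <= B + 1 by apply: le_trans (qB u) _; rewrite lerDl.
have Tp0 := family_period_gt0 hfam Vh0.
(* No chain that starts within [r] of the point of phase [th] closes up. The phase [th] at time
   [tau 0] corresponds to the argument [tau 0 - th] of [M]. *)
pose bad r th := forall e U Y, 0 < `|e| <= r ->
    truncated_chain (B + 1) e U Y -> system_chain e U Y ->
    `|Y 0%N - q th h0| <= r -> Y N <> Y 0%N.
(* Half of the radius obtained at [th] absorbs the displacement from [q th h0] to [q th' h0]. *)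
have loc th : `[0, Tper h0]%classic th ->
    \forall th' \near th & r \near (0 : R)^'+, bad r th'.
  move=> _; have [r r_gt0 hr] := no_closed_chain (B + 1) (tau 0%N - th) B10 qB1 (M0 _).
  have r2 : 0 < r / 2 by rewrite divr_gt0.
  near=> th' r' => /= e U Y /andP[e0 er] tch ch Yr.
  have rr' : r' <= r / 2 by near: r'; exact: nbhs_right_le.
  apply: (hr e U Y) => //; first by rewrite e0/=; lra.
  rewrite subKr -(subrK (q th' h0) (Y 0%N)) -addrA.
  apply: le_trans (ler_normD _ _) _.
  have h : `|q th h0 - q th' h0| <= r / 2.
    near: th'; have /cvgrPdist_le := q_continuous th.
    by apply.
  by rewrite [`|q th' h0 - _|]distrC; lra.
have := (compact_near_coveringP _).1 (@segment_compact R 0 (Tper h0)) R (0 : R)^'+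
  bad _ loc.
move=> unif.
have [r r_gt0 hr] : exists2 r : R, 0 < r & forall th, 0 <= th <= Tper h0 -> bad r th.
  near (0 : R)^'+ => r; exists r; first by near: r; exact: nbhs_right_gt.
  move=> th thI; have thI' : `[0, Tper h0]%classic th by rewrite /= in_itv.
  by move: th thI' {thI}; near: r; exact: unif.
pose rho := Num.min 1 (r / 2).
have rho0 : 0 < rho by rewrite lt_min ltr01 divr_gt0.
have rho1 : rho <= 1 by rewrite /rho ge_min lexx.
have rhor : rho <= r / 2 by rewrite /rho ge_min lexx orbT.
have dist : \forall e \near (0 : R)^', (sup_dist (L h0) (x e) < rho%:E)%E.
  apply: (xdist [set y | (y < rho%:E)%E]); apply: open_nbhs_nbhs.
  by split; [exact: open_ereal_lt_ereal|rewrite /= lte_fin].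
near (0 : R)^' => e.
have [isol iper] : periodic_solution f g t l (m%:R * T) e (x e) by near: e.
have e0 : 0 < `|e| by rewrite normr_gt0; near: e; exact: nbhs_dnbhs_neq.
have er : `|e| <= r by apply: ltW; near: e; exact: dnbhs0_lt.
have xL : forall u, exists2 a, L h0 a & `|x e u - a| < rho.
  by apply: sup_dist_lt; near: e.
have xq u : exists v, `|x e u - q v h0| < rho.
  have [a] := xL u; rewrite (family_param hfam Vh0) => -[v _ <-] h.
  by exists v.
have [U [Y [ch Ylim Ux]]] := chain_of_solution f g t l e (x e) N (impulse_incr himp) isol.
(* These are the right limits at [t N = t 0 + P] and at [t 0]. *)
have YN : Y N = Y 0%N.
  have [_ h] := iper (t 0).
  rewrite -/P -tauN in h.
  by rewrite -(cvg_lim _ (Ylim N))// -(cvg_lim _ (Ylim 0%N)).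
have xB u : `|x e u| <= B + 1.
  have [v hv] := xq u; rewrite -(subrK (q v h0) (x e u)) addrC.
  apply: le_trans (ler_normD _ _) _; apply: lerD; first exact: qB.
  exact: le_trans (ltW hv) _.
have tch : truncated_chain (B + 1) e U Y.
  apply: (impulsive_chain_ext _ _ _ _ _ _ _ _ (B + 1) tau_lt _ _ _ ch).
  - by move=> u z zB; rewrite clampV_id.
  - by move=> i z zB; rewrite clampV_id.
  - by move=> i u iN uI; rewrite Ux.
(* [Y 0] is a right limit of values within [rho <= r / 2] of the orbit; stopping short of the limit
   costs the other half. *)
have [v Yv] : exists v, `|Y 0%N - q v h0| <= r.
  have r2 : 0 < r / 2 by rewrite divr_gt0.
  near (t 0)^'+ => u; have [v hv] := xq u; exists v.
  rewrite -(subrK (x e u) (Y 0%N)) -addrA; apply: le_trans (ler_normD _ _) _.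
  have h : `|Y 0%N - x e u| <= r / 2.
    by near: u; have /cvgrPdist_le/(_ _ r2) := Ylim 0%N.
  by lra.
have [k hk] := reduce_mod (Tper h0) v Tp0.
apply: (hr _ hk e U Y) => //; first by rewrite e0.
by rewrite (periodic_int _ (fun u => q u h0) _ (fun s => family_periodic hfam s Vh0)).
Unshelve. all: by end_near. Qed.


(** * From closed chains to periodic solutions *)

Lemma solution_right_limit (e : R) (x : R -> 'cV[R]_2) :
  impulsive_solution f g t l e x ->
  (forall (k : int) u, t (k - 1) < u < t k -> lim (x v @[v --> u^'+]) = x u) /\
  (forall k : int, lim (x v @[v --> (t k)^'+]) = x (t k) + e *: l k (x (t k)) e).
Proof.
move=> [dx jx]; split.
- move=> k u uk; apply: cvg_lim => //; apply: cvg_at_right_filter.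
  apply: differentiable_continuous; apply/derivable1_diffP.
  by have := dx k u uk.
- move=> k; have [xm [xp [_ h2 -> h4]]] := jx k.
  by rewrite (cvg_lim _ h2)// -h4 addrC subrK.
Qed.

Lemma period_shift_int (k j : int) : t (k + j * N%:Z) = t k + j%:~R * P /\
  l (k + j * N%:Z) = l k.
Proof.
have nat_case (n : nat) k' : t (k' + n%:Z * N%:Z) = t k' + n%:R * P /\ l (k' + n%:Z *
  N%:Z) = l k'.
  elim: n => [|n [ih1 ih2]]; first by rewrite !mul0r !addr0.
  have E : k' + n.+1%:Z * N%:Z = (k' + n%:Z * N%:Z) + N%:Z
    by rewrite -addn1 PoszD mulrDl mul1r addrA.
  rewrite E; have [-> ->] := period_shift (k' + n%:Z * N%:Z).
  by rewrite ih1 ih2 -natr1 mulrDl mul1r addrA.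
case: j => n; first exact: nat_case.
rewrite NegzE; have [] := nat_case n.+1 (k + - n.+1%:Z * N%:Z).
rewrite mulNr subrK => -> ->; split => //.
by rewrite mulrNz mulNr -pmulrn addrK.
Qed.

Lemma N_gt0 : (0 < N)%N.
Proof. by rewrite !muln_gt0 hm hs (impulse_nu_gt0 himp). Qed.

Lemma g_period_int (j : int) u x e : g (u + j%:~R * P) x e = g u x e.
Proof.
apply: (periodic_int _ (fun u => g u x e)) => v.
rewrite /P -[m%:R]/(m%:Z%:~R); apply: (periodic_int _ (fun u => g u x e)) => w.
exact: g_periodic.
Qed.

(** An index [a] is written as [ix a + qn a * N]; on [(t a, t (a + 1)]] the solution is piece [ix a]
    delayed by [qn a] periods. Intervals closed on the right make it left-continuous at the
    impulses. *)
Lemma periodic_extension (e : R) (U : nat -> R -> 'cV[R]_2) (Y : nat -> 'cV[R]_2) :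
  system_chain e U Y -> Y N = Y 0%N ->
  exists x : R -> 'cV[R]_2, periodic_solution f g t l P e x /\
    forall u, exists i (n : int), [/\ (i < N)%N,
      tau i < u - n%:~R * P <= tau i.+1 & x u = U i (u - n%:~R * P)].
Proof.
move=> ch YN.
have N0 : N%:Z != 0 by rewrite eqz_nat -lt0n N_gt0.
have Npos : 0 < N%:Z by rewrite ltz_nat N_gt0.
pose ix (a : int) : nat := `|(a %% N%:Z)%Z|%N.
pose qn (a : int) : int := (a %/ N%:Z)%Z.
have ixE a : (ix a)%:Z = (a %% N%:Z)%Z by rewrite /ix gez0_abs// modz_ge0.
have aE a : a = (ix a)%:Z + qn a * N%:Z by rewrite ixE addrC -divz_eq.
have ixN a : (ix a < N)%N by rewrite -ltz_nat ixE ltz_pmod.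
have tE a : t a = tau (ix a) + (qn a)%:~R * P.
  by rewrite {1}(aE a); have [-> _] := period_shift_int (ix a)%:Z (qn a).
have tE1 a : t (a + 1) = tau (ix a).+1 + (qn a)%:~R * P.
  have -> : a + 1 = (ix a).+1%:Z + qn a * N%:Z by rewrite {1}(aE a) -addn1 PoszD; ring.
  by have [-> _] := period_shift_int (ix a).+1%:Z (qn a).
have lE1 a : l (a + 1) = l (ix a).+1%:Z.
  have -> : a + 1 = (ix a).+1%:Z + qn a * N%:Z by rewrite {1}(aE a) -addn1 PoszD; ring.
  by have [_ ->] := period_shift_int (ix a).+1%:Z (qn a).
(* For [ix a = N - 1] the next index is 0 instead of [N]; this is where [Y N = Y 0] enters. *)
have Yix a : Y (ix (a + 1)) = Y (ix a).+1.
  have hN := ixN a.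
  have E1 : (a + 1)%R = (ix a).+1%:Z + qn a * N%:Z by rewrite {1}(aE a) -addn1 PoszD;
    ring.
  move: hN; rewrite leq_eqVlt => /predU1P[hN|hN].
    rewrite hN YN; congr (Y _); apply/eqP; rewrite -eqz_nat ixE E1 hN.
    by rewrite -[X in (X + _)%R]mul1r -mulrDl modzMl.
  congr (Y _); apply/eqP; rewrite -eqz_nat ixE E1 addrC modzMDl modz_small//.
have shiftI a u : t a < u <= t (a + 1) ->
    tau (ix a) < u - (qn a)%:~R * P <= tau (ix a).+1.
  by rewrite tE tE1 => /andP[h1 h2]; rewrite ltrBrDr h1 lerBlDr h2.
have /choice[kk hk] : forall u, exists a : int, t a < u <= t (a + 1).
  move=> u; have [k hk] := impulse_interval t u (impulse_incr himp)
    (impulse_pinfty himp) (impulse_ninfty himp).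
  by exists (k - 1); rewrite subrK.
pose x u := U (ix (kk u)) (u - (qn (kk u))%:~R * P).
have tmono := impulse_incr himp.
have kkE a u : t a < u <= t (a + 1) -> kk u = a.
  move=> /andP[h1 h2]; have /andP[h3 h4] := hk u.
  have tle (i j : int) : i <= j -> t i <= t j.
    by rewrite le_eqVlt => /predU1P[->//|/tmono/ltW].
  apply/eqP; rewrite eq_le; apply/andP; split; rewrite leNgt; apply/negP => lt.
    have le : a + 1 <= kk u by lia.
    by have := lt_le_trans h3 (le_trans h2 (tle _ _ le)); rewrite ltxx.
  have le : kk u + 1 <= a by lia.
  by have := lt_le_trans h1 (le_trans h4 (tle _ _ le)); rewrite ltxx.
have xE a u : t a < u <= t (a + 1) -> x u = U (ix a) (u - (qn a)%:~R * P).
  by move=> h; rewrite /x (kkE a).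
have xshift u : x (u + P) = x u.
  have h := hk u; rewrite (xE (kk u) u)//; set a := kk u in h *.
  have h' : t (a + N%:Z) < u + P <= t (a + N%:Z + 1).
    rewrite addrAC; have [-> _] := period_shift a; have [-> _] := period_shift (a + 1).
    by rewrite ltrD2r lerD2r.
  rewrite (xE _ _ h'); have -> : ix (a + N%:Z) = ix a.
    by apply/eqP; rewrite -eqz_nat !ixE modzDr.
  have -> : qn (a + N%:Z) = qn a + 1 by rewrite /qn divzDr ?dvdzz// divzz N0.
  by congr (U _ _); rewrite intrD; ring.
have Wc a u : {for u, continuous (fun u => U (ix a) (u - (qn a)%:~R * P))}.
  have [cU _ _ _] := ch _ (ixN a).
  apply: (@continuous_comp_at _ _ _ (fun u => u - (qn a)%:~R * P) (U (ix a)));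
    last exact: cU.
  by apply: cvgB; [exact: cvg_id|exact: cvg_cst].
have tlt a : t a < t (a + 1) by apply: tmono; rewrite ltrDl.
have sol : impulsive_solution f g t l e x.
  split.
  - move=> k u; set a := k - 1; have -> : k = a + 1 by rewrite /a subrK.
    move=> /andP[u1 u2]; have uI : t a < u <= t (a + 1) by rewrite u1 ltW.
    have uI' : tau (ix a) < u - (qn a)%:~R * P < tau (ix a).+1.
      by move: u1 u2; rewrite tE tE1 => h1 h2; rewrite ltrBrDr h1 ltrBlDr h2.
    have [_ _ dU _] := ch _ (ixN a).
    have du : is_derive u (1 : R) (fun u => U (ix a) (u - (qn a)%:~R * P))
        (f (x u) + e *: g u (x u) e).
      rewrite (xE a u uI); apply: is_derive_cV2 => i.
      have dq := is_derive_entry _ _ _ _ _ i (dU _ uI').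
      have ds : is_derive u (1 : R) (fun u : R => u - (qn a)%:~R * P) 1.
        by apply: (is_derive_eq (is_deriveB (is_derive_id u 1)
          (is_derive_cst ((qn a)%:~R * P) u 1))); rewrite subr0.
      have := @is_derive1_comp R (fun s => U (ix a) s i 0)
        (fun u => u - (qn a)%:~R * P) u _ _ dq ds.
      by rewrite mulr1 -(g_period_int (qn a)) subrK.
    refine (near_eq_is_derive _ du); near=> v; rewrite (xE a)//.
    apply/andP; split; first by near: v; exact: lt_nbhsr.
    by apply: ltW; near: v; exact: lt_nbhsl.
  - move=> k; set a := k - 1; have kE : k = a + 1 by rewrite /a subrK.
    have kI : t a < t k <= t (a + 1) by rewrite kE tlt lexx.
    have [_ _ _ Yn] := ch _ (ixN a); have [_ Uk _ _] := ch _ (ixN k).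
    exists (x (t k)), (x (t k) + e *: l k (x (t k)) e); split => //.
    + rewrite (xE _ _ kI).
      refine (cvg_trans (near_eq_cvg _) (cvg_at_left_filter (Wc a (t k)))).
      near=> v; rewrite (xE a)//; apply/andP; split.
        by near: v; apply: nbhs_left_gt; rewrite kE.
      by rewrite -kE; apply: ltW; near: v; exact: nbhs_left_lt.
    + have -> : x (t k) + e *: l k (x (t k)) e = U (ix k) (t k - (qn k)%:~R * P).
        have Yk : Y (ix k) = Y (ix a).+1 by rewrite -Yix -kE.
        have tk : t k = tau (ix a).+1 + (qn a)%:~R * P by rewrite -tE1 -kE.
        have lk : l k = l (ix a).+1%:Z by rewrite -lE1 -kE.
        have xk : x (t k) = U (ix a) (tau (ix a).+1) by rewrite (xE _ _ kI) tk addrK.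
        by rewrite [in RHS](tE k) addrK Uk Yk Yn xk lk.
      refine (cvg_trans (near_eq_cvg _) (cvg_at_right_filter (Wc k (t k)))).
      near=> v; rewrite (xE k)//; apply/andP; split.
        by near: v; exact: nbhs_right_gt.
      by apply: ltW; near: v; apply: nbhs_right_lt.
    + by rewrite addrC addKr.
exists x; split; last first.
  by move=> u; exists (ix (kk u)), (qn (kk u)); split => //; exact: shiftI.
split=> // u.
have exk v : exists k : int, t (k - 1) < v <= t k.
  by exists (kk v + 1); rewrite addrK.
split.
  by rewrite !(impulsive_solution_left_limit f g t l e x)// xshift.
have [r1' r2'] := solution_right_limit e x sol.
have [k /andP[k1]] := exk u; rewrite le_eqVlt => /predU1P[->|k2].
  have [<- lk] := period_shift k; rewrite !r2' lk.
  by have [-> _] := period_shift k; rewrite xshift.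
rewrite (r1' (k + N%:Z) (u + P)); first by rewrite (r1' k u) ?xshift// k1.
have [-> _] := period_shift k; rewrite addrAC; have [-> _] := period_shift (k - 1).
by rewrite !ltrD2r k1.
Unshelve. all: by end_near. Qed.

(** * Existence of closed chains *)

Lemma truncated_flow (B e : R) : 0 <= B -> `|e| <= 1 ->
  exists (U : 'cV[R]_2 -> nat -> R -> 'cV[R]_2) (Y : 'cV[R]_2 -> nat -> 'cV[R]_2),
    (forall x, Y x 0%N = x /\ truncated_chain B e (U x) (Y x)) /\
    continuous (fun x => Y x N).
Proof.
move=> B0 e1.
have [Lf Lf0 hLf] := class_C_box_lipschitz _ _ B r0_gt0 hf.
have [Lg Lg0 hLg] := class_C_param_lipschitz _ _ (tau 0%N) (tau N) B r0_gt0 hg.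
have cF : continuous (fun z : R * 'cV[R]_2 =>
    f (clampV B z.2) + e *: g z.1 (clampV B z.2) e).
  move=> z; have c2 : {for z, continuous (fun z : R * 'cV[R]_2 => clampV B z.2)}.
    by apply: (@continuous_comp_at _ _ _ snd (clampV B));
      [exact: cvg_snd|exact: continuous_clampV].
  have c1 : {for z, continuous (fun z : R * 'cV[R]_2 => z.1)} by exact: cvg_fst.
  have c0 : {for z, continuous (fun=> e : R)} by exact: cvg_cst.
  have cG := continuous_comp_at _ _ _ _ (fun z : R * 'cV[R]_2 * R => g z.1.1 z.1.2 z.2)
    _ (continuous_pairing _ _ _ _ _ _ (continuous_pairing _ _ _ _ _ _ c1 c2) c0)
    (g_continuous _).
  have cs := continuous_comp_at _ _ _ _ _ _ cG (@scaler_continuous _ _ e _).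
  have cf := continuous_comp_at _ _ _ _ _ _ c2 (f_continuous _).
  exact: (cvgD cf cs).
have cJ i : continuous (fun x : 'cV[R]_2 => x + e *: l i.+1%:Z (clampV B x) e).
  move=> x; have c0 : {for x, continuous (fun=> e : R)} by exact: cst_continuous.
  have cL := continuous_comp_at _ _ _ _ (fun z : 'cV[R]_2 * R => l i.+1%:Z z.1 z.2)
    _ (continuous_pairing _ _ _ _ _ _ (@continuous_clampV _ B x) c0)
    (@impulse_continuous _ _ _ _ _ _ himp i.+1%:Z _).
  have cs := continuous_comp_at _ _ _ _ _ _ cL (@scaler_continuous _ _ e _).
  have cx : {for x, continuous (@id 'cV[R]_2)} by move=> A.
  exact: (cvgD cx cs).
have lipF u x y : tau 0%N < u < tau N ->
    `|f (clampV B x) + e *: g u (clampV B x) e - (f (clampV B y) + e *: g u (clampV B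
      y) e)|
    <= (Lf + Lg) * `|x - y|.
  move=> /andP[u1 u2]; rewrite opprD addrACA -scalerBr mulrDl.
  have bx := clampV_norm B x B0; have bY := clampV_norm B y B0.
  apply: le_trans (ler_normD _ _) _; apply: lerD.
    apply: le_trans (hLf _ _ bx bY) _; rewrite ler_wpM2l//; exact: clampV_lipschitz.
  rewrite normrZ; apply: (@le_trans _ _ (Lg * `|clampV B x - clampV B y|)).
    rewrite -[leRHS]mul1r ler_pM//; apply: hLg => //.
    by rewrite !ltW.
  by rewrite ler_wpM2l//; exact: clampV_lipschitz.
have [U [Y [h1 h2]]] := impulsive_flow
  (fun u x => f (clampV B x) + e *: g u (clampV B x) e)
  (fun i x => x + e *: l i.+1%:Z (clampV B x) e) tau N (Lf + Lg) (addr_ge0 Lf0 Lg0)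
  tau_lt cF lipF cJ.
by exists U, Y; split; [exact: h1|exact: h2].
Qed.

Lemma energy_interval : exists2 eta : R, 0 < eta &
  forall h, h0 - eta <= h <= h0 + eta -> V h.
Proof.
have : nbhs h0 V by exact: open_nbhs_nbhs.
move=> /nbhs_ballP[r /= r_gt0 hr]; exists (r / 2); first by rewrite divr_gt0.
move=> h /andP[h1 h2]; apply: hr; rewrite -ball_normE/= ltr_norml.
by apply/andP; split; lra.
Qed.

Lemma clamped_family_continuous (c d : R) : c <= d ->
  (forall h, c <= h <= d -> V h) ->
  continuous (fun z : R * R => q z.1 (clamp c d z.2)).
Proof.
move=> cd cdV z.
apply: (@continuous_comp_at _ _ _ (fun z : R * R => (z.1, clamp c d z.2))
  (fun z : R * R => q z.1 z.2)); last first.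
  apply: (family_continuous _ _ _ _ _ _ _ r0_gt0 hfam Vopen f_continuous).
  by apply: cdV; exact: clamp_itv.
apply: continuous_pairing; first exact: cvg_fst.
apply: (@continuous_comp_at _ _ _ snd (clamp c d)); first exact: cvg_snd.
exact: continuous_clamp.
Qed.

Lemma orbit_tube (c d tb0 kappa : R) : c <= h0 <= d ->
  (forall h, c <= h <= d -> V h) -> 0 < kappa ->
  exists2 r : R, 0 < r & forall u tb h, tau 0%N <= u <= tau N ->
    `|tb - tb0| <= r -> `|h - h0| <= r -> c <= h <= d ->
    `|q (u - tb) h - q (u - tb0) h0| <= kappa.
Proof.
move=> ch0 cdV k0; have cd : c <= d by case/andP: ch0; exact: le_trans.
have cq := clamped_family_continuous c d cd cdV.
pose F (z : R * (R * R)) := q (z.1 - z.2.1) (clamp c d z.2.2).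
have cF (z : R * (R * R)) : {for z, continuous F}.
  apply: (@continuous_comp_at _ _ _ (fun z : R * (R * R) => (z.1 - z.2.1, z.2.2))
    (fun z : R * R => q z.1 (clamp c d z.2))); last exact: cq.
  have c21 : {for z, continuous (fun z : R * (R * R) => z.2.1)}.
    by apply: (@continuous_comp_at _ _ _ snd fst); [exact: cvg_snd|exact: cvg_fst].
  apply: continuous_pairing.
    by apply: cvgB; [exact: cvg_fst|exact: c21].
  by apply: (@continuous_comp_at _ _ _ snd snd); [exact: cvg_snd|exact: cvg_snd].
have cg0 (u : R) : {for u, continuous (fun=> (tb0, h0) : R * R)} by exact: cvg_cst.
have [r r_gt0 hr] := @compact_tube R R^o (R * R)%type _ `[tau 0%N, tau N] F
  (fun=> (tb0, h0)) (@segment_compact _ _ _) (fun u _ => cg0 u) (fun u _ => cF _)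
    kappa k0.
exists r => // u tb h uI tbr hr0 hcd.
have := hr u (tb, h); rewrite /F/= !clamp_id//; apply; first by rewrite in_itv.
by rewrite prod_normE ge_max; apply/andP.
Qed.

(** The time left over in one period [m T] after [K] turns on the orbit of energy [h]; it is 0 at
    [h0] by resonance. *)
Let drift h := P - K%:R * Tper h.

(** By resonance, [K * Tper h] is [P * Omega h0 / Omega h]. The positive factor [P / Omega h]
    transfers the sign of [Omega h - Omega h0] to the drift. *)
Lemma drift_Omega h : V h -> drift h = P / Omega Tper h * (Omega Tper h - Omega Tper h0).
Proof.
move=> Vh; rewrite /drift resonance /Omega.
have T0 := family_period_gt0 hfam Vh0; have Th := family_period_gt0 hfam Vh.
move: (pi : R) (@pi_gt0 R) => c c0; field.
by rewrite !gt_eqF.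
Qed.

Lemma drift_sign : derive1 (Omega Tper) h0 != 0 ->
  exists2 d0 : R, 0 < d0 & forall d, 0 < d <= d0 -> V (h0 + d) -> V (h0 - d) ->
    0 < derive1 (Omega Tper) h0 * drift (h0 + d) /\
    derive1 (Omega Tper) h0 * drift (h0 - d) < 0.
Proof.
move=> D0; have [d0 d00 hd0] := derive1_neq0_sign _ _ D0.
exists d0 => // d dI V1 V2; have [s1 s2] := hd0 d dI.
have pos h : V h -> 0 < P / Omega Tper h.
  by move=> Vh; rewrite divr_gt0 ?period_gt0// (Omega_gt0 _ _ _ _ _ _ _ hfam).
split; rewrite drift_Omega// mulrCA; first by rewrite pmulr_rgt0// pos.
by rewrite pmulr_rlt0// pos.
Qed.

Lemma drift_small (w : R) : 0 < w -> exists2 r : R, 0 < r &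
  forall h, `|h - h0| <= r -> V h -> `|drift h| <= w.
Proof.
move=> w0.
have cO := continuous_Omega _ _ _ _ _ _ _ r0_gt0 hfam Vopen f_continuous h0 Vh0.
have O0 : Omega Tper h0 != 0 by rewrite gt_eqF// (Omega_gt0 _ _ _ _ _ _ _ hfam).
have c : {for h0, continuous (fun h => P / Omega Tper h * (Omega Tper h - Omega Tper
  h0))}.
  apply: cvgM; last by apply: cvgB; [exact: cO|exact: cvg_cst].
  by apply: cvgM; [exact: cvg_cst|apply: cvgV => //; exact: cO].
have /cvgrPdist_le/(_ _ w0)/nbhs_ballP[r /= r_gt0 hr] := c.
exists (r / 2); first by rewrite divr_gt0.
move=> h hh Vh; have := hr h; rewrite -ball_normE/= subrr mulr0 sub0r normrN
  drift_Omega//.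
by apply; rewrite distrC; apply: le_lt_trans hh _; rewrite ltr_pdivrMr// ltr_pMr// ltr1n.
Qed.

(** The [K] full turns drop out, and the rest is the mean value theorem for the linear form
    [(a, - b)] along the orbit over the time [drift h], which may have either sign. *)
Lemma tangential_drift (a b u h : R) : V h -> exists2 v, `|v - u| <= `|drift h| &
  a * (q (u + P) h 0 0 - q u h 0 0) - b * (q (u + P) h 1 0 - q u h 1 0) =
  drift h * (a * f (q v h) 0 0 - b * f (q v h) 1 0).
Proof.
move=> Vh.
have -> : q (u + P) h = q (u + drift h) h.
  have -> : u + P = u + drift h + K%:Z%:~R * Tper h
    by rewrite /drift -[K%:Z%:~R]/(K%:R); ring.
  exact: (periodic_int _ (fun u => q u h) _ (fun s => family_periodic hfam s Vh)).
pose w v := a * q v h 0 0 - b * q v h 1 0.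
have dw v : is_derive v (1 : R) w (a * f (q v h) 0 0 - b * f (q v h) 1 0).
  have d0 := is_derive_entry _ _ _ _ _ 0 (family_solution hfam v Vh).
  have d1 := is_derive_entry _ _ _ _ _ 1 (family_solution hfam v Vh).
  apply: (is_derive_eq (is_deriveB (is_deriveM (is_derive_cst a v (1 : R)) d0)
    (is_deriveM (is_derive_cst b v (1 : R)) d1))).
  by rewrite !scaler0 !addr0.
have cw : continuous w.
  by move=> v; apply: differentiable_continuous; apply/derivable1_diffP; have := dw v.
have -> : a * (q (u + drift h) h 0 0 - q u h 0 0) - b * (q (u + drift h) h 1 0 - q u
  h 1 0) =
  w (u + drift h) - w u by rewrite /w; ring.
have [d0|d0] := leP 0 (drift h).
  have le1 : u <= u + drift h by rewrite lerDl.
  have [v vI ->] := MVT_segment le1 (fun v _ => dw v) (continuous_subspaceT cw).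
  exists v; last by rewrite addrAC subrr add0r mulrC.
  by move: vI; rewrite in_itv/= => /andP[v1 v2]; rewrite !ger0_norm//; lra.
have le1 : u + drift h <= u by rewrite gerDl ltW.
have [v vI E] := MVT_segment le1 (fun v _ => dw v) (continuous_subspaceT cw).
exists v; last by rewrite -[LHS]opprB E; ring.
move: vI; rewrite in_itv/= => /andP[v1 v2]; rewrite (ltr0_norm d0) ler_norml.
by apply/andP; split; lra.
Qed.

(* The unknowns are the phase [tb] and the energy [h] of the initial point on
   the unperturbed family: the energy gained over a period changes sign with
   [tb] (through [M]), the tangential displacement with [h] (through [drift]). *)
Lemma closed_chain_near_orbit (t0 rho : R) : M t0 h0 = 0 ->
  derive1 (Omega Tper) h0 != 0 -> derive1 (fun tb => M tb h0) t0 != 0 -> 0 < rho ->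
  exists2 e1 : R, 0 < e1 & forall e, 0 < `|e| <= e1 -> exists U Y,
    [/\ system_chain e U Y, Y N = Y 0%N
      & forall i u, (i < N)%N -> tau i <= u <= tau i.+1 ->
          `|U i u - q (u - t0) h0| <= rho].
Proof.
move=> Mt0 DO0 DM0 rho0.
set DO := derive1 (Omega Tper) h0 in DO0.
set DM := derive1 (fun tb => M tb h0) t0 in DM0.
(* The start of the reference orbit. [S] is the squared norm of the gradient there, positive because
   [f] is the rotated gradient and does not vanish on the orbit. *)
pose z0 := q (tau 0%N - t0) h0.
pose n0 := partial H 0 z0; pose n1 := partial H 1 z0.
pose S := n0 ^+ 2 + n1 ^+ 2.
have S0 : 0 < S.
  rewrite lt_neqAle addr_ge0 ?sqr_ge0// andbT eq_sym; apply/eqP => /eqP.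
  rewrite paddr_eq0 ?sqr_ge0// !sqrf_eq0 => /andP[/eqP e0 /eqP e1].
  have := family_nonsingular _ _ _ _ _ _ _ hfam _ (tau 0%N - t0) Vh0.
  apply/negP; rewrite negbK; apply/eqP; rewrite hfH.
  by apply: cV2_eq; rewrite !mxE/= -?/n0 -?/n1 ?e0 ?e1 ?oppr0.
have [rr rr0 inj] := energy_tangent_injective H z0 H_derivable H_partial_continuous S0.
rewrite -/n0 -/n1 in inj.
(* The scalar product with [f z0 = (n1, - n0)]. *)
pose tang (x : 'cV[R]_2) := n1 * x 0 0 - n0 * x 1 0.
pose Ct := `|n1| + `|n0|.
have Ct0 : 0 <= Ct by rewrite addr_ge0.
have tangB x y : `|tang x - tang y| <= Ct * `|x - y|.
  rewrite (_ : _ - _ = n1 * (x - y) 0 0 - n0 * (x - y) 1 0); last first.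
    by rewrite /tang !mxE; ring.
  apply: le_trans (ler_normB _ _) _; rewrite !normrM mulrDl.
  by apply: lerD; rewrite ler_wpM2l// mx_entry_norm.
have [eta0 eta00 Veta] := energy_interval.
pose c := h0 - eta0; pose d := h0 + eta0.
have cdV h : c <= h <= d -> V h by exact: Veta.
have [/ltW cd ch0 _ _] := radius_ends h0 eta0 eta00; rewrite -/c -/d in cd ch0.
have [B0 B00 hB0] := family_bounded _ _ _ _ _ _ _ r0_gt0 hfam Vopen f_continuous c d cdV.
pose B := B0 + 1; have Bge0 : 0 <= B by rewrite addr_ge0.
have cqc := clamped_family_continuous c d cd cdV.
have rho2 : 0 < rho / 2 by rewrite divr_gt0.
have rr2 : 0 < rr / 2 by rewrite divr_gt0.
have minA0 : 0 < Num.min (rho / 2) (rr / 2) by rewrite lt_min rho2.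
have [dA dA0 tubeA] := orbit_tube c d t0 _ ch0 cdV minA0.
(* At [z0] the velocity has tangential component [S], so nearby it keeps at least [S / 2]; this is
   the positive factor that multiplies the drift. *)
have [w w0 hw] : exists2 w : R, 0 < w & forall v h, `|v - (tau 0%N - t0)| <= w ->
    `|h - h0| <= w -> c <= h <= d -> S / 2 <= n1 * f (q v h) 0 0 - n0 * f (q v h) 1 0.
  have S2 : 0 < S / 2 by rewrite divr_gt0.
  pose F (z : R * R) := tang (f (q z.1 (clamp c d z.2))).
  have cF : {for (tau 0%N - t0, h0), continuous F}.
    have cf1 := continuous_comp_at _ _ _ _ _ _ (cqc (tau 0%N - t0, h0)) (f_continuous _).
    have cfi i := (continuous_cV2P _ _ _).1 cf1 i.
    by apply: cvgB; (apply: cvgM; [exact: cvg_cst|exact: cfi]).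
  have FS : F (tau 0%N - t0, h0) = S.
    by rewrite /F /= clamp_id// /tang hfH !mxE/= -/z0 -/n0 -/n1 /S; ring.
  have /cvgrPdist_le/(_ _ S2)/nbhs_ballP[r /= r_gt0 hr] := cF.
  exists (r / 2); first by rewrite divr_gt0.
  move=> v h vr hr0 hcd.
  have lt : r / 2 < r by rewrite ltr_pdivrMr// ltr_pMr// ltr1n.
  have : `|F (tau 0%N - t0, h0) - F (v, h)| <= S / 2.
    apply: hr; split; rewrite -ball_normE/= distrC; exact: le_lt_trans lt.
  by rewrite FS /F/= clamp_id//; exact: half_le_of_dist.
have w2 : 0 < w / 2 by rewrite divr_gt0.
have [w' w'0 hdrift] := drift_small _ w2.
have [dO dO0 signO] := drift_sign DO0; rewrite -/DO in signO.
have [dM dM0' signM] := derive1_neq0_sign _ _ DM0; rewrite -/DM Mt0 in signM.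
(* [dA] keeps the orbits near the reference one, [dM] provides the signs of [M], and [w / 2] leaves
   the other half of [w] to the drift. *)
pose delta := Num.min (Num.min dA dM) (w / 2).
have delta0 : 0 < delta by rewrite !lt_min dA0 dM0'.
have [deltaA deltaM deltaW] : [/\ delta <= dA, delta <= dM & delta <= w / 2].
  by split; rewrite /delta !ge_min lexx ?orbT.
have [Mp Mm] : 0 < DM * M (t0 + delta) h0 /\ DM * M (t0 - delta) h0 < 0.
  by have := signM delta; rewrite delta0 deltaM !subr0; apply.
have Mp0 : 0 < `|M (t0 + delta) h0|.
  by rewrite normr_gt0; apply/eqP => E; move: Mp; rewrite E mulr0 ltxx.
have Mm0 : 0 < `|M (t0 - delta) h0|.
  by rewrite normr_gt0; apply/eqP => E; move: Mm; rewrite E mulr0 ltxx.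
have Mp2 : 0 < `|M (t0 + delta) h0| / 2 by rewrite divr_gt0.
have Mm2 : 0 < `|M (t0 - delta) h0| / 2 by rewrite divr_gt0.
have [dp dp0 enp] := chain_energy (t0 + delta) _ Mp2.
have [dm dm0 enm] := chain_energy (t0 - delta) _ Mm2.
have dp2 : 0 < dp / 2 by rewrite divr_gt0.
have dm2 : 0 < dm / 2 by rewrite divr_gt0.
have [ep ep0 tubep] := orbit_tube c d (t0 + delta) _ ch0 cdV dp2.
have [em em0 tubem] := orbit_tube c d (t0 - delta) _ ch0 cdV dm2.
(* [ep] and [em] depend on [delta]: on the sides [tb = t0 + delta] and [tb = t0 - delta], the orbits
   of energy [h] must stay near the one of energy [h0], the only energy at which [M] is
   evaluated. *)
pose eta := Num.min (Num.min (Num.min dA eta0) (Num.min w w')) (Num.min dO (Num.min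
  ep em)).
have eta_gt0 : 0 < eta by rewrite !lt_min dA0 eta00 w0 w'0 dO0 ep0 em0.
have [etaA eta_eta0 etaw etaw'] : [/\ eta <= dA, eta <= eta0, eta <= w & eta <= w'].
  by split; rewrite /eta !ge_min lexx ?orbT.
have [etaO etap etam] : [/\ eta <= dO, eta <= ep & eta <= em].
  by split; rewrite /eta !ge_min lexx ?orbT.
have hcd h : h0 - eta <= h <= h0 + eta -> c <= h <= d.
  exact: radius_le.
have hn h : h0 - eta <= h <= h0 + eta -> `|h - h0| <= eta.
  by rewrite ler_distl.
have tn tb : t0 - delta <= tb <= t0 + delta -> `|tb - t0| <= delta.
  by rewrite ler_distl.
have [lt2 _ edgem edgep] := radius_ends h0 eta eta_gt0.
have Vp := cdV _ (hcd _ edgep); have Vm := cdV _ (hcd _ edgem).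
have [Op Om] : 0 < DO * drift (h0 + eta) /\ DO * drift (h0 - eta) < 0.
  by apply: signO => //; rewrite eta_gt0.
(* A lower bound for the unperturbed tangential displacement on the sides [h = h0 + eta] and
   [h = h0 - eta]; the perturbation may use up half of it. *)
pose b := Num.min `|drift (h0 + eta)| `|drift (h0 - eta)| * (S / 2).
have b0 : 0 < b.
  rewrite mulr_gt0 ?divr_gt0// lt_min !normr_gt0; apply/andP; split; apply/eqP => E.
    by move: Op; rewrite E mulr0 ltxx.
  by move: Om; rewrite E mulr0 ltxx.
pose dd := Num.min (Num.min (Num.min 1 (rho / 2)) (rr / 2))
   (Num.min (Num.min (dp / 2) (dm / 2)) (b / 2 / (Ct + 1))).
have Ct1 : 0 < Ct + 1 by rewrite ltr_wpDl.
have dd0 : 0 < dd by rewrite !lt_min ltr01 rho2 rr2 dp2 dm2 !divr_gt0.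
have [dd1 ddrho ddrr] : [/\ dd <= 1, dd <= rho / 2 & dd <= rr / 2].
  by split; rewrite /dd !ge_min lexx ?orbT.
have [ddp ddm ddb] : [/\ dd <= dp / 2, dd <= dm / 2 & dd <= b / 2 / (Ct + 1)].
  by split; rewrite /dd !ge_min lexx ?orbT.
have [d' d'0 close] := truncated_chain_closeness B Bge0 dd dd0.
pose e1 := Num.min (Num.min 1 d') (Num.min dp dm).
exists e1; first by rewrite !lt_min ltr01 d'0 dp0.
move=> e /andP[e_gt0 ee1].
have [e_1 ed' edp edm] : [/\ `|e| <= 1, `|e| <= d', `|e| <= dp & `|e| <= dm].
  by split; apply: le_trans ee1 _; rewrite /e1 !ge_min lexx ?orbT.
have [U [Y [flowP cY]]] := truncated_flow B e Bge0 e_1.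
pose x0 (z : R * R) := q (tau 0%N - z.1) (clamp c d z.2).
have cx0 : continuous x0.
  move=> z; apply: (@continuous_comp_at _ _ _ (fun z : R * R => (tau 0%N - z.1, z.2))
    (fun z : R * R => q z.1 (clamp c d z.2))); last exact: cqc.
  apply: continuous_pairing; last exact: cvg_snd.
  by apply: cvgB; [exact: cvg_cst|exact: cvg_fst].
pose X z := Y (x0 z) N.
have cX : continuous X by move=> z; exact: continuous_comp_at _ _ _ _ _ _ (cx0 z) (cY _).
(* The truncated chain stays within [dd <= 1] of an orbit bounded by [B0], hence in the box of
   radius [B = B0 + 1], where it solves the true system. *)
have rect (tb h : R) : t0 - delta <= tb <= t0 + delta -> h0 - eta <= h <= h0 + eta ->
  [/\ system_chain e (U (x0 (tb, h))) (Y (x0 (tb, h))),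
      Y (x0 (tb, h)) 0%N = q (tau 0%N - tb) h,
      forall i u, (i < N)%N -> tau i <= u <= tau i.+1 ->
         `|U (x0 (tb, h)) i u - q (u - tb) h| <= dd
    & `|X (tb, h) - q (tau 0%N - tb + P) h| <= dd].
  move=> tbI hI; have hcd' := hcd h hI; have Vh := cdV h hcd'.
  have [Y0 tch] := flowP (x0 (tb, h)).
  have x0E : x0 (tb, h) = q (tau 0%N - tb) h by rewrite /x0/= clamp_id.
  have init : `|Y (x0 (tb, h)) 0%N - q (tau 0%N - tb) h| <= d'.
    by rewrite Y0 x0E subrr normr0 ltW.
  have qB u : `|q (u - tb) h| <= B by apply: le_trans (hB0 h _ hcd') _; rewrite lerDl.
  have [c1 c2] := close e _ _ _ ed' (orbit_solution h tb Vh) qB tch init.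
  split => //; last 2 first.
  - by rewrite Y0.
  - by have := c2 N (leqnn N); rewrite /tau tauN /X addrAC.
  apply: (impulsive_chain_ext _ _ _ _ _ _ _ _ B tau_lt _ _ _ tch).
  - by move=> u y yB; rewrite clampV_id.
  - by move=> i y yB; rewrite clampV_id.
  - move=> i u iN /andP[u1 u2]; have uI : tau i <= u <= tau i.+1 by rewrite u2 ltW.
    rewrite -(subrK (q (u - tb) h) (U _ i u)) addrC; apply: le_trans (ler_normD _ _) _.
    by apply: lerD; [exact: hB0|exact: le_trans (c1 i u iN uI) dd1].
have tau_le := steps_le tau tau_lt.
have inN i u : (i < N)%N -> tau i <= u <= tau i.+1 -> tau 0%N <= u <= tau N.
  move=> iN /andP[u1 u2]; rewrite (le_trans _ u1) ?tau_le//=.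
  by rewrite (le_trans u2)// tau_le.
(* The distance from the chain to the orbit of energy [h0] is split at the orbit of energy [h] with
   the same phase, half of [dn] for each part. *)
have energy_edge tb h dn : t0 - delta <= tb <= t0 + delta -> h0 - eta <= h <= h0 + eta ->
    dd <= dn / 2 ->
    (forall u, tau 0%N <= u <= tau N -> `|q (u - tb) h - q (u - tb) h0| <= dn / 2) ->
    (forall U Y, system_chain e U Y ->
      (forall i u, (i < N)%N -> tau i <= u <= tau i.+1 -> `|U i u - q (u - tb) h0| <=
        dn) ->
      `|H (Y N) - H (Y 0%N) - e * M tb h0| <= `|M tb h0| / 2 * `|e|) ->
    `|H (X (tb, h)) - H (x0 (tb, h)) - e * M tb h0| <= `|M tb h0| / 2 * `|e|.
  move=> tbI hI ddn tubeh en; have [ch Y0 cl _] := rect tb h tbI hI.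
  have := en _ _ ch; rewrite (flowP (x0 (tb, h))).1 => h'; apply: h'.
  move=> i u iN uI; apply: norm_sub_half (tubeh u (inN i u iN uI)).
  exact: le_trans (cl i u iN uI) ddn.
have en0 : e != 0 by rewrite -normr_gt0.
have shift_sign tb h : t0 - delta <= tb <= t0 + delta -> h0 - eta <= h <= h0 + eta ->
    b <= `|drift h| * (S / 2) ->
    (0 < DO * drift h -> 0 < DO * (tang (X (tb, h)) - tang (x0 (tb, h)))) /\
    (DO * drift h < 0 -> DO * (tang (X (tb, h)) - tang (x0 (tb, h))) < 0).
  move=> tbI hI bh; have hcd' := hcd h hI; have Vh := cdV h hcd'.
  have [_ _ _ hX] := rect tb h tbI hI.
  have x0E : x0 (tb, h) = q (tau 0%N - tb) h by rewrite /x0/= clamp_id.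
  have [v vu E] := tangential_drift n1 n0 (tau 0%N - tb) h Vh.
  have dr : `|drift h| <= w / 2.
    by apply: hdrift => //; apply: le_trans (hn h hI) _.
  have hv : S / 2 <= n1 * f (q v h) 0 0 - n0 * f (q v h) 1 0.
    apply: hw => //; last by apply: le_trans (hn h hI) _.
    apply: norm_sub_half (le_trans vu dr) _.
    rewrite (_ : _ - _ = t0 - tb); last by ring.
    by rewrite distrC; exact: le_trans (tn tb tbI) deltaW.
  set k := n1 * _ - _ in hv E.
  have E' : tang (q (tau 0%N - tb + P) h) - tang (q (tau 0%N - tb) h) = drift h * k.
    by rewrite -E /tang; ring.
  have hT1' : `|tang (X (tb, h)) - tang (q (tau 0%N - tb + P) h)| <= b / 2.
    apply: le_trans (tangB _ _) _; apply: (@le_trans _ _ ((Ct + 1) * dd)).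
      by rewrite ler_pM// lerDl.
    by rewrite mulrC -ler_pdivlMr.
  rewrite x0E; apply: perturbed_shift_sign b0 hT1' E' _ _.
    by apply: lt_le_trans hv; rewrite divr_gt0.
  by apply: le_trans bh _; rewrite ler_wpM2l.
(* The factors [DM], [DO] and [e] orient both functions from negative to positive, whatever the
   signs of the derivatives and of [e]; they are nonzero, so the zeros are those of the two
   defects. *)
pose f1 z := DM * (e * (H (X z) - H (x0 z))).
pose f2 z := DO * (tang (X z) - tang (x0 z)).
have cf1 : continuous f1.
  move=> z; apply: cvgM; first exact: cvg_cst; apply: cvgM; first exact: cvg_cst.
  apply: cvgB; first exact: continuous_comp_at _ _ _ _ _ _ (cX z) (H_continuous _).
  exact: continuous_comp_at _ _ _ _ _ _ (cx0 z) (H_continuous _).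
have ctang : continuous tang.
  apply: (@lipschitz_continuous _ _ _ _ Ct) => x y; exact: tangB.
have cf2 : continuous f2.
  move=> z; apply: cvgM; first exact: cvg_cst.
  apply: cvgB; first exact: continuous_comp_at _ _ _ _ _ _ (cX z) (ctang _).
  exact: continuous_comp_at _ _ _ _ _ _ (cx0 z) (ctang _).
have [lt1 _ tedgem tedgep] := radius_ends t0 delta delta0.
have s1 h : h0 - eta <= h <= h0 + eta -> f1 (t0 - delta, h) < 0 /\ 0 < f1 (t0 + delta, h).
  move=> hI; split.
  - apply: (first_order_sign DM e (M (t0 - delta) h0) _ en0 _).2 => //.
    apply: (energy_edge _ _ dm) => //; last by move=> U' Y' ch; exact: enm.
    move=> u uI; apply: tubem => //; first by rewrite subrr normr0 ltW.
      exact: le_trans (hn h hI) _.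
    exact: hcd.
  - apply: (first_order_sign DM e (M (t0 + delta) h0) _ en0 _).1 => //.
    apply: (energy_edge _ _ dp) => //; last by move=> U' Y' ch; exact: enp.
    move=> u uI; apply: tubep => //; first by rewrite subrr normr0 ltW.
      exact: le_trans (hn h hI) _.
    exact: hcd.
have s2 tb : t0 - delta <= tb <= t0 + delta -> f2 (tb, h0 - eta) < 0 /\ 0 < f2 (tb,
  h0 + eta).
  move=> tbI; have S20 : 0 <= S / 2 by rewrite divr_ge0// ltW.
  split.
  - apply: (shift_sign tb (h0 - eta) tbI edgem _).2 => //.
    by rewrite /b ler_wpM2r// ge_min lexx orbT.
  - apply: (shift_sign tb (h0 + eta) tbI edgep _).1 => //.
    by rewrite /b ler_wpM2r// ge_min lexx.
have [[tb h] [/= tbI hI z1 z2]] := poincare_miranda f1 f2 _ _ _ _ lt1 lt2 cf1 cf2 s1 s2.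
have [ch Y0 cl hX] := rect tb h tbI hI.
have x0E : x0 (tb, h) = q (tau 0%N - tb) h by rewrite /x0/= clamp_id//; exact: hcd.
have tA : `|tb - t0| <= dA by apply: le_trans (tn tb tbI) _.
have hA : `|h - h0| <= dA by apply: le_trans (hn h hI) _.
have tube u : tau 0%N <= u <= tau N ->
    `|q (u - tb) h - q (u - t0) h0| <= Num.min (rho / 2) (rr / 2).
  by move=> uI; apply: tubeA => //; exact: hcd.
have tau0N : tau 0%N <= tau N by exact: tau_le.
have close0 : `|x0 (tb, h) - z0| <= rr.
  rewrite x0E; apply: le_trans (tube (tau 0%N) _) _; first by rewrite lexx.
  by rewrite ge_min (half_le _ rr0) orbT.
(* The end point is compared with [q (tau N - t0) h0], which is again [z0] by resonance. *)
have closeN : `|X (tb, h) - z0| <= rr.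
  have tube' := tube (tau N); rewrite lexx andbT in tube'; have {}tube' := tube' tau0N.
  rewrite /tau tauN -!(addrAC _ (- _) P) q_periodic -/(tau 0%N) -/z0 in tube'.
  apply: norm_sub_half (le_trans hX ddrr) _.
  by apply: le_trans tube' _; rewrite ge_min lexx orbT.
have HX : H (X (tb, h)) = H (x0 (tb, h)).
  move: z1; rewrite /f1 => /eqP; rewrite mulf_eq0 (negPf DM0)/= mulf_eq0.
  by rewrite -normr_eq0 gt_eqF//= subr_eq0 => /eqP.
have TX : tang (X (tb, h)) = tang (x0 (tb, h)).
  by move: z2; rewrite /f2 => /eqP; rewrite mulf_eq0 (negPf DO0)/= subr_eq0 => /eqP.
have XE : X (tb, h) = x0 (tb, h) by apply: inj.
exists (U (x0 (tb, h))), (Y (x0 (tb, h))); split => //.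
  by rewrite -/(X (tb, h)) XE (flowP _).1.
move=> i u iN uI; apply: norm_sub_half (le_trans (cl i u iN uI) ddrho) _.
by apply: le_trans (tube u (inN i u iN uI)) _; rewrite ge_min lexx.
Qed.

(* Among the periodic solutions for a given [eps], one is chosen whose distance
   to the unperturbed orbit is within [eps] of the infimum. *)
Lemma melnikov_sufficient (t0 : R) : M t0 h0 = 0 ->
  derive1 (Omega Tper) h0 != 0 -> derive1 (fun tb => M tb h0) t0 != 0 ->
  exists2 eps0 : R, 0 < eps0 & exists x : R -> R -> 'cV[R]_2,
    (forall eps, 0 < `|eps| < eps0 -> periodic_solution f g t l P eps (x eps)) /\
    (forall u : R, x eps u @[eps --> 0^'] --> q (u - t0) h0).
Proof.
move=> Mt0 DO0 DM0.
pose near_orbit (e rho : R) := [/\ 0 <= rho & exists x, periodic_solution f g t l P e x /\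
  forall u, `|x u - q (u - t0) h0| <= rho].
have exist rho : 0 < rho -> exists2 e1, 0 < e1 & forall e, 0 < `|e| <= e1 ->
  near_orbit e rho.
  move=> rho0; have [e1 e10 he1] := closed_chain_near_orbit t0 rho Mt0 DO0 DM0 rho0.
  exists e1 => // e eI; split; first exact: ltW.
  have [U [Y [ch YN close]]] := he1 e eI.
  have [x [xsol xU]] := periodic_extension e U Y ch YN.
  exists x; split => // u; have [i [n [iN uI ->]]] := xU u.
  have -> : q (u - t0) h0 = q (u - n%:~R * P - t0) h0.
    rewrite -(periodic_int _ (fun u => q u h0) P q_periodic (u - n%:~R * P - t0) n).
    by congr (q _ _); ring.
  by case/andP: uI => u1 u2; apply: close => //; rewrite ltW.
have [eps0 eps00 h1] := exist 1 ltr01.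
(* [exist] supplies a solution for each tolerance separately, whereas the limit concerns a single
   function of [eps]; a nearly optimal choice serves all tolerances at once. *)
have /choice[x xP] : forall e, exists x : R -> 'cV[R]_2, 0 < `|e| <= eps0 ->
    periodic_solution f g t l P e x /\
    forall rho u, near_orbit e rho -> `|x u - q (u - t0) h0| <= rho + `|e|.
  move=> e; have [eI|] := boolP (0 < `|e| <= eps0); last by exists (cst 0).
  have infD : has_inf [set rho | near_orbit e rho].
    by split; [exists 1; exact: h1|exists 0 => rho []].
  have e0 : 0 < `|e| by case/andP: eI.
  have [rho [rho0 [x [xsol xq]]] hrho] := inf_adherent e0 infD.
  exists x => _; split => // rho' u Arho'; apply: le_trans (xq u) _.
  apply: le_trans (ltW hrho) _; rewrite lerD2r.
  by apply: ge_inf => //; case: infD.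
exists eps0 => //; exists x; split.
  by move=> e /andP[e0 e1]; have [] := xP e; rewrite ?e0 ?ltW.
move=> u; apply/cvgrPdist_le => rho rho0.
have rho2 : 0 < rho / 2 by rewrite divr_gt0.
have [e1 e10 he1] := exist _ rho2.
near=> e; have e0 : 0 < `|e| by rewrite normr_gt0; near: e; exact: nbhs_dnbhs_neq.
have ee1 : `|e| <= e1 by apply: ltW; near: e; exact: dnbhs0_lt.
have eeps : `|e| <= eps0 by apply: ltW; near: e; exact: dnbhs0_lt.
have erho : `|e| <= rho / 2 by apply: ltW; near: e; exact: dnbhs0_lt.
have [|_ hx] := xP e; first by rewrite e0.
rewrite distrC; apply: le_trans (hx (rho / 2) u _) _; first by apply: he1; rewrite e0.
by rewrite [leRHS]splitr lerD2l.
Unshelve. all: by end_near. Qed.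

End system.

Theorem theorem3p1 (R : realType) (r0 r1 : nat)
  (f : 'cV[R]_2 -> 'cV[R]_2) (g : R -> 'cV[R]_2 -> R -> 'cV[R]_2)
  (H : 'cV[R]_2 -> R) (V : set R) (L : R -> set 'cV[R]_2) (Tper : R -> R)
  (q : R -> R -> 'cV[R]_2) (t : int -> R)
  (l : int -> 'cV[R]_2 -> R -> 'cV[R]_2)
  (T1 T2 T h0 : R) (nu p s m K : nat)
  (hr0 : (3 <= r0)%N) (hr1 : (4 <= r1)%N)
  (hf : class_C r0 setT f)
  (hg : class_C r0 setT (fun z : R * 'cV[R]_2 * R => g z.1.1 z.1.2 z.2))
  (hT1 : 0 < T1)
  (hgT1 : forall (tau : R) (x : 'cV[R]_2) (eps : R),
     g (tau + T1) x eps = g tau x eps)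
  (hH : class_C r1 setT H)
  (hfH : forall x : 'cV[R]_2, f x = hamiltonian_field H x)
  (hVopen : open V) (hVint : is_interval V)
  (hfam : periodic_family r0 f H V L Tper q)
  (himp : impulse_data r0 T2 nu t l)
  (hp : (0 < p)%N) (hs : (0 < s)%N) (hps : coprime p s)
  (hT12 : T2 / T1 = p%:R / s%:R)
  (hT : T = p%:R * T1) (hT' : T = s%:R * T2)
  (hh0 : V h0)
  (hm : (0 < m)%N) (hK : (0 < K)%N) (hmK : coprime m K)
  (hres : Tper h0 / T = m%:R / K%:R) :
  let M := melnikov H g t l q T s nu m in
  ((exists x : R -> R -> 'cV[R]_2,
      (\forall eps \near 0^',
         periodic_solution f g t l (m%:R * T) eps (x eps)) /\
      sup_dist (L h0) (x eps) @[eps --> 0^'] --> 0%E) ->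
   exists t0 : R, 0 <= t0 <= T /\ M t0 h0 = 0)
  /\
  (forall t0 : R, 0 <= t0 <= T -> M t0 h0 = 0 ->
     derive1 (Omega Tper) h0 != 0 ->
     derive1 (fun tb : R => M tb h0) t0 != 0 ->
     exists2 eps0 : R, 0 < eps0 &
     exists x : R -> R -> 'cV[R]_2,
       (forall eps : R, 0 < `|eps| < eps0 ->
          ((1 < m)%N -> subharmonic_solution f g t l T m eps (x eps)) /\
          (m = 1%N -> harmonic_solution f g t l T eps (x eps))) /\
       (forall tau : R, x eps tau @[eps --> 0^'] --> q (tau - t0) h0)).
Proof.
have r0_gt0 : (0 < r0)%N by exact: leq_trans hr0.
have r1_gt0 : (0 < r1)%N by exact: leq_trans hr1.
move=> M; split.
  move=> [x [xsol xdist]].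
  exact: (melnikov_necessary r0 r1 f g H V L Tper q t l T1 T2 T h0 nu p s m K
    r0_gt0 r1_gt0 hf hg hT1 hgT1 hH hfH hVopen hfam himp hp hT hT' hh0 hm hK hres
    x xsol xdist).
move=> t0 _ Mt0 DO0 DM0.
have [eps0 eps00 [x [xsol xlim]]] := melnikov_sufficient r0 r1 f g H V L Tper q t l
  T1 T2 T h0 nu p s m K r0_gt0 r1_gt0 hf hg hT1 hgT1 hH hfH hVopen hfam himp hp hs
  hT hT' hh0 hm hK hres t0 Mt0 DO0 DM0.
exists eps0 => //; exists x; split => // eps epsI; split=> [m1|m1].
  by split => //; exact: xsol.
by have := xsol eps epsI; rewrite m1 mul1r.
Qed.
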